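(* Let $q > 2$, and suppose that a compact set $K \subset \mathbb{T}$ supports a non-zero Schwartz distribution $S$ such that $\widehat{S} \in \ell_q(\mathbb{Z})$. Then there is a compact set $K_1 \subset K$ such that: (1) $K_1$ supports a non-zero distribution $S_1$ with $\widehat{S}_1 \in \ell_q(\mathbb{Z})$; (2) $K_1$ does not support any non-zero finite complex Borel measure $\mu$ with $\widehat{\mu} \in \ell_q(\mathbb{Z})$.
   Context: $\mathbb{T} = \mathbb{R}/2\pi\mathbb{Z}$ is the circle. For a Schwartz distribution (or measure) $S$ on $\mathbb{T}$, $\widehat{S}(n)$, $n \in \mathbb{Z}$, denotes its Fourier coefficients. A compact set $K$ supports a distribution or measure if the support of the latter is contained in $K$. *)

(* Defs.v *)
From HB Require Import structures.
From mathcomp Require Import all_boot all_order all_algebra.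
From mathcomp Require Import generic_quotient complex.
From mathcomp Require Import all_classical all_reals all_analysis.

Set Implicit Arguments.
Unset Strict Implicit.
Unset Printing Implicit Defensive.

Import Order.TTheory GRing.Theory Num.Theory.
Import numFieldNormedType.Exports.

Local Open Scope classical_set_scope.
Local Open Scope ring_scope.
Local Open Scope complex_scope.
Local Open Scope quotient_scope.

Section Circle.
Variable R : realType.

Definition circle_rel (x y : R) : bool :=
  `[< exists k : int, x - y = k%:~R * (2 * pi) >].

Lemma circle_rel_refl : reflexive circle_rel.
Proof. by move=> x; apply/asboolP; exists 0; rewrite subrr mul0r. Qed.

Lemma circle_rel_sym : symmetric circle_rel.
Proof.
suff H x y : circle_rel x y -> circle_rel y x by move=> x y; apply/idP/idP; exact: H.
move=> /asboolP[k hk]; apply/asboolP; exists (- k).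
by rewrite -opprB hk rmorphN mulNr.
Qed.

Lemma circle_rel_trans : transitive circle_rel.
Proof.
move=> y x z /asboolP[k hk] /asboolP[l hl]; apply/asboolP; exists (k + l).
by rewrite rmorphD mulrDl -hk -hl addrA subrK.
Qed.

Canonical circle_equiv :=
  EquivRel circle_rel circle_rel_refl circle_rel_sym circle_rel_trans.

Definition circle : Type := quotient_topology {eq_quot circle_equiv}.
HB.instance Definition _ := Quotient.on circle.
HB.instance Definition _ := PointedTopological.on circle.

Definition circle_pi (x : R) : circle := \pi_circle x.

Lemma circle_piP (x y : R) :
  circle_pi x = circle_pi y <-> exists k : int, x - y = k%:~R * (2 * pi).
Proof.
split; first by move=> /(@eqquotP _ _ {eq_quot circle_equiv}) /asboolP.
by move=> h; apply/(@eqquotP _ _ {eq_quot circle_equiv})/asboolP.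
Qed.

(* The character t |-> e^{-int}; its value does not depend on the chosen
   representative of t. *)
Definition character (n : int) (t : circle) : R[i] :=
  let x : R := n%:~R * repr t in cos x -i* sin x.

(* ell_q for a finite exponent q; normc is the modulus, with values in R. *)
Definition ell (q : R) (c : int -> R[i]) : Prop :=
  summable [set: int] (fun n => ((Normc.normc (c n)) `^ q)%:E).

Definition re_lift (phi : circle -> R[i]) (x : R) : R := complex.Re (phi (circle_pi x)).
Definition im_lift (phi : circle -> R[i]) (x : R) : R := complex.Im (phi (circle_pi x)).

Definition smooth (phi : circle -> R[i]) : Prop :=
  forall (k : nat) (x : R),
    derivable (derive1n k (re_lift phi)) x 1 /\ derivable (derive1n k (im_lift phi)) x 1.

Definition iter_derive (k : nat) (phi : circle -> R[i]) (x : R) : R[i] :=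
  derive1n k (re_lift phi) x +i* derive1n k (im_lift phi) x.

(* Smooth functions on the circle have bounded derivatives, so that the sup is
   the actual uniform norm of the k-th derivative. *)
Definition deriv_norm (k : nat) (phi : circle -> R[i]) : R :=
  sup (range (fun x : R => Normc.normc (iter_derive k phi x))).

(* A continuous linear functional on the Frechet space of smooth functions.
   The values of the underlying map on non-smooth arguments are meaningless. *)
Record schwartz_distribution := SchwartzDistribution {
  dist_fun :> (circle -> R[i]) -> R[i] ;
  dist_linear : forall (a : R[i]) (phi psi : circle -> R[i]),
    smooth phi -> smooth psi ->
    dist_fun (fun t => a * phi t + psi t) = a * dist_fun phi + dist_fun psi ;
  dist_continuous : exists (N : nat) (C : R), forall phi : circle -> R[i],
    smooth phi ->
    Normc.normc (dist_fun phi) <= C * \sum_(k < N.+1) deriv_norm k phi }.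

Definition dist_nonzero (S : schwartz_distribution) : Prop :=
  exists2 phi : circle -> R[i], smooth phi & S phi <> 0.

Definition fun_support (phi : circle -> R[i]) : set circle :=
  closure [set t | phi t <> 0].

Definition dist_vanishes_on (S : schwartz_distribution) (U : set circle) : Prop :=
  forall phi : circle -> R[i], smooth phi -> fun_support phi `<=` U -> S phi = 0.

Definition dist_support (S : schwartz_distribution) : set circle :=
  ~` \bigcup_(U in [set U | open U /\ dist_vanishes_on S U]) U.

(* Fourier coefficients are normalized without the factor 1/(2 pi), both here and
   for measures; membership in ell_q is unaffected. *)
Definition dist_fourier (S : schwartz_distribution) (n : int) : R[i] := S (character n).

Definition borel_circle := g_sigma_algebraType (@open circle).

(* The integral of f against a finite signed measure nu, through a Jordan
   decomposition of nu; the result does not depend on the decomposition. *)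
Definition charge_integral (nu : {charge set borel_circle -> \bar R})
    (f : borel_circle -> R) : R :=
  let HP := cid (Hahn_decomposition nu) in
  let nuPN := projT2 (cid (projT2 HP)) in
  (\int[jordan_pos nuPN]_t f t - \int[jordan_neg nuPN]_t f t)%R.

(* A finite complex Borel measure, given by its real and imaginary parts, which
   are arbitrary finite signed Borel measures. *)
Record complex_measure := ComplexMeasure {
  re_measure : {charge set borel_circle -> \bar R} ;
  im_measure : {charge set borel_circle -> \bar R} }.

Definition cmeas (mu : complex_measure) (A : set borel_circle) : R[i] :=
  fine (re_measure mu A) +i* fine (im_measure mu A).

Definition meas_nonzero (mu : complex_measure) : Prop :=
  exists2 A : set borel_circle, measurable A & cmeas mu A <> 0.

Definition meas_vanishes_on (mu : complex_measure) (U : set circle) : Prop :=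
  forall A : set borel_circle, measurable A -> A `<=` U -> cmeas mu A = 0.

Definition meas_support (mu : complex_measure) : set circle :=
  ~` \bigcup_(U in [set U | open U /\ meas_vanishes_on mu U]) U.

Definition complex_integral (mu : complex_measure) (f : circle -> R[i]) : R[i] :=
  let u (t : borel_circle) : R := complex.Re (f t) in
  let v (t : borel_circle) : R := complex.Im (f t) in
  (charge_integral (re_measure mu) u - charge_integral (im_measure mu) v) +i*
  (charge_integral (re_measure mu) v + charge_integral (im_measure mu) u).

Definition meas_fourier (mu : complex_measure) (n : int) : R[i] :=
  complex_integral mu (character n).

End Circle.

(* Main.v *)
(** Fix delta > 0 small and multiply the given distribution S successively by smooth
functions f_k(t) = g_k(Lambda_k t), where Lambda_k is a large integer and g_k vanishes
wherever the lacunary average X_m(t) = (1/m) sum_(j < m) cos(10^j t) is at most delta,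
while its Fourier coefficients are close to those of the constant 1 in l_q.  Such g_k
exist because q > 2: in the Riesz products prod_(j < m) (1 + a cos(10^j t)) a frequency
built from k of the 10^j has coefficient (a/2)^k, and a linear combination of a few of
these products with a of the same size cancels all k <= L; the rest is small in l_q,
and the mass of the combination is concentrated in L^2 where X_m is about a/2.  When
Lambda_k is large the frequencies decouple, so that multiplication by f_k increases the
l_q norm and moves every Fourier coefficient as little as desired.  In the limit S_1 is
non-zero, has coefficients in l_q, and is supported by K_1, the part of K where
Y_k(t) = X_(m_k)(Lambda_k t) >= delta for all k.

If a measure mu on K_1 has coefficients tending to 0, then \int Y_k p dmu -> 0 for
every trigonometric polynomial p, hence for Lipschitz functions, indicators of open
sets and finally of all Borel sets.  Applied to a Hahn set of the real or imaginary
part, where Y_k >= delta almost everywhere, this forces mu = 0. *)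

Require Import Defs.
From HB Require Import structures.
From mathcomp Require Import all_boot all_order all_algebra.
From mathcomp Require Import complex ring lra zify.
From mathcomp Require Import all_classical all_reals all_analysis measurable_realfun.

Set Implicit Arguments.
Unset Strict Implicit.
Unset Printing Implicit Defensive.
Import Order.TTheory GRing.Theory Num.Theory.
Import numFieldNormedType.Exports.
Local Open Scope classical_set_scope.
Local Open Scope ring_scope.
Local Open Scope complex_scope.
Local Open Scope quotient_scope.

(** * Calculus for periodic functions *)

(** A single Riesz product is not close to 1 in l_q: for fixed a its 2m coefficients of order one
    already contribute 2 m (a/2)^q, which grows with m. Cancelling the orders up to L leaves a
    factor exponentially small in L, against a sum over all frequencies of size (1 + C a^q)^m. On
    the other side, the part of the combination on the set where X_m is small has squared L^2 norm
    at most about C^L exp(-c a^2 m), so m is taken to be a large multiple of L / a^2. For such m the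
    sum over frequencies is exp(C' L a^(q - 2)), harmless for small a because q > 2. So a, and with
    it delta, depends on q alone, and only L grows as the error shrinks; a delta common to all
    stages is what the lower bound for Y_k rests on. In the multiplications, Young's inequality
    would cost the l_1 norm of the coefficients of g_k at every stage; for widely spaced frequencies
    the l_q norms essentially multiply, which keeps the total growth as small as desired. *)

Section PointwiseSums.
Variables (T I : Type) (V W : nmodType) (P : (T -> V) -> Prop) (Phi : (T -> V) -> W).
Hypotheses (P0 : P (fun=> 0)) (PD : forall f g, P f -> P g -> P (fun x => f x + g x)).
Hypotheses (Phi0 : Phi (fun=> 0) = 0)
  (PhiD : forall f g, P f -> P g -> Phi (fun x => f x + g x) = Phi f + Phi g).
Variables (s : seq I) (F : I -> T -> V).

Lemma fun_sum_nil : (fun x => \sum_(i <- [::]) F i x) = (fun=> 0).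
Proof. by apply/funext => x; rewrite big_nil. Qed.

Lemma fun_sum_cons i r :
  (fun x => \sum_(j <- i :: r) F j x) = (fun x => F i x + \sum_(j <- r) F j x).
Proof. by apply/funext => x; rewrite big_cons. Qed.

Lemma closed_fun_sum : (forall i, P (F i)) -> P (fun x => \sum_(i <- s) F i x).
Proof.
by move=> H; elim: s => [|i r IH]; rewrite ?fun_sum_nil// fun_sum_cons; exact: PD.
Qed.

Hypothesis PF : forall i, P (F i).

(** [Phi] is additive only on [P], so membership in [P] is carried through the induction. Instances
    are means, distributions and signed integrals. *)
Lemma additive_fun_sum : Phi (fun x => \sum_(i <- s) F i x) = \sum_(i <- s) Phi (F i).
Proof.
suff [] : P (fun x => \sum_(i <- s) F i x) /\
    Phi (fun x => \sum_(i <- s) F i x) = \sum_(i <- s) Phi (F i) by [].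
elim: s => [|i r [Pr IH]]; first by rewrite fun_sum_nil big_nil.
by rewrite fun_sum_cons big_cons PhiD// IH; split=> //; exact: PD.
Qed.

End PointwiseSums.

(** * Smooth functions on the real line *)

Section SmoothReal.
Variable R : realType.
Implicit Types (f g h : R -> R) (x : R).

Definition derivableT f := forall x, derivable f x 1.
(** Differentiability n times, without continuity of the last derivative. The inductions for
    products and compositions run on this finite order: the derivative of a product involves the
    factors themselves, which are known to one order more. *)
Record Ck n f : Prop := MkCk { CkP : forall k, (k < n)%N -> derivableT (derive1n k f) }.
Record smoothR f : Prop := SmoothR { smoothRP : forall k, derivableT (derive1n k f) }.

Lemma smoothR_Ck f : smoothR f <-> forall n, Ck n f.
Proof. by split=> [[H] n|H]; split=> k; [move=> _; exact: H|exact: (CkP (H k.+1))]. Qed.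

Lemma smoothRCk n f : smoothR f -> Ck n f.
Proof. by move=> /smoothR_Ck. Qed.

Lemma CkS n f : Ck n.+1 f <-> derivableT f /\ Ck n (derive1 f).
Proof.
split=> [[H]|[H0 [H]]].
  split; first exact: (H 0%N).
  by split=> k kn; rewrite -derive1Sn; exact: H.
by split=> -[_|k kn]; [exact: H0|rewrite derive1Sn; exact: H].
Qed.

Lemma Ck0 f : Ck 0 f. Proof. by split. Qed.

Lemma CkW n f : Ck n.+1 f -> Ck n f.
Proof. by move=> [H]; split=> k kn; apply: H; rewrite ltnS ltnW. Qed.

Lemma smoothR_derive f : smoothR f -> smoothR (derive1 f).
Proof. by move=> [H]; split=> k; rewrite -derive1Sn; exact: H. Qed.

Lemma smoothR_derivable f : smoothR f -> derivableT f.
Proof. by move=> [H]; exact: (H 0%N). Qed.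

Lemma derivableT_continuous f : derivableT f -> continuous f.
Proof. by move=> H x; apply: differentiable_continuous; apply/derivable1_diffP/H. Qed.

Lemma smoothR_continuous f : smoothR f -> continuous f.
Proof. by move=> /smoothR_derivable/derivableT_continuous. Qed.

Lemma derive1T f df : (forall x, is_derive x 1 f (df x)) -> derive1 f = df.
Proof. by move=> H; apply/funext => x; rewrite derive1E; exact: derive_val. Qed.

Lemma is_deriveT f : derivableT f -> forall x, is_derive x 1 f (derive1 f x).
Proof. by move=> H x; rewrite derive1E; apply/derivableP/H. Qed.

Lemma is_derive_derivableT f df : (forall x, is_derive x 1 f (df x)) -> derivableT f.
Proof. by move=> H x; exact: ex_derive. Qed.

Lemma CkS_is_derive n f df :
  (forall x, is_derive x 1 f (df x)) -> Ck n df -> Ck n.+1 f.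
Proof.
move=> H C; apply/CkS; split; first exact: is_derive_derivableT H.
by rewrite (derive1T H).
Qed.

Lemma derivableT_D f g : derivableT f -> derivableT g ->
  derive1 (f \+ g) = derive1 f \+ derive1 g.
Proof.
move=> /is_deriveT df /is_deriveT dg; exact: derive1T.
Qed.

Lemma derivableT_M f g : derivableT f -> derivableT g ->
  derive1 (f \* g) = (derive1 f \* g) \+ (f \* derive1 g).
Proof.
move=> /is_deriveT df /is_deriveT dg; apply: derive1T => x.
apply: is_derive_eq.
by rewrite /GRing.scale /= addrC mulrC.
Qed.

Lemma Ck_D n f g : Ck n f -> Ck n g -> Ck n (f \+ g).
Proof.
elim: n f g => [|n IH] f g; first by move=> _ _; exact: Ck0.
move=> /CkS[df cf] /CkS[dg cg]; apply/CkS; split.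
  by move=> x; apply: derivableD.
by rewrite (derivableT_D df dg); exact: IH.
Qed.

Lemma Ck_M n f g : Ck n f -> Ck n g -> Ck n (f \* g).
Proof.
elim: n f g => [|n IH] f g; first by move=> _ _; exact: Ck0.
move=> Cf Cg; move: (Cf) (Cg) => /CkS[df cf] /CkS[dg cg]; apply/CkS; split.
  by move=> x; apply: derivableM.
rewrite (derivableT_M df dg); apply: Ck_D; apply: IH; [exact: cf|exact: CkW|exact: CkW|exact: cg].
Qed.

Lemma smoothR_D f g : smoothR f -> smoothR g -> smoothR (f \+ g).
Proof. by move=> /smoothR_Ck H1 /smoothR_Ck H2; apply/smoothR_Ck => n; exact: Ck_D. Qed.

Lemma smoothR_M f g : smoothR f -> smoothR g -> smoothR (f \* g).
Proof. by move=> /smoothR_Ck H1 /smoothR_Ck H2; apply/smoothR_Ck => n; exact: Ck_M. Qed.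

Lemma smoothR_cst (c : R) : smoothR (cst c).
Proof.
have d0 (b : R) x : is_derive x 1 (cst b) 0 by exact: is_derive_cst.
have dS (b : R) : derive1 (cst b) = cst 0 :> (R -> R) by exact: derive1T.
have dd (b : R) : derivableT (cst b) by exact: is_derive_derivableT.
by split=> k; elim: k c => [|k IH] c; [exact: dd|rewrite derive1Sn dS; exact: IH].
Qed.

Lemma smoothR_Z (c : R) f : smoothR f -> smoothR (fun x => c * f x).
Proof. by move=> H; exact (smoothR_M (smoothR_cst c) H). Qed.

Lemma smoothR_N f : smoothR f -> smoothR (\- f).
Proof.
move=> /(smoothR_Z (-1)); congr smoothR.
by apply/funext => x; rewrite mulN1r.
Qed.

Lemma smoothR_B f g : smoothR f -> smoothR g -> smoothR (f \- g).
Proof. by move=> H1 H2; exact (smoothR_D H1 (smoothR_N H2)). Qed.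

Lemma smoothR_X f n : smoothR f -> smoothR (fun x => f x ^+ n).
Proof.
move=> H; elim: n => [|n IH]; first exact: (smoothR_cst 1).
by under [X in smoothR X]eq_fun do rewrite exprS; exact: smoothR_M.
Qed.

Lemma smoothR_sum (I : Type) (r : seq I) (F : I -> R -> R) :
  (forall i, smoothR (F i)) -> smoothR (fun x => \sum_(i <- r) F i x).
Proof. by move=> H; exact: (closed_fun_sum (smoothR_cst 0) smoothR_D). Qed.

Lemma smoothR_prod (I : Type) (r : seq I) (F : I -> R -> R) :
  (forall i, smoothR (F i)) -> smoothR (fun x => \prod_(i <- r) F i x).
Proof.
move=> H; elim: r => [|i r IH].
  by under [X in smoothR X]eq_fun do rewrite big_nil; exact: smoothR_cst.
by under [X in smoothR X]eq_fun do rewrite big_cons; exact: smoothR_M.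
Qed.

Lemma is_derive_comp f g (df dg : R -> R) : (forall x, is_derive x 1 f (df x)) ->
  (forall x, is_derive x 1 g (dg x)) ->
  forall x, is_derive x 1 (f \o g) (df (g x) * dg x).
Proof.
move=> H1 H2 x; by apply: is_derive_eq; rewrite mulrC.
Qed.

Lemma Ck_comp n f g : Ck n f -> Ck n g -> Ck n (f \o g).
Proof.
elim: n f g => [|n IH] f g; first by move=> _ _; exact: Ck0.
move=> Cf Cg; move: (Cf) (Cg) => /CkS[/is_deriveT df cf] /CkS[/is_deriveT dg cg].
apply: (CkS_is_derive (is_derive_comp df dg)).
by apply: (@Ck_M n (derive1 f \o g) _ _ cg); apply: IH; [exact: cf|exact: CkW].
Qed.

Lemma smoothR_comp f g : smoothR f -> smoothR g -> smoothR (f \o g).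
Proof. by move=> /smoothR_Ck H1 /smoothR_Ck H2; apply/smoothR_Ck => n; exact: Ck_comp. Qed.

Lemma smoothR_id : smoothR id.
Proof.
apply/smoothR_Ck; case=> [|n]; first exact: Ck0.
apply: (@CkS_is_derive n _ (cst 1) (fun x => is_derive_id x 1)).
by apply: smoothRCk; exact: smoothR_cst.
Qed.

Lemma smoothR_cos : smoothR cos.
Proof.
apply/smoothR_Ck => n.
(* Each is the derivative of the other up to sign, so both go through one induction. *)
suff : Ck n (@cos R) /\ Ck n (@sin R) by case.
elim: n => [|n [IHc IHs]]; first by split; exact: Ck0.
split; last exact: (CkS_is_derive (@is_derive_sin R)).
apply: (CkS_is_derive (@is_derive_cos R)).
have -> : (fun x : R => - sin x) = cst (-1) \* @sin R.
  by apply/funext => x /=; rewrite mulN1r.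
by apply: Ck_M IHs; apply: smoothRCk; exact: smoothR_cst.
Qed.

Lemma smoothR_sin : smoothR sin.
Proof.
apply/smoothR_Ck; case=> [|n]; first exact: Ck0.
 apply: (CkS_is_derive (@is_derive_sin R)).
by apply: smoothRCk; exact: smoothR_cos.
Qed.

Lemma smoothR_scale f c : smoothR f -> smoothR (fun x => f (c * x)).
Proof. by move=> H; apply: (smoothR_comp H); apply: smoothR_Z; exact: smoothR_id. Qed.

End SmoothReal.

(** * Mean values over a period *)

Section Mean.
Variable R : realType.
Implicit Types (f g h : R -> R) (x : R).

Let mu := @lebesgue_measure R.
Let I : set R := `[0, 2 * pi]%classic.

Definition mean f : R := (2 * pi)^-1 * \int[lebesgue_measure]_(x in `[0, 2 * pi]) f x.

Definition per2pi (T : Type) (f : R -> T) := forall x, f (x + 2 * pi) = f x.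

Let pi2 : 0 < 2 * pi :> R. Proof. by rewrite mulr_gt0// pi_gt0. Qed.

Lemma contD f g : continuous f -> continuous g -> continuous (fun x => f x + g x).
Proof. by move=> cf cg x; apply: continuousD; [exact: cf|exact: cg]. Qed.

Lemma contM f g : continuous f -> continuous g -> continuous (fun x => f x * g x).
Proof. by move=> cf cg x; apply: continuousM; [exact: cf|exact: cg]. Qed.

Lemma cont_cst (c : R) : continuous (fun _ : R => c).
Proof. by move=> x; exact: cst_continuous. Qed.

Lemma contZ c f : continuous f -> continuous (fun x => c * f x).
Proof. by move=> cf; exact: (contM (@cont_cst c)). Qed.

Lemma contN f : continuous f -> continuous (fun x => - f x).
Proof. by move=> cf x; apply: continuousN; exact: cf. Qed.

Lemma contB f g : continuous f -> continuous g -> continuous (fun x => f x - g x).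
Proof. by move=> cf cg; apply: contD => //; exact: contN. Qed.

Lemma cont_sum (J : Type) (r : seq J) (F : J -> R -> R) :
  (forall i, continuous (F i)) -> continuous (fun x => \sum_(i <- r) F i x).
Proof. by move=> H; exact: (closed_fun_sum (@cont_cst 0) contD). Qed.

Lemma continuous_integrable f : continuous f -> mu.-integrable I (EFin \o f).
Proof.
move=> cf; apply: continuous_compact_integrable; first exact: segment_compact.
exact: continuous_subspaceT.
Qed.

Lemma mean_D f g : continuous f -> continuous g ->
  mean (fun x => f x + g x) = mean f + mean g.
Proof.
move=> cf cg; rewrite /mean -mulrDr RintegralD//; exact: continuous_integrable.
Qed.

Lemma mean_Z c f : continuous f -> mean (fun x => c * f x) = c * mean f.
Proof.
move=> cf; rewrite /mean RintegralZl//; last exact: continuous_integrable.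
by rewrite mulrCA.
Qed.

Lemma mean_cst c : mean (fun=> c) = c.
Proof.
rewrite /mean Rintegral_cst//= lebesgue_measure_itv/= lte_fin pi2/= oppr0 addr0.
by rewrite mulrC -mulrA divff ?mulr1// gt_eqF.
Qed.

Lemma mean_le f g : continuous f -> continuous g -> (forall x, f x <= g x) ->
  mean f <= mean g.
Proof.
move=> cf cg fg; rewrite /mean ler_wpM2l//; first by rewrite invr_ge0 ltW.
by apply: le_Rintegral => //; exact: continuous_integrable.
Qed.

Lemma mean_derive1 f : smoothR f -> per2pi f -> mean (derive1 f) = 0.
Proof.
move=> sf pf; rewrite /mean.
have := @continuous_FTC2 R (derive1 f) f 0 (2 * pi) pi2.
rewrite /Rintegral => -> //=.
- by rewrite -[X in f X - _](add0r (2 * pi)) pf subrr mulr0.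
- by apply: continuous_subspaceT; apply: smoothR_continuous; exact: smoothR_derive.
- split.
  + by move=> x _; exact: smoothR_derivable.
  + by apply: cvg_at_right_filter; exact: smoothR_continuous.
  + by apply: cvg_at_left_filter; exact: smoothR_continuous.
Qed.

Lemma mean_sum (J : Type) (r : seq J) (F : J -> R -> R) :
  (forall i, continuous (F i)) ->
  mean (fun x => \sum_(i <- r) F i x) = \sum_(i <- r) mean (F i).
Proof. exact: (additive_fun_sum (@cont_cst 0) contD (mean_cst 0) mean_D). Qed.

Lemma derive1_periodic f : per2pi f -> per2pi (derive1 f).
Proof.
move=> pf x; rewrite /derive1.
suff -> : (fun h : R => h^-1 *: (f (h + (x + 2 * pi)) - f (x + 2 * pi))) =
          (fun h : R => h^-1 *: (f (h + x) - f x)) by [].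
by apply/funext => h; rewrite (addrA h) !pf.
Qed.

Lemma periodic_int (T : Type) (f : R -> T) (k : int) x : per2pi f ->
  f (x + k%:~R * (2 * pi)) = f x.
Proof.
move=> pf; have H (n : nat) y : f (y + n%:R * (2 * pi)) = f y.
  elim: n y => [|n IH] y; first by rewrite mul0r addr0.
  by rewrite -addn1 natrD mulrDl mul1r addrA pf.
case: k => n; first exact: H.
by rewrite NegzE -(H n.+1) mulrNz mulNr subrK.
Qed.

Lemma mod_2pi x : exists k : int, 0 <= x + k%:~R * (2 * pi) <= 2 * pi.
Proof.
exists (- Num.floor (x / (2 * pi))).
have /andP[h1 h2] := floor_itv (x / (2 * pi)).
move: h1 h2; rewrite ler_pdivlMr// ltr_pdivrMr// intrD mulrNz mulNr => h1 h2.
by rewrite subr_ge0 h1 /= lerBlDr ltW// addrC -[X in _ + X]mul1r -mulrDl.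
Qed.

Lemma periodic_bounded f : per2pi f -> continuous f ->
  exists2 M : R, 0 <= M & forall x, `|f x| <= M.
Proof.
move=> pf cf.
have [M [_ HM]] : bounded_set (f @` I).
  apply: compact_bounded; apply: continuous_compact; last exact: segment_compact.
  exact: continuous_subspaceT.
exists (`|M| + 1); first by rewrite addr_ge0.
move=> x; have [k hk] := mod_2pi x.
rewrite -(periodic_int k x pf).
apply: HM; first by rewrite (le_lt_trans (ler_norm _))// ltrDl.
by exists (x + k%:~R * (2 * pi)) => //=; rewrite in_itv.
Qed.

End Mean.

(** * Complex-valued functions, exponentials and Fourier coefficients *)

Section ComplexCalculus.
Variable R : realType.
Notation C := R[i].
Notation Re := complex.Re.
Notation Im := complex.Im.
Implicit Types (p r : R -> C) (x : R) (z w : C).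

Definition nm z : R := Normc.normc z.
Definition rc (a : R) : C := a +i* 0.

Lemma ReD z w : Re (z + w) = Re z + Re w. Proof. by case: z w => [a b] [c d]. Qed.
Lemma ImD z w : Im (z + w) = Im z + Im w. Proof. by case: z w => [a b] [c d]. Qed.
Lemma ReN z : Re (- z) = - Re z. Proof. by case: z. Qed.
Lemma ImN z : Im (- z) = - Im z. Proof. by case: z. Qed.
Lemma ReB z w : Re (z - w) = Re z - Re w. Proof. by rewrite ReD ReN. Qed.
Lemma ImB z w : Im (z - w) = Im z - Im w. Proof. by rewrite ImD ImN. Qed.
Lemma ReM z w : Re (z * w) = Re z * Re w - Im z * Im w.
Proof. by case: z w => [a b] [c d]. Qed.
Lemma ImM z w : Im (z * w) = Re z * Im w + Im z * Re w.
Proof. by case: z w => [a b] [c d]. Qed.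
Lemma complex_ext z w : Re z = Re w -> Im z = Im w -> z = w.
Proof. by case: z w => [a b] [c d] /= -> ->. Qed.
Lemma complex_eta z : z = Re z +i* Im z. Proof. by case: z. Qed.

Lemma nm_ge0 z : 0 <= nm z. Proof. by case: z => a b; rewrite /nm sqrtr_ge0. Qed.
Lemma nm_sqr z : nm z ^+ 2 = Re z ^+ 2 + Im z ^+ 2.
Proof. by case: z => a b; rewrite /nm sqr_sqrtr// addr_ge0// sqr_ge0. Qed.
Lemma Re_le_nm z : `|Re z| <= nm z.
Proof.
rewrite -[X in X <= _]sqrtr_sqr; case: z => a b; rewrite /nm /=.
by rewrite ler_sqrt ?lerDl ?sqr_ge0// addr_ge0// sqr_ge0.
Qed.
Lemma Im_le_nm z : `|Im z| <= nm z.
Proof.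
rewrite -[X in X <= _]sqrtr_sqr; case: z => a b; rewrite /nm /=.
by rewrite ler_sqrt ?lerDr ?sqr_ge0// addr_ge0// sqr_ge0.
Qed.
Lemma nm_real (a : R) : nm (rc a) = `|a|.
Proof. by rewrite /nm /= expr0n addr0 sqrtr_sqr. Qed.
Lemma nmD z w : nm (z + w) <= nm z + nm w. Proof. exact: le_normcD. Qed.
Lemma nmM z w : nm (z * w) = nm z * nm w. Proof. exact: Normc.normcM. Qed.
Lemma nm0 : nm 0 = 0. Proof. exact: Normc.normc0. Qed.
Lemma nm1 : nm 1 = 1. Proof. exact: Normc.normc1. Qed.
Lemma nm_eq0 z : nm z = 0 -> z = 0. Proof. exact: Normc.eq0_normc. Qed.
Lemma nmN z : nm (- z) = nm z. Proof. exact: normcN. Qed.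
Lemma rcD (a b : R) : rc (a + b) = rc a + rc b.
Proof. by apply: complex_ext => //=; rewrite addr0. Qed.
Lemma rcN (a : R) : rc (- a) = - rc a.
Proof. by apply: complex_ext => //=; rewrite oppr0. Qed.
Lemma rcB (a b : R) : rc (a - b) = rc a - rc b.
Proof. by rewrite rcD rcN. Qed.
Lemma rcM (a b : R) : rc (a * b) = rc a * rc b.
Proof. by apply: complex_ext => /=; ring. Qed.
Lemma rc_sum (I : Type) (s : seq I) (F : I -> R) : rc (\sum_(i <- s) F i) = \sum_(i <- s) rc (F i).
Proof. by elim: s => [|i s IH]; rewrite ?big_nil// !big_cons rcD IH. Qed.
Lemma rc_nat n : rc n%:R = n%:R.
Proof. by elim: n => // n IH; rewrite -addn1 !natrD rcD IH. Qed.
Lemma rcI : injective rc. Proof. by move=> a b []. Qed.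
Lemma nm_le z : nm z <= `|Re z| + `|Im z|.
Proof.
rewrite -(@ler_pXn2r _ 2)// ?nnegrE ?nm_ge0 ?addr_ge0//.
by rewrite nm_sqr sqrrD !real_normK ?num_real// -addrA lerD2l addrC lerDl mulrn_wge0// mulr_ge0.
Qed.
Lemma nm_sum (I : Type) (s : seq I) (F : I -> C) :
  nm (\sum_(i <- s) F i) <= \sum_(i <- s) nm (F i).
Proof.
elim: s => [|i s IH]; first by rewrite !big_nil nm0.
by rewrite !big_cons (le_trans (nmD _ _))// lerD2l.
Qed.
Lemma nmB z w : nm (z - w) = nm (w - z).
Proof. by rewrite -nmN opprB. Qed.
Definition cj z : C := Re z -i* Im z.

Lemma cjM z w : cj (z * w) = cj z * cj w.
Proof. by case: z w => [a b] [c d]; apply: complex_ext => /=; ring. Qed.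
Lemma cjB z w : cj (z - w) = cj z - cj w.
Proof. by case: z w => [a b] [c d]; apply: complex_ext => /=; ring. Qed.
Lemma cjD z w : cj (z + w) = cj z + cj w.
Proof. by case: z w => [a b] [c d]; apply: complex_ext => /=; ring. Qed.
Lemma cj_sum (I : Type) (s : seq I) (F : I -> C) :
  cj (\sum_(i <- s) F i) = \sum_(i <- s) cj (F i).
Proof.
elim: s => [|i s IH]; last by rewrite !big_cons cjD IH.
by rewrite !big_nil; apply: complex_ext => //=; rewrite oppr0.
Qed.

Lemma mul_conj z : z * cj z = rc (nm z ^+ 2).
Proof. by rewrite nm_sqr; case: z => a b; apply: complex_ext => /=; ring. Qed.

Record ccont p : Prop := Ccont {
  ccont_Re : continuous (fun x => Re (p x)) ; ccont_Im : continuous (fun x => Im (p x)) }.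
Record csmooth p : Prop := Csmooth {
  csmooth_Re : smoothR (fun x => Re (p x)) ; csmooth_Im : smoothR (fun x => Im (p x)) }.

Definition cD p : R -> C :=
  fun x => derive1 (fun y => Re (p y)) x +i* derive1 (fun y => Im (p y)) x.
Definition cDn k p := iter k cD p.
Definition cmean p : C := mean (fun x => Re (p x)) +i* mean (fun x => Im (p x)).

Lemma csmooth_ccont p : csmooth p -> ccont p.
Proof. by case=> h1 h2; split; exact: smoothR_continuous. Qed.

Lemma csmooth_cD p : csmooth p -> csmooth (cD p).
Proof. by case=> h1 h2; split; exact: smoothR_derive. Qed.

Lemma csmooth_cDn k p : csmooth p -> csmooth (cDn k p).
Proof. by move=> h; elim: k => //= k; exact: csmooth_cD. Qed.

Lemma eq_funR (f g : R -> R) (P : (R -> R) -> Prop) : (forall x, f x = g x) -> P g -> P f.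
Proof. by move=> /funext ->. Qed.

Lemma csmooth_D p r : csmooth p -> csmooth r -> csmooth (fun x => p x + r x).
Proof.
case=> h1 h2 [k1 k2]; split.
- exact: (eq_funR (fun x => ReD _ _) (smoothR_D h1 k1)).
- exact: (eq_funR (fun x => ImD _ _) (smoothR_D h2 k2)).
Qed.

Lemma csmooth_M p r : csmooth p -> csmooth r -> csmooth (fun x => p x * r x).
Proof.
case=> h1 h2 [k1 k2]; split.
- exact: (eq_funR (fun x => ReM _ _) (smoothR_B (smoothR_M h1 k1) (smoothR_M h2 k2))).
- exact: (eq_funR (fun x => ImM _ _) (smoothR_D (smoothR_M h1 k2) (smoothR_M h2 k1))).
Qed.

Lemma csmooth_cst z : csmooth (fun=> z).
Proof. by split; exact: smoothR_cst. Qed.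

Lemma csmooth_Z z p : csmooth p -> csmooth (fun x => z * p x).
Proof. exact: (csmooth_M (csmooth_cst z)). Qed.

Lemma csmooth_N p : csmooth p -> csmooth (fun x => - p x).
Proof.
move=> /(csmooth_Z (-1)); congr csmooth.
by apply/funext => x; rewrite mulN1r.
Qed.

Lemma csmooth_B p r : csmooth p -> csmooth r -> csmooth (fun x => p x - r x).
Proof. by move=> h1 h2; apply: csmooth_D => //; exact: csmooth_N. Qed.

Lemma csmooth_sum (I : Type) (s : seq I) (F : I -> R -> C) :
  (forall i, csmooth (F i)) -> csmooth (fun x => \sum_(i <- s) F i x).
Proof. by move=> H; exact: (closed_fun_sum (csmooth_cst 0) csmooth_D). Qed.

Lemma csmooth_real (f : R -> R) : smoothR f -> csmooth (fun x => rc (f x)).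
Proof. by move=> h; split => //=; exact: smoothR_cst. Qed.

Lemma ccont_D p r : ccont p -> ccont r -> ccont (fun x => p x + r x).
Proof.
case=> h1 h2 [k1 k2]; split.
- exact: (@eq_funR _ _ (fun f => continuous f) (fun x => ReD _ _) (contD h1 k1)).
- exact: (@eq_funR _ _ (fun f => continuous f) (fun x => ImD _ _) (contD h2 k2)).
Qed.

Lemma ccont_M p r : ccont p -> ccont r -> ccont (fun x => p x * r x).
Proof.
case=> h1 h2 [k1 k2]; split.
- exact: (@eq_funR _ _ (fun f => continuous f) (fun x => ReM _ _) (contB (contM h1 k1) (contM h2 k2))).
- exact: (@eq_funR _ _ (fun f => continuous f) (fun x => ImM _ _) (contD (contM h1 k2) (contM h2 k1))).
Qed.

Lemma ccont_cst z : ccont (fun=> z).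
Proof. by split; exact: cont_cst. Qed.

Lemma ccont_Z z p : ccont p -> ccont (fun x => z * p x).
Proof. exact: (ccont_M (ccont_cst z)). Qed.

Lemma ccont_conj p : ccont p -> ccont (fun x => cj (p x)).
Proof.
case=> h1 h2; split.
- by apply: (@eq_funR _ _ (fun f => continuous f) _ h1) => x; case: (p x).
- by apply: (@eq_funR _ _ (fun f => continuous f) _ (contN h2)) => x; case: (p x).
Qed.

Lemma ccont_real (f : R -> R) : continuous f -> ccont (fun x => rc (f x)).
Proof. by move=> h; split => //=; exact: cont_cst. Qed.

Lemma ccont_sum (I : Type) (s : seq I) (F : I -> R -> C) :
  (forall i, ccont (F i)) -> ccont (fun x => \sum_(i <- s) F i x).
Proof. by move=> H; exact: (closed_fun_sum (ccont_cst 0) ccont_D). Qed.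

Lemma cmean_D p r : ccont p -> ccont r ->
  cmean (fun x => p x + r x) = cmean p + cmean r.
Proof.
case=> h1 h2 [k1 k2]; apply: complex_ext => /=.
- by under eq_fun do rewrite ReD; rewrite mean_D.
- by under eq_fun do rewrite ImD; rewrite mean_D.
Qed.

Lemma mean_B (f g : R -> R) : continuous f -> continuous g ->
  mean (fun x => f x - g x) = mean f - mean g.
Proof.
move=> cf cg; rewrite mean_D//; last exact: contN.
congr (_ + _); rewrite -mulN1r -mean_Z//.
by congr mean; apply/funext => x; rewrite mulN1r.
Qed.

Lemma cmean_Z z p : ccont p -> cmean (fun x => z * p x) = z * cmean p.
Proof.
case=> h1 h2; apply: complex_ext; rewrite ?ReM ?ImM /=.
- under eq_fun do rewrite ReM.
  by rewrite mean_B ?mean_Z//; exact: contZ.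
- under eq_fun do rewrite ImM.
  by rewrite mean_D ?mean_Z//; exact: contZ.
Qed.

Lemma cmean_B p r : ccont p -> ccont r ->
  cmean (fun x => p x - r x) = cmean p - cmean r.
Proof.
case=> h1 h2 [k1 k2]; apply: complex_ext; rewrite ?ReB ?ImB /=.
- by under eq_fun do rewrite ReB; rewrite mean_B.
- by under eq_fun do rewrite ImB; rewrite mean_B.
Qed.

Lemma cmean_cst z : cmean (fun=> z) = z.
Proof. by rewrite /cmean !mean_cst -complex_eta. Qed.

Lemma cmean_sum (I : Type) (s : seq I) (F : I -> R -> C) :
  (forall i, ccont (F i)) ->
  cmean (fun x => \sum_(i <- s) F i x) = \sum_(i <- s) cmean (F i).
Proof. exact: (additive_fun_sum (ccont_cst 0) ccont_D (cmean_cst 0) cmean_D). Qed.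

Lemma cmean_conj p : ccont p -> cmean (fun x => cj (p x)) = cj (cmean p).
Proof.
case=> h1 h2; apply: complex_ext => /=.
- by congr mean; apply/funext => x; case: (p x).
- rewrite -mulN1r -mean_Z//.
  by congr mean; apply/funext => x; case: (p x) => a b /=; rewrite mulN1r.
Qed.

Lemma cmean_real (f : R -> R) : cmean (fun x => rc (f x)) = rc (mean f).
Proof. by apply: complex_ext => //=; rewrite mean_cst. Qed.

Lemma normr_mean_le (f g : R -> R) : continuous f -> continuous g ->
  (forall x, `|f x| <= g x) -> `|mean f| <= mean g.
Proof.
move=> cf cg H; rewrite ler_norml; apply/andP; split.
  rewrite -[X in X <= _]mulN1r -mean_Z//; apply: mean_le => //; first exact: contZ.
  by move=> x; rewrite mulN1r; have := H x; rewrite ler_norml => /andP[].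
by apply: mean_le => // x; exact: le_trans (ler_norm _) (H x).
Qed.

(** The factor 2 comes from bounding real and imaginary parts separately; it reappears in the later
    bounds on Fourier coefficients. *)
Lemma nm_cmean p M : ccont p -> (forall x, nm (p x) <= M) ->
  nm (cmean p) <= 2 * M.
Proof.
case=> h1 h2 H; rewrite (le_trans (nm_le _))// mulr_natl mulr2n.
apply: lerD; rewrite -[leRHS](mean_cst M); apply: normr_mean_le => //; try exact: cont_cst.
  by move=> x; exact: le_trans (Re_le_nm _) (H x).
by move=> x; exact: le_trans (Im_le_nm _) (H x).
Qed.

Lemma cD_D p r : csmooth p -> csmooth r ->
  cD (fun x => p x + r x) = (fun x => cD p x + cD r x).
Proof.
case=> /smoothR_derivable h1 /smoothR_derivable h2 [/smoothR_derivable k1 /smoothR_derivable k2].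
apply/funext => x; apply: complex_ext => /=.
- under eq_fun do rewrite ReD.
  by have /= := congr1 (@^~ x) (derivableT_D h1 k1).
- under eq_fun do rewrite ImD.
  by have /= := congr1 (@^~ x) (derivableT_D h2 k2).
Qed.

Lemma derivableT_B (f g : R -> R) : derivableT f -> derivableT g ->
  derive1 (f \- g) = derive1 f \- derive1 g.
Proof.
move=> /is_deriveT df /is_deriveT dg; exact: derive1T.
Qed.

Lemma smoothRdM (f g : R -> R) : smoothR f -> smoothR g -> derivableT (f \* g).
Proof. by move=> h1 h2; apply: smoothR_derivable; exact: smoothR_M. Qed.

Lemma cD_M p r : csmooth p -> csmooth r ->
  cD (fun x => p x * r x) = (fun x => cD p x * r x + p x * cD r x).
Proof.
case=> h1 h2 [k1 k2].
move: (h1) (h2) (k1) (k2) => /smoothR_derivable d1 /smoothR_derivable d2 /smoothR_derivable d3 /smoothR_derivable d4.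
apply/funext => x; apply: complex_ext.
- rewrite /cD /= ReD !ReM /=.
  under eq_fun do rewrite ReM.
  have /= -> := congr1 (@^~ x) (derivableT_B (smoothRdM h1 k1) (smoothRdM h2 k2)).
  rewrite (derivableT_M d1 d3) (derivableT_M d2 d4) /=; ring.
- rewrite /cD /= ImD !ImM /=.
  under eq_fun do rewrite ImM.
  have /= -> := congr1 (@^~ x) (derivableT_D (smoothRdM h1 k2) (smoothRdM h2 k1)).
  rewrite (derivableT_M d1 d4) (derivableT_M d2 d3) /=; ring.
Qed.

Lemma cD_cst z : cD (fun=> z) = (fun=> 0).
Proof.
apply/funext => x.
have H (c : R) : derive1 (fun=> c : R) x = 0 by rewrite (derive1T (fun x => is_derive_cst c x 1)).
by apply: complex_ext; rewrite /cD /= H.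
Qed.

Lemma cD_Z z p : csmooth p -> cD (fun x => z * p x) = (fun x => z * cD p x).
Proof.
move=> h; rewrite (cD_M (csmooth_cst z) h) cD_cst.
by apply/funext => x; rewrite mul0r add0r.
Qed.

Lemma cDn_D k p r : csmooth p -> csmooth r ->
  cDn k (fun x => p x + r x) = (fun x => cDn k p x + cDn k r x).
Proof.
move=> h1 h2; elim: k => //= k ->; rewrite cD_D//; exact: csmooth_cDn.
Qed.

Lemma cDn_Z k z p : csmooth p -> cDn k (fun x => z * p x) = (fun x => z * cDn k p x).
Proof.
move=> h1; elim: k => //= k ->; rewrite cD_Z//; exact: csmooth_cDn.
Qed.

Lemma cDn_B k p r : csmooth p -> csmooth r ->
  cDn k (fun x => p x - r x) = (fun x => cDn k p x - cDn k r x).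
Proof.
move=> h1 h2.
have -> : (fun x => p x - r x) = (fun x => p x + (-1) * r x).
  by apply/funext => x; rewrite mulN1r.
rewrite cDn_D//; last exact: csmooth_Z.
by rewrite cDn_Z//; apply/funext => x; rewrite mulN1r.
Qed.

Lemma cDn_sum k (I : Type) (s : seq I) (F : I -> R -> C) :
  (forall i, csmooth (F i)) ->
  cDn k (fun x => \sum_(i <- s) F i x) = (fun x => \sum_(i <- s) cDn k (F i) x).
Proof.
move=> H; elim: s => [|i s IH].
  rewrite fun_sum_nil; have -> : cDn k (fun=> 0) = (fun=> 0) by elim: k => //= k ->; rewrite cD_cst.
  by apply/funext => x; rewrite big_nil.
rewrite fun_sum_cons cDn_D//; last exact: csmooth_sum.
by rewrite IH; apply/funext => x; rewrite big_cons.
Qed.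

Lemma cmean_cD p : csmooth p -> per2pi p -> cmean (cD p) = 0.
Proof.
case=> h1 h2 pp; apply: complex_ext => /=; apply: mean_derive1 => // x; by rewrite pp.
Qed.

Lemma periodic_cD p : per2pi p -> per2pi (cD p).
Proof.
move=> h x; rewrite /cD; congr (_ +i* _); apply: derive1_periodic => y; by rewrite h.
Qed.

Lemma periodic_cDn k p : per2pi p -> per2pi (cDn k p).
Proof. by move=> h; elim: k => //= k; exact: periodic_cD. Qed.

Lemma periodicM p r : per2pi p -> per2pi r -> per2pi (fun x => p x * r x).
Proof. by move=> h1 h2 x; rewrite h1 h2. Qed.

Definition e (n : int) x : C := cos (n%:~R * x) +i* sin (n%:~R * x).

Lemma e0 x : e 0 x = 1.
Proof. by rewrite /e mul0r cos0 sin0. Qed.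

Lemma eD m n x : e (m + n) x = e m x * e n x.
Proof.
by rewrite /e rmorphD/= mulrDl cosD sinD; apply: complex_ext => //=; rewrite addrC mulrC [X in _ + X]mulrC addrC.
Qed.

Lemma e_conj n x : cj (e n x) = e (- n) x.
Proof. by rewrite /e mulrNz mulNr cosN sinN. Qed.

Lemma eN n x : e n x * e (- n) x = 1.
Proof. by rewrite -eD subrr e0. Qed.

Lemma e_add n x y : e n (x + y) = e n x * e n y.
Proof.
by rewrite /e mulrDr cosD sinD; apply: complex_ext => //=; rewrite addrC mulrC [X in _ + X]mulrC addrC.
Qed.

Lemma e_opp n x : e n (- x) = e (- n) x.
Proof. by rewrite /e mulrN mulrNz mulNr. Qed.

Lemma e_scale n (k : int) x : e n (k%:~R * x) = e (n * k) x.
Proof. by rewrite /e mulrA intrM. Qed.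

Lemma nm_e n x : nm (e n x) = 1.
Proof. by rewrite /nm /= cos2Dsin2 sqrtr1. Qed.

Lemma e_periodic n : per2pi (e n).
Proof.
have c1 : per2pi (@cos R) by move=> x; rewrite mulr_natl cosD2pi.
have s1 : per2pi (@sin R) by move=> x; rewrite mulr_natl sinD2pi.
by move=> x; rewrite /e mulrDr (periodic_int _ _ c1) (periodic_int _ _ s1).
Qed.

Lemma csmooth_e n : csmooth (e n).
Proof. by split; apply: smoothR_scale; [exact: smoothR_cos|exact: smoothR_sin]. Qed.

Lemma ccont_e n : ccont (e n).
Proof. by apply: csmooth_ccont; exact: csmooth_e. Qed.

Lemma cD_e n : cD (e n) = (fun x => 'i * rc (n%:~R) * e n x).
Proof.
have is_lin x : is_derive x 1 (fun y : R => n%:~R * y) n%:~R.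
  have := @is_deriveZ R R^o R^o id n%:~R x 1 1 (is_derive_id x 1).
  by rewrite /GRing.scale /= mulr1.
apply/funext => x; apply: complex_ext; rewrite /cD /=.
- by rewrite (derive1T (is_derive_comp (@is_derive_cos R) is_lin)); ring.
- by rewrite (derive1T (is_derive_comp (@is_derive_sin R) is_lin)); ring.
Qed.

(** For [n != 0] the function [e n] is, up to the factor ['i * n], the derivative of a periodic
    function, and such a derivative has mean zero. *)
Lemma cmean_e n : cmean (e n) = (n == 0)%:R.
Proof.
have [->|n0] := eqVneq n 0.
  by rewrite (_ : e 0 = fun=> 1) ?cmean_cst//; apply/funext => x; exact: e0.
have /= := cmean_cD (csmooth_e n) (@e_periodic n).
rewrite cD_e cmean_Z; last exact: ccont_e.
move=> /eqP; rewrite mulf_eq0 => /orP[|/eqP //].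
rewrite mulf_eq0 => /orP[/eqP [] /eqP|]; first by rewrite oner_eq0.
by move=> /eqP[] /eqP; rewrite intr_eq0 (negbTE n0).
Qed.

Definition fc p (n : int) : C := cmean (fun x => p x * e (- n) x).

Lemma ccont_fc p n : ccont p -> ccont (fun x => p x * e n x).
Proof. by move=> h; apply: ccont_M => //; exact: ccont_e. Qed.

(** Integration by parts: the derivative of [p] times [e (- n)] has mean zero. *)
Lemma fc_cD p n : csmooth p -> per2pi p -> fc (cD p) n = 'i * rc (n%:~R) * fc p n.
Proof.
move=> h pp; rewrite /fc; have := cmean_cD (csmooth_M h (csmooth_e (- n))) (periodicM pp (@e_periodic (- n))).
rewrite cD_M//; last exact: csmooth_e.
rewrite cD_e cmean_D; last 2 first.
- by apply: ccont_fc; apply: csmooth_ccont; exact: csmooth_cD.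
- by apply: ccont_M; [exact: csmooth_ccont|apply: ccont_Z; exact: ccont_e].
move=> /eqP; rewrite addr_eq0 => /eqP ->.
rewrite -mulN1r -!cmean_Z; last 2 first.
- by apply: ccont_fc; exact: csmooth_ccont.
- by apply: ccont_M; [exact: csmooth_ccont|apply: ccont_Z; exact: ccont_e].
congr cmean; apply/funext => x; rewrite mulrNz rcN; ring.
Qed.

End ComplexCalculus.

(** * Fejer means *)

Section Fejer.
Variable R : realType.
Notation C := R[i].
Notation Re := complex.Re.
Notation Im := complex.Im.
Implicit Types (p r : R -> C) (x y : R) (z w : C).

Lemma cmean_eM (m n : int) : cmean (fun x => e m x * e n x) = (m + n == 0)%:R :> C.
Proof. by rewrite -cmean_e; congr cmean; apply/funext => x; rewrite eD. Qed.

Lemma ccont_B p r : ccont p -> ccont r -> ccont (fun x => p x - r x).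
Proof.
move=> h1 h2; apply: ccont_D => //.
have -> : (fun x => - r x) = (fun x => (-1) * r x) by apply/funext => x; rewrite mulN1r.
exact: ccont_Z.
Qed.

Lemma fc_sum (s : seq int) (c : int -> C) n : uniq s ->
  fc (fun x => \sum_(k <- s) c k * e k x) n = if n \in s then c n else 0.
Proof.
move=> us; rewrite /fc.
have -> : (fun x => (\sum_(k <- s) c k * e k x) * e (- n) x) =
   (fun x => \sum_(k <- s) c k * (e k x * e (- n) x)).
  by apply/funext => x; rewrite mulr_suml; apply: eq_bigr => k _; rewrite mulrA.
rewrite cmean_sum; last by move=> k; apply: ccont_Z; apply: ccont_fc; exact: ccont_e.
under eq_bigr => k _.
  rewrite cmean_Z; last by apply: ccont_fc; exact: ccont_e.
  rewrite cmean_eM subr_eq0 mulr_natr mulrb; over.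
rewrite -big_mkcond /=; case: ifP => ns.
  rewrite (big_rem n) //= eqxx big1_seq ?addr0// => k /andP[/eqP -> ].
  by rewrite mem_rem_uniq// inE eqxx.
by rewrite big1_seq// => k /andP[/eqP ->]; rewrite ns.
Qed.

Lemma bessel p (s : seq int) : ccont p -> uniq s ->
  \sum_(n <- s) nm (fc p n) ^+ 2 <= mean (fun x => nm (p x) ^+ 2).
Proof.
move=> cp us.
pose q x : C := \sum_(n <- s) fc p n * e n x.
have cq : ccont q by apply: ccont_sum => n; apply: ccont_Z; exact: ccont_e.
have cpq : ccont (fun x => p x - q x) by exact: ccont_B.
have cn r : ccont r -> continuous (fun x => nm (r x) ^+ 2).
  case=> h1 h2.
  have -> : (fun x => nm (r x) ^+ 2) = (fun x => Re (r x) * Re (r x) + Im (r x) * Im (r x)).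
    by apply/funext => x; rewrite nm_sqr !expr2.
  by apply: contD; exact: contM.
have H : rc (mean (fun x => nm (p x - q x) ^+ 2)) =
    rc (mean (fun x => nm (p x) ^+ 2)) - rc (\sum_(n <- s) nm (fc p n) ^+ 2).
  rewrite -!cmean_real.
  (* The first sum has mean [\sum_(n <- s) nm (fc p n) ^+ 2]; the second has mean zero, because
     [p - q] is orthogonal to [e n] for every [n] in [s]. *)
  have -> : (fun x => rc (nm (p x - q x) ^+ 2)) = (fun x => rc (nm (p x) ^+ 2) -
      (\sum_(n <- s) cj (fc p n) * (p x * e (- n) x) + \sum_(n <- s) fc p n * (cj (p x * e (- n) x) - cj (q x * e (- n) x)))).
    apply/funext => x.
    have q1 : cj (q x) * p x = \sum_(n <- s) cj (fc p n) * (p x * e (- n) x).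
      rewrite /q cj_sum mulr_suml; apply: eq_bigr => n _.
      by rewrite cjM e_conj; ring.
    have q2 : q x * (cj (p x) - cj (q x)) = \sum_(n <- s) fc p n * (cj (p x * e (- n) x) - cj (q x * e (- n) x)).
      rewrite mulr_suml; apply: eq_bigr => n _.
      by rewrite !cjM e_conj opprK; ring.
    by rewrite -q1 -q2 -!mul_conj cjB; ring.
  have c1 n : ccont (fun x => p x * e (- n) x) by exact: ccont_fc.
  have c2 n : ccont (fun x => q x * e (- n) x) by exact: ccont_fc.
  have c3 n : ccont (fun x => cj (p x * e (- n) x) - cj (q x * e (- n) x)).
    by apply: ccont_B; apply: ccont_conj.
  rewrite cmean_B; last 2 first.
  - by apply: ccont_real; exact: cn.
  - by apply: ccont_D; apply: ccont_sum => n; exact: ccont_Z.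
  rewrite cmean_D; try by apply: ccont_sum => n; exact: ccont_Z.
  rewrite !cmean_sum; try by move=> n; exact: ccont_Z.
  congr (_ - _); rewrite [X in _ + X]big1_seq ?addr0.
    rewrite rc_sum; apply: eq_bigr => n _.
    by rewrite cmean_Z// -mul_conj mulrC.
  move=> n /andP[_ ns]; rewrite cmean_Z// cmean_B; try exact: ccont_conj.
  rewrite !cmean_conj// -/(fc p n) -/(fc q n).
  by rewrite (fc_sum _ _ us) ns subrr mulr0.
move: H => /(congr1 (fun z : C => Re z)); rewrite ReB /= => H.
rewrite -subr_ge0 -H -[leLHS](mean_cst (0 : R)); apply: mean_le.
- exact: cont_cst.
- exact: cn.
- by move=> x; rewrite sqr_ge0.
Qed.

Definition fejer_kernel (N : nat) (u : R) : R :=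
  N%:R^-1 * nm (\sum_(a < N) e a%:Z u) ^+ 2.

(** The frequency n occurs N - |n| times as a difference a - b, so the usual weights 1 - |n|/N stay
    implicit. *)
Definition fejer (N : nat) p x : C :=
  rc N%:R^-1 * \sum_(a < N) \sum_(b < N) fc p (a%:Z - b%:Z) * e (a%:Z - b%:Z) x.

Lemma fejer_kernelE N u : rc (fejer_kernel N u) =
  rc N%:R^-1 * \sum_(a < N) \sum_(b < N) e (a%:Z - b%:Z) u.
Proof.
rewrite /fejer_kernel rcM -mul_conj; congr (_ * _).
rewrite cj_sum mulr_suml; apply: eq_bigr => a _.
by rewrite mulr_sumr; apply: eq_bigr => b _; rewrite eD -e_conj.
Qed.

Lemma fejer_kernel_ge0 N u : 0 <= fejer_kernel N u.
Proof. by rewrite mulr_ge0 ?invr_ge0// sqr_ge0. Qed.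

Lemma ccont_e_sub n x : ccont (fun y => e n (x - y)).
Proof.
have -> : (fun y => e n (x - y)) = (fun y => e n x * e (- n) y).
  by apply/funext => y; rewrite e_add e_opp.
by apply: ccont_Z; exact: ccont_e.
Qed.

Lemma cont_fejer_kernel N x : continuous (fun y => fejer_kernel N (x - y)).
Proof.
have : ccont (fun y => rc (fejer_kernel N (x - y))).
  have -> : (fun y => rc (fejer_kernel N (x - y))) =
    (fun y => rc N%:R^-1 * \sum_(a < N) \sum_(b < N) e (a%:Z - b%:Z) (x - y)).
    by apply/funext => y; exact: fejer_kernelE.
  apply: ccont_Z; apply: ccont_sum => a; apply: ccont_sum => b; exact: ccont_e_sub.
by case.
Qed.

Lemma fejerE N p x : ccont p ->
  fejer N p x = cmean (fun y => p y * rc (fejer_kernel N (x - y))).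
Proof.
move=> cp.
have -> : (fun y => p y * rc (fejer_kernel N (x - y))) =
    (fun y => rc N%:R^-1 * \sum_(a < N) \sum_(b < N)
       e (a%:Z - b%:Z) x * (p y * e (- (a%:Z - b%:Z)) y)).
  apply/funext => y; rewrite fejer_kernelE mulrCA; congr (_ * _).
  rewrite mulr_sumr; apply: eq_bigr => a _; rewrite mulr_sumr; apply: eq_bigr => b _.
  by rewrite e_add e_opp mulrCA.
have cc n : ccont (fun y => e n x * (p y * e (- n) y)) by apply: ccont_Z; exact: ccont_fc.
rewrite cmean_Z; last by apply: ccont_sum => a; apply: ccont_sum => b; exact: cc.
congr (_ * _); rewrite cmean_sum; last by move=> a; apply: ccont_sum => b; exact: cc.
apply: eq_bigr => a _; rewrite cmean_sum; last by move=> b; exact: cc.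
apply: eq_bigr => b _; rewrite cmean_Z; last exact: ccont_fc.
by rewrite mulrC.
Qed.

Lemma fejer_e N n x : fejer N (e n) x =
  rc N%:R^-1 * (\sum_(a < N) \sum_(b < N) (a%:Z - b%:Z == n)%:R) * e n x.
Proof.
rewrite /fejer -mulrA; congr (_ * _); rewrite mulr_suml; apply: eq_bigr => a _.
rewrite mulr_suml; apply: eq_bigr => b _.
rewrite /fc cmean_eM subr_eq0 eq_sym.
by case: eqP => [->|]; rewrite ?mul1r ?mul0r.
Qed.

Lemma count_diag N : \sum_(a < N) \sum_(b < N) (a%:Z - b%:Z == 0)%:R = N%:R :> C.
Proof.
under eq_bigr => a _.
  rewrite (bigD1 a) //= subrr eqxx big1; last first.
    by move=> b ba; rewrite subr_eq0 eqz_nat eq_sym (negbTE ba : (b == a :> nat) = false).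
  rewrite addr0; over.
by rewrite sumr_const card_ord.
Qed.

Lemma count_subdiag N : \sum_(a < N.+1) \sum_(b < N.+1) (a%:Z - b%:Z == 1)%:R = N%:R :> C.
Proof.
rewrite big_ord_recl big1 ?add0r; last by move=> b _; rewrite /= (_ : (_ == _) = false)//; lia.
under eq_bigr => a _.
  rewrite (bigD1 (widen_ord (leqnSn N) a)) //= (_ : (_ == _) = true); last by rewrite /bump; lia.
  rewrite big1; last first.
    move=> b ba; rewrite (_ : (_ == _) = false)//.
    by apply/negbTE; move: ba; apply: contra => /eqP h; apply/eqP/val_inj => /=; rewrite /bump in h; lia.
  rewrite addr0; over.
by rewrite sumr_const card_ord.
Qed.

Lemma mean_fejer_kernel N x : mean (fun y => fejer_kernel N.+1 (x - y)) = 1.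
Proof.
apply: rcI; rewrite -cmean_real.
have -> : (fun y => rc (fejer_kernel N.+1 (x - y))) =
   (fun y => e 0 y * rc (fejer_kernel N.+1 (x - y))).
  by apply/funext => y; rewrite e0 mul1r.
rewrite -fejerE; last exact: ccont_e.
by rewrite fejer_e count_diag e0 mulr1 -rc_nat -rcM mulVf// pnatr_eq0.
Qed.

(** The first Fejer weight. Hence 1 - cos has mean 1/(N + 1) against the kernel, which is the only
    form of concentration used. *)
Lemma mean_fejer_cos N x :
  mean (fun y => cos (x - y) * fejer_kernel N.+1 (x - y)) = N%:R / N.+1%:R.
Proof.
have H : cmean (fun y => e 1 (x - y) * rc (fejer_kernel N.+1 (x - y))) = rc (N%:R / N.+1%:R).
  have -> : (fun y => e 1 (x - y) * rc (fejer_kernel N.+1 (x - y))) =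
      (fun y => e 1 x * (e (-1) y * rc (fejer_kernel N.+1 (x - y)))).
    by apply/funext => y; rewrite e_add e_opp mulrA.
  have cc : ccont (fun y => e (-1) y * rc (fejer_kernel N.+1 (x - y))).
    by apply: ccont_M; [exact: ccont_e|apply: ccont_real; exact: cont_fejer_kernel].
  rewrite cmean_Z// -fejerE; last exact: ccont_e.
  rewrite fejer_e mulrCA eN mulr1 exchange_big/=.
  under eq_bigr => a _ do under eq_bigr => b _ do rewrite -[X in X == _]opprB eqr_opp.
  by rewrite count_subdiag mulrC rcM rc_nat.
move: H => /(congr1 (fun z : C => Re z)) /= <-; congr mean; apply/funext => y.
by rewrite !mulr0 subr0 mul1r.
Qed.

(** Korovkin's argument: |f y - f x| is at most eta + (f y - f x)^2 / eta, the square is at most K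
    (1 - cos (x - y)), and the latter has mean K / (N + 1) against the kernel. *)
Lemma fejer_real (f : R -> R) (K : R) : continuous f -> 0 <= K ->
  (forall x y, (f y - f x) ^+ 2 <= K * (1 - cos (x - y))) ->
  forall N x (eta : R), 0 < eta ->
  `|mean (fun y => f y * fejer_kernel N.+1 (x - y)) - f x| <= eta + K / eta / N.+1%:R.
Proof.
move=> cf K0 H N x eta eta0.
have ck := @cont_fejer_kernel N.+1 x.
have ccos : continuous (fun y => cos (x - y)).
  have -> : (fun y => cos (x - y)) = (fun y => Re (e 1 (x - y))).
    by apply/funext => y /=; rewrite mul1r.
  by case: (ccont_e_sub 1 x).
have -> : mean (fun y => f y * fejer_kernel N.+1 (x - y)) - f x =
    mean (fun y => (f y - f x) * fejer_kernel N.+1 (x - y)).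
  transitivity (mean (fun y => f y * fejer_kernel N.+1 (x - y) - f x * fejer_kernel N.+1 (x - y))).
    rewrite mean_B; [|exact: contM|exact: contZ].
    by rewrite (mean_Z (f x) ck) mean_fejer_kernel mulr1.
  by congr mean; apply/funext => y; rewrite mulrBl.
have -> : eta + K / eta / N.+1%:R = mean (fun y =>
   (eta + K / eta) * fejer_kernel N.+1 (x - y) - K / eta * (cos (x - y) * fejer_kernel N.+1 (x - y))).
  rewrite mean_B; [|exact: contZ|by apply: contZ; exact: contM].
  rewrite (mean_Z _ ck) (mean_Z _ (contM ccos ck)) mean_fejer_kernel mean_fejer_cos mulr1 -addrA; congr (_ + _).
  rewrite -[X in _ = X - _]mulr1 -mulrBr; congr (_ * _).
  by rewrite -[X in _ = X - _](@divff _ N.+1%:R) ?pnatr_eq0// -mulrBl -natr1 addrAC subrr add0r mul1r.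
apply: normr_mean_le.
- by apply: contM => //; apply: contB => //; exact: cont_cst.
- by apply: contB; apply: contZ => //; exact: contM.
move=> y; rewrite normrM (ger0_norm (fejer_kernel_ge0 _ _)).
rewrite [X in _ <= _ - X]mulrA -mulrBl ler_wpM2r ?fejer_kernel_ge0//.
rewrite -addrA -[X in _ + (X - _)]mulr1 -mulrBr.
have h := H x y; set u := f y - f x in h *.
apply: (@le_trans _ _ (eta + u ^+ 2 / eta)); last first.
  by rewrite lerD2l [leRHS]mulrAC ler_wpM2r// invr_ge0 ltW.
have : 0 <= (`|u| - eta) ^+ 2 + eta * `|u| by rewrite addr_ge0 ?sqr_ge0// mulr_ge0// ltW.
rewrite -(real_normK (num_real u)); move: `|u| => v hv.
rewrite -(ler_pM2r eta0) mulrDl divfK ?gt_eqF//; nra.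
Qed.

Lemma sqr_le_cos (u : R) : - pi <= u <= pi -> u ^+ 2 <= 16 * (1 - cos u).
Proof.
have pi0 := @pi_gt0 R.
wlog u0 : u / 0 <= u.
  move=> H /andP[u1 u2]; have [u0|u0] := leP 0 u; first by apply: H => //; rewrite u1.
  by rewrite -sqrrN -cosN; apply: H; lra.
move=> /andP[_ u1].
(* At the quarter angle the cosine is at least 1/2, so sin v >= v/2 by the mean value theorem. Then
   1 - cos (4 v) = 8 sin^2 v cos^2 v >= v^2, since cos^2 v >= 1/2. *)
pose v := u / 4.
have v0 : 0 <= v by rewrite /v divr_ge0.
have v1 : v <= pi / 4 by rewrite /v ler_pM2r.
have hc (w : R) : 0 <= w <= pi / 4 -> 1 / 2 <= cos w /\ 1/2 <= cos w ^+ 2.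
  move=> /andP[w0 w1].
  have c0 : 0 <= cos w by apply: cos_ge0_pihalf; lra.
  have : 0 <= cos (w *+ 2) by apply: cos_ge0_pihalf; rewrite (mulr2n w); lra.
  rewrite cos_mulr2n (mulr2n (_ ^+ 2)) => h; split; last by lra.
  by nra.
have sv : v / 2 <= sin v.
  have [->|vn0] := eqVneq v 0; first by rewrite mul0r sin0.
  have vp : 0 < v by rewrite lt_def vn0.
  have [|c /= hcv] := @MVT R sin cos 0 v vp (fun x _ => is_derive_sin x).
    by apply: continuous_subspaceT => x; exact: continuous_sin.
  rewrite sin0 !subr0 => ->; rewrite mulrC ler_wpM2r//.
  rewrite in_itv/= in hcv; case: (hc c) => [|h _]; first by lra.
  by rewrite -div1r.
have [_ h2] : 1 / 2 <= cos v /\ 1/2 <= cos v ^+ 2 by apply: hc; rewrite v0.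
have -> : u = (v *+ 2) *+ 2 by rewrite /v; rewrite !mulr2n; lra.
rewrite (cos_mulr2n (v *+ 2)) cos_mulr2n.
have h3 := sin2cos2 v.
have h4 : (v / 2) ^+ 2 <= sin v ^+ 2 by rewrite ler_sqr// nnegrE ?divr_ge0// (le_trans _ sv)// divr_ge0.
move: h2 h3 h4; rewrite !mulr2n.
set c := cos v ^+ 2; set s := sin v ^+ 2; move=> h2 h3 h4.
have : 0 <= (c - 1 / 2) * s by rewrite mulr_ge0// ?subr_ge0// sqr_ge0.
rewrite h3 in h4 *.
have e4 : (v / 2) ^+ 2 = v ^+ 2 / 4 by field.
rewrite e4 in h4.
nra.
Qed.

End Fejer.

(** * Uniform convergence of Fejer means and absolute summability of Fourier coefficients *)

Section FejerConvergence.
Variable R : realType.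
Notation C := R[i].
Notation Re := complex.Re.
Notation Im := complex.Im.
Implicit Types (p r : R -> C) (x y : R) (z w : C).

Lemma lipschitz_cos (f : R -> R) (L : R) : per2pi f -> 0 <= L ->
  (forall x y, `|f y - f x| <= L * `|y - x|) ->
  forall x y, (f y - f x) ^+ 2 <= 16 * L ^+ 2 * (1 - cos (x - y)).
Proof.
move=> pf L0 H x y.
(* [sqr_le_cos] holds on one period around 0 only, so [x - y] is first moved into [-pi, pi] by
   periodicity. *)
have [k /andP[hk1 hk2]] := mod_2pi (x - y + pi).
pose u := x - y + k%:~R * (2 * pi).
have hu : - pi <= u <= pi.
  have -> : u = x - y + pi + k%:~R * (2 * pi) - pi by rewrite /u; ring.
  by apply/andP; split; lra.
have -> : cos (x - y) = cos u.
  by rewrite /u periodic_int// => t; rewrite mulr_natl cosD2pi.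
rewrite -(periodic_int k x pf) -(real_normK (num_real (_ - _))).
apply: (@le_trans _ _ ((L * `|u|) ^+ 2)).
  rewrite ler_sqr ?nnegrE ?mulr_ge0//.
  have -> : u = (x + k%:~R * (2 * pi)) - y by rewrite /u; ring.
  by rewrite [X in _ <= _ * X]distrC.
have -> : 16 * L ^+ 2 * (1 - cos u) = L ^+ 2 * (16 * (1 - cos u)) by ring.
by rewrite exprMn real_normK ?num_real// ler_wpM2l ?sqr_ge0// sqr_le_cos.
Qed.

Lemma smooth_lipschitz (f : R -> R) : smoothR f -> per2pi f ->
  exists2 L : R, 0 <= L & forall x y, `|f y - f x| <= L * `|y - x|.
Proof.
move=> sf pf.
have sd := smoothR_derive sf.
have [L L0 HL] := periodic_bounded (derive1_periodic pf) (smoothR_continuous sd).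
exists L => // x y.
wlog xy : x y / x < y.
  move=> H; have [xy|xy|->] := ltgtP x y; first exact: H.
    by rewrite distrC [X in _ <= _ * X]distrC; exact: H.
  by rewrite !subrr normr0 mulr0.
have [|c _ ->] := @MVT R f (derive1 f) x y xy (fun x _ => is_deriveT (smoothR_derivable sf) x).
  by apply: continuous_subspaceT; exact: smoothR_continuous.
by rewrite normrM ler_wpM2r.
Qed.

Lemma Re_mul_rc z (a : R) : Re (z * rc a) = Re z * a.
Proof. by rewrite ReM /= mulr0 subr0. Qed.
Lemma Im_mul_rc z (a : R) : Im (z * rc a) = Im z * a.
Proof. by rewrite ImM /= mulr0 add0r. Qed.

Lemma fejer_lipschitz (f : R -> R) (L : R) : continuous f -> per2pi f -> 0 <= L ->
  (forall x y, `|f y - f x| <= L * `|y - x|) ->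
  forall ep : R, 0 < ep -> exists N0, forall N, (N0 <= N)%N -> forall x,
  `|mean (fun y => f y * fejer_kernel N.+1 (x - y)) - f x| <= ep.
Proof.
move=> cf pf L0 H ep ep0.
pose K := 16 * L ^+ 2.
have K0 : 0 <= K by rewrite mulr_ge0// sqr_ge0.
have e2 : 0 < ep / 2 by rewrite divr_gt0.
have c0 : 0 <= K / (ep / 2) by rewrite divr_ge0// ltW.
exists (Num.truncn (K / (ep / 2) / (ep / 2))) => N hN x.
apply: le_trans (fejer_real cf K0 (lipschitz_cos pf L0 H) N x e2) _.
rewrite [leRHS]splitr lerD2l ler_pdivrMr ?ltr0n// -ler_pdivrMl//.
rewrite mulrC ltW// (lt_le_trans (truncnS_gt _))// ler_nat ltnS.
by rewrite [X in (Num.truncn X <= _)%N]mulrC mulrC in hN *.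
Qed.

Lemma fejer_uniform p : csmooth p -> per2pi p -> forall ep : R, 0 < ep ->
  exists N0, forall N, (N0 <= N)%N -> forall x, nm (fejer N.+1 p x - p x) <= ep.
Proof.
move=> sp pp ep ep0; have cp := csmooth_ccont sp.
case: (sp) => s1 s2; case: (cp) => c1 c2.
have p1 : per2pi (fun x => Re (p x)) by move=> x; rewrite pp.
have p2 : per2pi (fun x => Im (p x)) by move=> x; rewrite pp.
have [L1 L10 H1] := smooth_lipschitz s1 p1.
have [L2 L20 H2] := smooth_lipschitz s2 p2.
have e2 : 0 < ep / 2 by rewrite divr_gt0.
have [N1 K1] := fejer_lipschitz c1 p1 L10 H1 e2.
have [N2 K2] := fejer_lipschitz c2 p2 L20 H2 e2.
exists (maxn N1 N2) => N; rewrite geq_max => /andP[h1 h2] x.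
apply: le_trans (nm_le _) _; rewrite [leRHS]splitr; apply: lerD.
- rewrite ReB fejerE// /cmean /=.
  by under eq_fun do rewrite Re_mul_rc; exact: K1.
- rewrite ImB fejerE// /cmean /=.
  by under eq_fun do rewrite Im_mul_rc; exact: K2.
Qed.

Lemma csmooth_fejer N p : csmooth (fejer N p).
Proof.
apply: csmooth_Z; apply: csmooth_sum => a; apply: csmooth_sum => b.
by apply: csmooth_Z; exact: csmooth_e.
Qed.

Lemma per2pi_fejer N p : per2pi (fejer N p).
Proof.
move=> x; rewrite /fejer; congr (_ * _); apply: eq_bigr => a _; apply: eq_bigr => b _.
by rewrite e_periodic.
Qed.

Lemma cD_fejer N p : csmooth p -> per2pi p -> cD (fejer N p) = fejer N (cD p).
Proof.
move=> sp pp.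
have se n z : csmooth (fun x => z * e n x) by apply: csmooth_Z; exact: csmooth_e.
have cD_sum1 (J : Type) (s : seq J) (F : J -> R -> C) : (forall i, csmooth (F i)) ->
  cD (fun x => \sum_(i <- s) F i x) = (fun x => \sum_(i <- s) cD (F i) x) by exact: (@cDn_sum _ 1).
rewrite /fejer cD_Z; last by apply: csmooth_sum => a; exact: csmooth_sum.
apply/funext => x; congr (_ * _).
rewrite cD_sum1; last by move=> a; exact: csmooth_sum.
apply: eq_bigr => a _; rewrite cD_sum1//; apply: eq_bigr => b _.
by rewrite cD_Z ?cD_e ?fc_cD//; [ring|exact: csmooth_e].
Qed.

(** With [fejer_uniform] this gives convergence of all derivatives, that is, convergence in the
    topology of test functions. *)
Lemma cDn_fejer N k p : csmooth p -> per2pi p -> cDn k (fejer N p) = fejer N (cDn k p).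
Proof.
move=> sp pp; elim: k => //= k ->; rewrite cD_fejer//; first exact: csmooth_cDn.
exact: periodic_cDn.
Qed.

Lemma nm_rc_int (n : int) : nm (rc (n%:~R : R)) = `|n|%:R.
Proof. by rewrite nm_real -intr_norm. Qed.

Lemma nm_i : nm ('i : C) = 1.
Proof. by rewrite /nm /= expr0n add0r expr1n sqrtr1. Qed.

Lemma nm_fc p M n : ccont p -> (forall x, nm (p x) <= M) -> nm (fc p n) <= 2 * M.
Proof.
move=> cp H; apply: nm_cmean; first exact: ccont_fc.
by move=> x; rewrite nmM nm_e mulr1.
Qed.

Lemma fc_decay p M n : csmooth p -> per2pi p -> (forall x, nm (cDn 2 p x) <= M) ->
  n != 0 -> nm (fc p n) <= 2 * M / `|n|%:R ^+ 2.
Proof.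
move=> sp pp H n0.
have := nm_fc n (csmooth_ccont (csmooth_cDn 2 sp)) H.
rewrite -[cDn 2 p]/(cD (cD p)) fc_cD; [|exact: csmooth_cD|exact: periodic_cD].
rewrite fc_cD// !nmM nm_i !mul1r nm_rc_int mulrA -expr2 mulrC.
by rewrite -ler_pdivlMr// exprn_gt0// ltr0n absz_gt0.
Qed.

Lemma le_sum_subset (T : eqType) (s t : seq T) (F : T -> R) : uniq s ->
  {subset s <= t} -> (forall i, 0 <= F i) ->
  \sum_(i <- s) F i <= \sum_(i <- t) F i.
Proof.
move=> + + F0; elim: s t => [|i s IH] t /=.
  by move=> _ _; rewrite big_nil sumr_ge0.
move=> /andP[ni us] st; rewrite big_cons [leRHS](big_rem i) /=; last by apply: st; rewrite inE eqxx.
rewrite lerD2l; apply: IH => // j js.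
have jt : j \in t by apply: st; rewrite inE js orbT.
have ij : j != i by apply: contra ni => /eqP <-.
by have := perm_to_rem (st i (mem_head _ _)) => /perm_mem /(_ j); rewrite jt inE (negbTE ij).
Qed.

(** Telescoping: 1/(k + 1)^2 is below 1/k - 1/(k + 1). *)
Lemma sum_inv_sqr_nat M : \sum_(1 <= k < M.+2) (k%:R ^+ 2)^-1 <= 2 - (M.+1)%:R^-1 :> R.
Proof.
elim: M => [|M IH]; first by rewrite big_nat1 expr1n invr1; lra.
rewrite big_nat_recr//= (le_trans (lerD IH (lexx _)))// -addrA lerD2l.
have h1 : (M.+1)%:R > 0 :> R by rewrite ltr0n.
have h2 : (M.+2)%:R = (M.+1)%:R + 1 :> R by rewrite -natr1.
rewrite h2; move: (M.+1%:R : R) h1 => m m0.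
rewrite -subr_ge0.
have -> : - (m + 1)^-1 - (- m^-1 + ((m + 1) ^+ 2)^-1) = (m * (m + 1) ^+ 2)^-1.
  by field; rewrite !gt_eqF// addr_gt0.
by rewrite invr_ge0 mulr_ge0 ?sqr_ge0// ltW.
Qed.

Lemma sum_inv_sqr (s : seq int) : uniq s -> 0 \notin s ->
  \sum_(n <- s) (`|n|%:R ^+ 2)^-1 <= 4 :> R.
Proof.
move=> us s0.
pose M := \max_(n <- s) `|n|%N.
pose t := [seq k%:Z | k <- index_iota 1 M.+2] ++ [seq - k%:Z | k <- index_iota 1 M.+2].
apply: (@le_trans _ _ (\sum_(n <- t) (`|n|%:R ^+ 2)^-1)).
  apply: le_sum_subset => // n ns.
  have nM : (`|n| <= M)%N by rewrite /M (big_rem n)//= leq_maxl.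
  have n0 : n != 0 by apply: contra s0 => /eqP <-.
  rewrite /t mem_cat; apply/orP; have [np|nn] := leP 0 n; [left|right]; apply/mapP;
    by exists `|n|%N; rewrite ?mem_index_iota; lia.
rewrite /t big_cat !big_map/=.
have H : \sum_(1 <= k < M.+2) (k%:R ^+ 2)^-1 <= 2 :> R.
  by apply: le_trans (sum_inv_sqr_nat M) _; rewrite gerBl invr_ge0.
under [X in _ + X]eq_bigr do rewrite abszN absz_nat.
by apply: le_trans (lerD H H) _; rewrite -natrD.
Qed.

(** Frequency 0 contributes [2 * M0]; the others are at most [2 * M2 / n ^ 2], and the inverse
    squares sum to at most 4. Only two derivatives enter, which is why bounded coefficients later
    give order at most 2. *)
Lemma sum_fc_le p M0 M2 (s : seq int) : csmooth p -> per2pi p ->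
  (forall x, nm (p x) <= M0) -> (forall x, nm (cDn 2 p x) <= M2) -> uniq s ->
  \sum_(n <- s) nm (fc p n) <= 2 * M0 + 8 * M2.
Proof.
move=> sp pp H0 H2 us.
have M00 : 0 <= M0 by apply: le_trans (H0 0); exact: nm_ge0.
have M20 : 0 <= M2 by apply: le_trans (H2 0); exact: nm_ge0.
have K (t : seq int) : uniq t -> 0 \notin t -> \sum_(n <- t) nm (fc p n) <= 8 * M2.
  move=> ut t0; apply: (@le_trans _ _ (\sum_(n <- t) (2 * M2) * (`|n|%:R ^+ 2)^-1)).
    rewrite big_seq [leRHS]big_seq; apply: ler_sum => n nt.
    by apply: fc_decay => //; apply: contra t0 => /eqP <-.
  rewrite -mulr_sumr; have := sum_inv_sqr ut t0.
  by move=> /(ler_wpM2l (mulr_ge0 (ler0n R 2) M20)) /le_trans; apply; lra.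
have [s0|s0] := boolP (0 \in s); last first.
  by apply: le_trans (K _ us s0) _; rewrite lerDr mulr_ge0.
rewrite (big_rem 0)//= lerD//.
  exact: nm_fc (csmooth_ccont sp) H0.
by apply: K; rewrite ?rem_uniq// mem_rem_uniq// inE eqxx.
Qed.

Lemma fc_B p r n : ccont p -> ccont r -> fc (fun x => p x - r x) n = fc p n - fc r n.
Proof.
move=> cp cr; rewrite /fc -cmean_B; [|exact: ccont_fc|exact: ccont_fc].
by congr cmean; apply/funext => x; rewrite mulrBl.
Qed.

Lemma nm_le0P z : (forall ep : R, 0 < ep -> nm z <= ep) -> z = 0.
Proof.
move=> H; apply: nm_eq0; apply/eqP; rewrite eq_le nm_ge0 andbT.
by apply/ler_addgt0Pl => ep ep0; rewrite addr0; exact: H.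
Qed.

Lemma fc_double_sum N (c : nat -> nat -> C) (m : nat -> nat -> int) n :
  fc (fun x => rc N%:R^-1 * \sum_(a < N) \sum_(b < N) c a b * e (m a b) x) n =
  rc N%:R^-1 * \sum_(a < N) \sum_(b < N) c a b * (m a b == n)%:R.
Proof.
have cc a b : ccont (fun x => c a b * (e (m a b) x * e (- n) x)).
  by apply: ccont_Z; apply: ccont_fc; exact: ccont_e.
rewrite /fc.
have -> : (fun x => (rc N%:R^-1 * \sum_(a < N) \sum_(b < N) c a b * e (m a b) x) * e (- n) x) =
  (fun x => rc N%:R^-1 * \sum_(a < N) \sum_(b < N) c a b * (e (m a b) x * e (- n) x)).
  apply/funext => x; rewrite -mulrA; congr (_ * _); rewrite mulr_suml; apply: eq_bigr => a _.
  by rewrite mulr_suml; apply: eq_bigr => b _; rewrite mulrA.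
rewrite cmean_Z; last by apply: ccont_sum => a; apply: ccont_sum => b.
congr (_ * _); rewrite cmean_sum; last by move=> a; apply: ccont_sum => b.
apply: eq_bigr => a _; rewrite cmean_sum//; apply: eq_bigr => b _.
rewrite cmean_Z; last by apply: ccont_fc; exact: ccont_e.
by rewrite cmean_eM subr_eq0.
Qed.

Lemma csmooth_scale p (L : R) : csmooth p -> csmooth (fun x => p (L * x)).
Proof. by case=> h1 h2; split; [exact: (smoothR_scale L h1)|exact: (smoothR_scale L h2)]. Qed.

Lemma per2pi_scale (T : Type) (f : R -> T) (L : int) : per2pi f -> per2pi (fun x => f (L%:~R * x)).
Proof. by move=> h x; rewrite mulrDr periodic_int. Qed.

(** For trigonometric polynomials this is read off the exponentials. Fejer means carry it to smooth
    [p], since a Fourier coefficient is controlled by the uniform norm; no change of variable is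
    made. *)
Lemma fc_scale p (L : nat) (n : int) : csmooth p -> per2pi p -> (0 < L)%N ->
  fc (fun x => p (L%:Z%:~R * x)) n = if (L%:Z %| n)%Z then fc p (n %/ L%:Z)%Z else 0.
Proof.
move=> sp pp L0.
pose f x := p (L%:Z%:~R * x).
have sf : csmooth f by exact: csmooth_scale.
have cf := csmooth_ccont sf; have cp := csmooth_ccont sp.
pose F N x := fejer N p (L%:Z%:~R * x).
have cF N : ccont (F N) by apply: csmooth_ccont; apply: csmooth_scale; exact: csmooth_fejer.
have FE N : fc (F N) n = if (L%:Z %| n)%Z then fc (fejer N p) (n %/ L%:Z)%Z else 0.
  have -> : F N = (fun x => rc N%:R^-1 * \sum_(a < N) \sum_(b < N)
      fc p (a%:Z - b%:Z) * e ((a%:Z - b%:Z) * L%:Z) x).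
    apply/funext => x; rewrite /F /fejer; congr (_ * _).
    by apply: eq_bigr => a _; apply: eq_bigr => b _; rewrite e_scale.
  rewrite (fc_double_sum N (fun a b => fc p (a%:Z - b%:Z)) (fun a b => (a%:Z - b%:Z) * L%:Z)).
  case: ifP => [/dvdzP[k ->]|nL].
    rewrite mulzK; last by rewrite eqz_nat -lt0n.
    rewrite (fc_double_sum N (fun a b => fc p (a%:Z - b%:Z)) (fun a b => (a%:Z - b%:Z))).
    congr (_ * _); apply: eq_bigr => a _; apply: eq_bigr => b _; congr (_ * (nat_of_bool _)%:R).
    apply/eqP/eqP => [|-> //]; apply: mulIf; by rewrite eqz_nat -lt0n.
  rewrite big1 ?mulr0// => a _; rewrite big1// => b _.
  case: eqP => [E|]; last by rewrite mulr0.
  by rewrite -E dvdz_mull in nL.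
apply/eqP; rewrite -subr_eq0; apply/eqP; apply: nm_le0P => ep ep0.
have [N0 H] := fejer_uniform sp pp (divr_gt0 ep0 (ltr0n R 4)).
have H1 : nm (fc f n - fc (F N0.+1) n) <= ep / 2.
  rewrite -fc_B//; have -> : ep / 2 = 2 * (ep / 4) by field.
  apply: nm_fc => [|x]; first exact: ccont_B.
  by rewrite nmB; exact: H.
have -> : fc f n - (if (L%:Z %| n)%Z then fc p (n %/ L%:Z)%Z else 0) =
  (fc f n - fc (F N0.+1) n) + (fc (F N0.+1) n -
    (if (L%:Z %| n)%Z then fc p (n %/ L%:Z)%Z else 0)) by ring.
apply: le_trans (nmD _ _) _; rewrite [leRHS]splitr lerD//.
rewrite FE; case: ifP => _; last by rewrite subrr nm0 divr_ge0// ltW.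
rewrite -fc_B//; last by apply: csmooth_ccont; exact: csmooth_fejer.
have -> : ep / 2 = 2 * (ep / 4) by field.
apply: nm_fc => [|x]; last exact: H.
by apply: ccont_B => //; apply: csmooth_ccont; exact: csmooth_fejer.
Qed.

End FejerConvergence.

Lemma powR_near1 (R : realType) (q e1 : R) : 0 < q -> 0 < e1 -> exists2 eta : R, 0 < eta & (1 + eta) `^ q <= 1 + e1.
Proof.
move=> q0 e10; have e11 : 0 < 1 + e1 by rewrite addr_gt0.
exists ((1 + e1) `^ q^-1 - 1).
  rewrite subr_gt0 /powR gt_eqF// -[X in X < _](expR0 R) ltr_expR mulr_gt0 ?invr_gt0// ln_gt0//.
  by rewrite ltrDl.
by rewrite addrC subrK -powRrM mulVf ?gt_eqF// powRr1// ltW.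
Qed.

(** * Convolutions in l_q with widely spaced frequencies *)

Section Convolution.
Variables (R : realType) (q : R).
Hypothesis q1 : 1 < q.
Implicit Types (x y : R) (s t : seq int) (u v : int -> R).

Let q0 : 0 < q. Proof. exact: lt_trans q1. Qed.

(** The graph of [t ^ q] lies above its tangent at [y]; derived from Young's inequality with
    exponents q and q/(q - 1). *)
Lemma powR_tangent x y : 0 <= x -> 0 <= y ->
  q * (x * y `^ (q - 1)) <= x `^ q + (q - 1) * y `^ q.
Proof.
move=> x0 y0.
have q10 : 0 < q - 1 by rewrite subr_gt0.
have h : q^-1 + (q / (q - 1))^-1 = 1.
  by field; rewrite !gt_eqF.
have := conjugate_powR x0 (powR_ge0 y (q - 1)) q0 (divr_gt0 q0 q10) h.
rewrite -powRrM (_ : (q - 1) * (q / (q - 1)) = q); last by field; rewrite gt_eqF.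
rewrite -(ler_pM2l q0) mulrDr [q * (x `^ q / q)]mulrC divfK ?gt_eqF// => /le_trans; apply.
rewrite lerD2l; set w := y `^ q.
by rewrite (_ : q * _ = (q - 1) * w)//; field; rewrite !gt_eqF.
Qed.

(** Jensen's inequality for weights of total at most [G], from the tangent at the point [b / G]. *)
Lemma powR_jensen (T : Type) (r : seq T) (w x : T -> R) (G : R) : 0 < G ->
  (forall i, 0 <= w i) -> (forall i, 0 <= x i) -> \sum_(i <- r) w i <= G ->
  (\sum_(i <- r) w i * x i) `^ q <= G `^ q / G * \sum_(i <- r) w i * x i `^ q.
Proof.
move=> G0 w0 x0 wG.
set b := \sum_(i <- r) w i * x i; set A := \sum_(i <- r) _ * _ `^ q.
have b0 : 0 <= b by apply: sumr_ge0 => i _; rewrite mulr_ge0.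
pose y := b / G; have y0 : 0 <= y by rewrite divr_ge0// ltW.
have H : q * (b * y `^ (q - 1)) <= A + (q - 1) * (G * y `^ q).
  apply: (@le_trans _ _ (A + (q - 1) * ((\sum_(i <- r) w i) * y `^ q))); last first.
    by rewrite lerD2l ler_wpM2l ?subr_ge0 ?(ltW q1)// ler_wpM2r ?powR_ge0.
  rewrite /b /A !mulr_suml !mulr_sumr -big_split/=; apply: ler_sum => i _.
  have := ler_wpM2l (w0 i) (powR_tangent (x0 i) y0); lra.
have bG : b = G * y by rewrite /y mulrC divfK ?gt_eqF.
have E : b * y `^ (q - 1) = G * y `^ q by rewrite bG -mulrA mulr_powRB1.
rewrite E in H.
have HA : G * y `^ q <= A by lra.
rewrite {1}bG powRM//; last exact: ltW.
rewrite -mulrA ler_wpM2l ?powR_ge0// [leRHS]mulrC ler_pdivlMr//.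
by rewrite mulrC.
Qed.

(** Either [y <= eta * x] or [x < eta^-1 * y], and one term on the right suffices. For small [eta]
    the factor of the main term [x] is near 1. *)
Lemma powR_split eta x y : 0 < eta -> 0 <= x -> 0 <= y ->
  (x + y) `^ q <= (1 + eta) `^ q * x `^ q + (1 + eta^-1) `^ q * y `^ q.
Proof.
move=> e0 x0 y0.
have e1 : 0 <= eta^-1 by rewrite invr_ge0 ltW.
rewrite -!powRM//; try by rewrite addr_ge0// ltW.
have [h|h] := leP y (eta * x).
  apply: (@le_trans _ _ (((1 + eta) * x) `^ q)); last by rewrite lerDl powR_ge0.
  apply: ge0_ler_powR; rewrite ?nnegrE ?addr_ge0 ?mulr_ge0 ?addr_ge0 ?(ltW e0) ?(ltW q0)//.
  by rewrite mulrDl mul1r lerD2l.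
apply: (@le_trans _ _ (((1 + eta^-1) * y) `^ q)); last by rewrite lerDr powR_ge0.
apply: ge0_ler_powR; rewrite ?nnegrE ?addr_ge0 ?mulr_ge0 ?addr_ge0 ?(ltW q0)//.
by rewrite mulrDl mul1r addrC lerD2l ler_pdivlMl// ltW.
Qed.

(* For F >= 0: the sum of F over all integers is at most B. *)
Definition sumbd (F : int -> R) (B : R) := forall s, uniq s -> \sum_(n <- s) F n <= B.

Lemma sumbd_ge0 F B : sumbd F B -> 0 <= B.
Proof. by move=> /(_ [::] isT); rewrite big_nil. Qed.

Lemma sumbd_le F B n : sumbd F B -> F n <= B.
Proof. by move=> /(_ [:: n] isT); rewrite big_seq1. Qed.

(** A finite set whose sum is within [tau] of the supremum leaves at most [tau] for any finite set
    disjoint from it. *)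
Lemma sumbd_tail F B tau : (forall n, 0 <= F n) -> sumbd F B -> 0 < tau ->
  exists N : nat, forall s, uniq s -> (forall n, n \in s -> (N < `|n|)%N) ->
    \sum_(n <- s) F n <= tau.
Proof.
move=> F0 HF tau0.
pose A := [set x | exists2 s, uniq s & x = \sum_(n <- s) F n].
have hA : has_sup A.
  split; first by exists 0, [::]; rewrite ?big_nil.
  by exists B => _ [s us ->]; exact: HF.
have [_ [s us ->] hs] := sup_adherent tau0 hA.
exists (\max_(n <- s) `|n|%N) => t ut ht.
have : \sum_(n <- s ++ t) F n <= sup A.
  apply: ub_le_sup; first by case: hA.
  exists (s ++ t) => //; rewrite cat_uniq us ut andbT -all_predC; apply/allP => n nt /=.
  apply: contraL (ht n nt) => ns; rewrite -leqNgt.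
  by rewrite (big_rem n)//= leq_maxl.
by rewrite big_cat/= => h; lra.
Qed.

Lemma powR_le_inj x y : 0 <= x -> 0 <= y -> x `^ q <= y `^ q -> x <= y.
Proof.
move=> x0 y0; apply: contraTT; rewrite -!ltNge => h.
by apply: gt0_ltr_powR.
Qed.

Lemma filter_le1 (P : pred int) t : uniq t ->
  {in t &, forall k l, P k -> P l -> k = l} ->
  [seq k <- t | P k] = [::] \/ exists2 k, k \in t & [seq k <- t | P k] = [:: k] .
Proof.
move=> ut H; case E : [seq k <- t | P k] => [|k [|l r]]; [by left| |].
  right; exists k => //; have : k \in [seq k <- t | P k] by rewrite E inE eqxx.
  by rewrite mem_filter => /andP[].
have kl : k != l by have := filter_uniq P ut; rewrite E /= inE negb_or => /andP[/andP[]].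
have : k \in [seq k <- t | P k] by rewrite E inE eqxx.
have : l \in [seq k <- t | P k] by rewrite E !inE eqxx orbT.
rewrite !mem_filter => /andP[Pl tl] /andP[Pk tk].
by rewrite (H k l) ?eqxx// in kl.
Qed.

Lemma near_uniq (N L : nat) (n k l : int) : (2 * N < L)%N ->
  (`|(n - k * L%:Z)%R| <= N)%N -> (`|(n - l * L%:Z)%R| <= N)%N -> k = l.
Proof.
move=> NL h1 h2; have [//|kl] := eqVneq k l.
have : (L <= `|((k - l) * L%:Z)%R|)%N.
  have k0 : (0 < `|(k - l)%R|)%N by rewrite absz_gt0 subr_eq0.
  by rewrite abszM absz_nat leq_pmull.
have : (`|((k - l) * L%:Z)%R| <= N + N)%N by lia.
lia.
Qed.

Lemma shift_uniq s (a : int) : uniq s -> uniq [seq n - a | n <- s].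
Proof. by move=> us; rewrite map_inj_uniq// => x y /addIr. Qed.

(** [u] plays the spectrum of g_k, [v] that of the distribution. Young's inequality would only give
    [G ^ q * V]. When L exceeds 2N, each n is within N of at most one multiple of L, so the main
    part of the convolution has no overlaps and the q-th powers factor. The threshold [L0] is
    uniform in the finite sets [s] and [t]. *)
Lemma conv_le u v G U V : (forall k, 0 <= u k) -> (forall k, 0 <= v k) ->
  sumbd u G -> sumbd (fun k => u k `^ q) U -> sumbd (fun n => v n `^ q) V ->
  forall ep : R, 0 < ep -> exists L0 : nat, forall L : nat, (L0 <= L)%N -> forall s t, uniq s -> uniq t ->
  \sum_(n <- s) (\sum_(k <- t) u k * v (n - k * L%:Z)) `^ q <= U * V + ep.
Proof.
move=> u0 v0 hG hU hV ep ep0.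
have G0 := sumbd_ge0 hG; have U0 := sumbd_ge0 hU; have V0 := sumbd_ge0 hV.
pose G1 := G + 1; have G10 : 0 < G1 by rewrite /G1 ltr_wpDl.
pose e1 := ep / 2 / (U * V + 1).
have UV0 : 0 < U * V + 1 by rewrite ltr_wpDl// mulr_ge0.
have e10 : 0 < e1 by rewrite /e1 !divr_gt0.
have [eta eta0 etaq] := powR_near1 q0 e10.
pose K := (1 + eta^-1) `^ q * G1 `^ q.
have K0 : 0 < K by rewrite mulr_gt0// powR_gt0// addr_gt0// invr_gt0.
pose tau := ep / 2 / K.
have tau0 : 0 < tau by rewrite /tau !divr_gt0.
have [N HN] := sumbd_tail (fun n => powR_ge0 (v n) q) hV tau0.
exists (2 * N).+1 => L NL s t us ut.
pose P n (k : int) := (`|(n - k * L%:Z)%R| <= N)%N.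
pose b1 n := \sum_(k <- t | P n k) u k * v (n - k * L%:Z).
pose b2 n := \sum_(k <- t | ~~ P n k) u k * v (n - k * L%:Z).
have uv0 k m : 0 <= u k * v m by rewrite mulr_ge0.
have b10 n : 0 <= b1 n by apply: sumr_ge0.
have b20 n : 0 <= b2 n by apply: sumr_ge0.
(* Near pairs: the inner sum has at most one term, so its q-th power is the product of the q-th
   powers. *)
have H1 : \sum_(n <- s) b1 n `^ q <= U * V.
  apply: (@le_trans _ _ (\sum_(n <- s) \sum_(k <- t) u k `^ q * v (n - k * L%:Z) `^ q)).
    apply: ler_sum => n _.
    have H : {in t &, forall k l, P n k -> P n l -> k = l}.
      by move=> k l _ _; exact: near_uniq.
    rewrite /b1 -big_filter; have [->|[k kt ->]] := filter_le1 ut H.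
      rewrite big_nil powR0 ?gt_eqF//; apply: sumr_ge0 => k _.
      by rewrite mulr_ge0// powR_ge0.
    rewrite big_seq1 powRM// (big_rem k)//= lerDl; apply: sumr_ge0 => l _.
    by rewrite mulr_ge0// powR_ge0.
  rewrite exchange_big/=; apply: (@le_trans _ _ (\sum_(k <- t) u k `^ q * V)).
    apply: ler_sum => k _; rewrite -mulr_sumr ler_wpM2l ?powR_ge0//.
    have := hV _ (shift_uniq (k * L%:Z) us); by rewrite big_map.
  by rewrite -mulr_suml ler_wpM2r// hU.
(* Far pairs see only the tail of [v], of size [tau]; Jensen with weights [u] pays the l_1 norm
   here, where [tau] compensates for it. *)
have H2 : \sum_(n <- s) b2 n `^ q <= G1 `^ q * tau.
  apply: (@le_trans _ _ (\sum_(n <- s) (G1 `^ q / G1 * \sum_(k <- t | ~~ P n k) u k * v (n - k * L%:Z) `^ q))).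
    apply: ler_sum => n _; rewrite /b2 -big_filter -[X in _ * X]big_filter.
    apply: (@powR_jensen _ _ u (fun k => v (n - k * L%:Z))) => //.
    by apply: (le_trans (hG _ (filter_uniq _ ut))); rewrite lerDl.
  rewrite -mulr_sumr -mulrA ler_wpM2l ?powR_ge0// ler_pdivrMl//.
  under eq_bigr do rewrite big_mkcond/=.
  rewrite exchange_big/=; apply: (@le_trans _ _ (\sum_(k <- t) u k * tau)); last first.
    rewrite -mulr_suml ler_wpM2r ?(ltW tau0)//.
    by apply: (le_trans (hG _ ut)); rewrite lerDl.
  apply: ler_sum => k _.
  rewrite -big_mkcond/= -mulr_sumr ler_wpM2l// -big_filter.
  have := HN [seq n - k * L%:Z | n <- [seq n <- s | ~~ P n k]].
  rewrite big_map; apply; first by apply: shift_uniq; exact: filter_uniq.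
  by move=> n /mapP[m]; rewrite mem_filter => /andP[]; rewrite /P -ltnNge => h _ ->.
apply: (@le_trans _ _ (\sum_(n <- s) ((1 + eta) `^ q * b1 n `^ q + (1 + eta^-1) `^ q * b2 n `^ q))).
  apply: ler_sum => n _; rewrite (bigID (P n))/=; exact: (powR_split eta0 (b10 n) (b20 n)).
rewrite big_split/= -!mulr_sumr.
apply: (@le_trans _ _ ((1 + e1) * (U * V) + ep / 2)).
  apply: lerD; first by apply: ler_pM => //; [exact: powR_ge0|apply: sumr_ge0 => n _; exact: powR_ge0].
  apply: (@le_trans _ _ ((1 + eta^-1) `^ q * (G1 `^ q * tau))).
    by rewrite ler_wpM2l// powR_ge0.
  by rewrite mulrA -/K /tau mulrC divfK// gt_eqF.
rewrite mulrDl mul1r -addrA lerD2l [leRHS]splitr lerD2r.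
by rewrite /e1 mulrAC ler_pdivrMr// ler_wpM2l ?divr_ge0 ?(ltW ep0)// lerDl.
Qed.

(** The pointwise analogue of [conv_le]: the single near term is at most [kap] times the l_q norm of
    [v], and the far terms use a bound [tau] on [v] outside [-N, N]. It controls how far a
    coefficient moves. *)
Lemma conv_sup u v G kap V : (forall k, 0 <= u k) -> (forall k, 0 <= v k) ->
  sumbd u G -> (forall k, u k <= kap) -> sumbd (fun n => v n `^ q) V ->
  forall ep : R, 0 < ep -> exists L0 : nat, forall L : nat, (L0 <= L)%N -> forall n t, uniq t ->
  \sum_(k <- t) u k * v (n - k * L%:Z) <= kap * V `^ q^-1 + ep.
Proof.
move=> u0 v0 hG hk hV ep ep0.
have G0 := sumbd_ge0 hG; have V0 := sumbd_ge0 hV.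
pose G1 := G + 1; have G10 : 0 < G1 by rewrite /G1 ltr_wpDl.
pose tau := ep / G1; have tau0 : 0 < tau by rewrite divr_gt0.
have tauq : 0 < tau `^ q by exact: powR_gt0.
have kap0 : 0 <= kap := le_trans (u0 0) (hk 0).
have [N HN] := sumbd_tail (fun n => powR_ge0 (v n) q) hV tauq.
have vV n : v n <= V `^ q^-1.
  apply: powR_le_inj; rewrite ?powR_ge0// -powRrM mulVf ?gt_eqF// powRr1//.
  exact: (sumbd_le n hV).
have vt n : (N < `|n|)%N -> v n <= tau.
  move=> h; apply: powR_le_inj; rewrite ?(ltW tau0)//.
  by have := HN [:: n] isT; rewrite big_seq1; apply => m; rewrite inE => /eqP ->.
exists (2 * N).+1 => L NL n t ut.
pose P (k : int) := (`|(n - k * L%:Z)%R| <= N)%N.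
rewrite (bigID P)/=; apply: lerD.
  have H : {in t &, forall k l, P k -> P l -> k = l}.
    by move=> k l _ _; exact: near_uniq.
  rewrite -big_filter; have [->|[k kt ->]] := filter_le1 ut H.
    by rewrite big_nil mulr_ge0// powR_ge0.
  by rewrite big_seq1; apply: ler_pM.
apply: (@le_trans _ _ (\sum_(k <- t | ~~ P k) u k * tau)).
  by apply: ler_sum => k; rewrite /P -ltnNge => h; rewrite ler_wpM2l// vt.
rewrite -mulr_suml -big_filter.
have := ler_wpM2r (ltW tau0) (hG _ (filter_uniq (predC P) ut)) => /le_trans; apply.
by rewrite /tau mulrA ler_pdivrMr// mulrC ler_wpM2l ?(ltW ep0)// lerDl.
Qed.

End Convolution.

(** * Riesz products and functions vanishing where a lacunary sum is small *)

Section Bump.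
Variable R : realType.
Implicit Types (p : {poly R}) (x y : R).

(** The polynomial factor makes the family stable under differentiation, so that all derivatives of
    exp(-1/x) are treated at once. *)
Definition expinv p x : R := if 0 < x then p.[x^-1] * expR (- x^-1) else 0.

(** With u = 1/x, exp(u) dominates u^(d + 1) / (d + 1)! for d = [size p], while the polynomial is
    O(u^d); a factor x is left over. *)
Lemma expinv_bound p : exists2 K : R, 0 <= K & forall x, `|x| <= 1 -> `|expinv p x| <= K * `|x|.
Proof.
pose A := \sum_(i < size p) `|p`_i|.
have A0 : 0 <= A by apply: sumr_ge0.
exists (A * ((size p).+1)`!%:R); first by rewrite mulr_ge0.
move=> x x1; rewrite /expinv; case: ifPn => [x0|_]; last by rewrite normr0 !mulr_ge0.
rewrite gtr0_norm// in x1 *; set u := x^-1.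
have u1 : 1 <= u by rewrite /u invf_ge1.
have u0 : 0 < u by exact: lt_le_trans u1.
rewrite normrM (ger0_norm (expR_ge0 _)) expRN.
have H1 : `|p.[u]| <= A * u ^+ size p.
  rewrite horner_coef (le_trans (ler_norm_sum _ _ _))// /A mulr_suml ler_sum// => i _.
  by rewrite normrM normrX (gtr0_norm u0) ler_wpM2l// ler_weXn2l// ltnW.
have H2 : u ^+ (size p).+1 / ((size p).+1)`!%:R <= expR u.
  by apply: le_trans (expR_ge1Dxn (size p) (ltW u0)); rewrite lerDr.
rewrite ler_pdivrMr ?expR_gt0//; apply: (le_trans H1).
have f0 : 0 < ((size p).+1)`!%:R :> R by rewrite ltr0n fact_gt0.
have -> : A * u ^+ size p = A * ((size p).+1)`!%:R * x * (u ^+ (size p).+1 / ((size p).+1)`!%:R).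
  rewrite exprS /u; have := f0; set f := (_%:R); move=> f0'; field.
  by rewrite !gt_eqF.
by rewrite ler_wpM2l// !mulr_ge0// ltW.
Qed.

Lemma expinvX p x : x * expinv (p * 'X) x = expinv p x.
Proof.
rewrite /expinv; case: ifPn => [x0|_]; last by rewrite mulr0.
by rewrite hornerMX mulrA mulrCA mulfV ?mulr1// gt_eqF.
Qed.

Lemma is_derive_expinv p x :
  is_derive x 1 (expinv p) (expinv ('X ^+ 2 * (p - p^`())) x).
Proof.
have [x0|x0|->] := ltgtP x 0.
- rewrite /expinv ltNge (ltW x0)/=.
  apply: (@near_eq_is_derive _ _ _ (cst 0)).
  near=> y; have y0 : y < 0 by near: y; exact: lt_nbhsl.
  by rewrite /cst ltNge (ltW y0).
- have xn0 : x != 0 by rewrite gt_eqF.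
  apply: (@near_eq_is_derive _ _ _ ((horner p \o (fun y => y^-1)) * (expR \o (fun y => - y^-1)))).
    near=> y; have y0 : 0 < y by near: y; exact: lt_nbhsr.
    by rewrite /expinv y0.
  have dV : is_derive x 1 (fun y : R => y^-1) (- x ^- 2).
    by have := is_deriveV xn0 (is_derive_id x (1 : R)); rewrite /GRing.scale/= mulr1.
  have d1 : is_derive x 1 (horner p \o (fun y => y^-1)) (p^`().[x^-1] * - x ^- 2).
    by apply: is_derive_eq; rewrite mulrC.
  have d2 : is_derive x 1 (expR \o (fun y : R => - y^-1)) (expR (- x^-1) * x ^- 2).
    have dN : is_derive x 1 (fun y : R => - y^-1) (x ^- 2).
      by have := is_deriveN dV; rewrite opprK.
    by apply: is_derive_eq; rewrite mulrC.
  apply: is_derive_eq; rewrite /GRing.scale/= /expinv x0 hornerM hornerXn hornerD hornerN.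
  by rewrite exprVn; ring.
(* At 0 the difference quotient of [expinv p] is [expinv (p * 'X)], which tends to 0 by the linear
   bound. *)
- have [K K0 HK] := expinv_bound (p * 'X).
  have L : (fun h : R => h^-1 *: ((expinv p \o shift 0) (h *: (1:R)) - expinv p 0)) @ 0^' --> (0 : R).
    apply/cvgrPdist_le => ep ep0; near=> h.
    have h0 : h != 0 by near: h; exact: nbhs_dnbhs_neq.
    have h1 : `|h| < 1 /\ `|h| < ep / (K + 1).
      split; near: h; apply: dnbhs0_lt => //.
      by rewrite divr_gt0// ltr_wpDl.
    rewrite sub0r normrN /= /shift/= addr0 [h *: 1]mulr1 -expinvX.
    rewrite [expinv p 0]/expinv ltxx subr0 /GRing.scale/= mulKf//.
    apply: le_trans (HK _ (ltW h1.1)) _.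
    apply: (@le_trans _ _ ((K + 1) * `|h|)); first by rewrite ler_wpM2r// lerDl.
    by rewrite -ler_pdivlMl ?ltr_wpDl// mulrC ltW// h1.2.
  rewrite {2}/expinv ltxx.
  by apply: DeriveDef; [exact: cvgP L|exact: cvg_lim L].
Unshelve. all: by end_near. Qed.

Definition bump : R -> R := expinv 1.

Lemma smoothR_bump : smoothR bump.
Proof.
apply/smoothR_Ck => n; rewrite /bump; elim: n (1 : {poly R}) => [|n IH] p; first exact: Ck0.
by apply: (CkS_is_derive (is_derive_expinv p)).
Qed.

Lemma bump_le0 x : x <= 0 -> bump x = 0.
Proof. by move=> x0; rewrite /bump /expinv ltNge x0. Qed.

Lemma bump_gt0 x : 0 < x -> 0 < bump x.
Proof. by move=> x0; rewrite /bump /expinv x0 hornerC mul1r expR_gt0. Qed.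

Lemma bump_ge0 x : 0 <= bump x.
Proof. by have [/bump_le0 ->|/bump_gt0/ltW] := leP x 0. Qed.

Lemma bump_le1 x : bump x <= 1.
Proof.
have [/bump_le0 ->//|x0] := leP x 0.
by rewrite /bump /expinv x0 hornerC mul1r -[leRHS]expR0 ler_expR oppr_le0 invr_ge0 ltW.
Qed.

Lemma bump_nondecreasing x y : x <= y -> bump x <= bump y.
Proof.
move=> xy; have [/bump_le0 ->|x0] := leP x 0; first exact: bump_ge0.
have y0 : 0 < y by exact: lt_le_trans xy.
by rewrite /bump /expinv x0 y0 !hornerC !mul1r ler_expR lerN2 lef_pV2.
Qed.

End Bump.

(** * Finite differences and weights with vanishing moments *)

Section FiniteDifference.
Variable R : realType.
Implicit Types (f : R -> R) (x : R).

Fixpoint fd n f x : R := if n is n'.+1 then fd n' f x - fd n' f (x + 1) else f x.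

(** Nodes are kept with multiplicity: each weight is 1 or -1 and there are 2^n of them, instead of
    binomial coefficients on n + 1 nodes. *)
Fixpoint fd_nodes n : seq (R * nat) :=
  if n is n'.+1 then fd_nodes n' ++ [seq (- p.1, p.2.+1) | p <- fd_nodes n'] else [:: (1, 0%N)].

Lemma fd_nodesE n f x : fd n f x = \sum_(p <- fd_nodes n) p.1 * f (x + p.2%:R).
Proof.
elim: n f x => [|n IH] f x; first by rewrite big_seq1 mul1r addr0.
rewrite /= big_cat/= big_map/= !IH -sumrN; congr (_ + _).
by apply: eq_bigr => p _; rewrite -natr1 mulNr addrAC addrA.
Qed.

Lemma size_fd_nodes n : size (fd_nodes n) = (2 ^ n)%N.
Proof. by elim: n => //= n IH; rewrite size_cat size_map IH expnS; lia. Qed.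

Lemma fd_nodesP n p : p \in fd_nodes n -> `|p.1| = 1 /\ (p.2 <= n)%N.
Proof.
elim: n p => [|n IH] p /=; first by rewrite inE => /eqP -> /=; rewrite normr1.
rewrite mem_cat => /orP[/IH[-> h]|/mapP[r /IH[r1 r2] ->]]; first by split=> //; exact: leqW.
by rewrite normrN.
Qed.

(** The Leibniz rule for a linear factor; it yields both the vanishing on low powers and the value
    on the inverse function. *)
Lemma fdM n f x : fd n.+1 (fun y => y * f y) x = x * fd n.+1 f x - n.+1%:R * fd n f (x + 1).
Proof.
elim: n x => [|n IH] x /=; first by ring.
have /= := IH x; have /= := IH (x + 1) => -> ->.
by rewrite -[(n.+2)%:R]natr1; ring.
Qed.

Lemma fd_X n k x : (k < n)%N -> fd n (fun y => y ^+ k) x = 0.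
Proof.
elim: k n x => [|k IH] n x.
  case: n => // n _; rewrite [fd _ _ _]/=; suff H y z : fd n (fun=> 1) y = fd n (fun=> 1) z :> R.
    by rewrite (H x (x + 1)) subrr.
  by elim: n y z => //= n IH y z; rewrite (IH y z) (IH (y+1) (z+1)).
case: n => // n; rewrite ltnS => kn.
under [X in fd _ X]eq_fun do rewrite exprS.
by rewrite fdM !IH ?mulr0 ?subrr// ltnW.
Qed.

Lemma fd_ext n f g x : 0 < x -> (forall y, 0 < y -> f y = g y) -> fd n f x = fd n g x.
Proof.
move=> + H; elim: n x => [|n IH] x x0 /=; first exact: H.
by rewrite !IH// addr_gt0.
Qed.

(** [fdM] applied to y y^-1 = 1, whose difference vanishes, is a recursion from order n at k + 2 to
    order n + 1 at k + 1. *)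
Lemma fd_inv n (k : nat) : fd n (fun y => y^-1) k.+1%:R * ('C(k + n.+1, n) * k.+1)%:R = 1.
Proof.
elim: n k => [|n IH] k; first by rewrite bin0 mul1n /= mulVf// pnatr_eq0.
have k0 : 0 < k.+1%:R :> R by rewrite ltr0n.
have := fdM n (fun y => y^-1) k.+1%:R.
rewrite (@fd_ext _ _ (fun y => y ^+ 0)) ?fd_X//; last by move=> y y0; rewrite mulfV ?gt_eqF.
move=> /esym/eqP; rewrite subr_eq0 => /eqP E.
have -> : fd n.+1 (fun y => y^-1) k.+1%:R = n.+1%:R / k.+1%:R * fd n (fun y => y^-1) (k.+1%:R + 1).
  by rewrite mulrAC -E mulrAC mulfV ?mul1r// gt_eqF.
rewrite natr1 -[RHS](IH k.+1) [n.+1%:R / _ * _]mulrC -mulrA; congr (_ * _).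
rewrite mulrAC -natrM; apply: (@mulIf _ k.+1%:R); first by rewrite gt_eqF.
rewrite divfK ?gt_eqF// -natrM; congr (_%:R).
have -> : (k + n.+2 = (k.+1 + n.+1))%N by lia.
have := mul_bin_left (k.+1 + n.+1) n; rewrite mulnCA => h; nia.
Qed.

(* The nodes are [alpha (L + i) / L] and the weights are proportional to those of the
   L-th difference divided by [L + i]: for k >= 1 the difference is applied to y^(k-1),
   of degree less than L. *)
Lemma vanishing_moments (L : nat) (alpha : R) : (0 < L)%N -> 0 < alpha ->
  exists l : seq (R * R), [/\ size l = (2 ^ L)%N,
    (forall p, p \in l -> `|p.1| <= 4 ^+ L),
    (forall p, p \in l -> alpha <= p.2 <= 2 * alpha) &
    forall k, (k <= L)%N -> \sum_(p <- l) p.1 * p.2 ^+ k = (k == 0%N)%:R].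
Proof.
move=> L0 a0; have Lp : 0 < L%:R :> R by rewrite ltr0n.
pose W : R := fd L (fun y => y^-1) L%:R.
have HW : W * ('C(L.-1 + L.+1, L) * L)%:R = 1 by have := fd_inv L L.-1; rewrite prednK.
have EL : (L.-1 + L.+1 = 2 * L)%N by lia.
have W0 : W != 0 by apply/eqP => h; move: HW; rewrite h mul0r => /eqP; rewrite eq_sym oner_eq0.
pose F (p : R * nat) : R * R := (p.1 / (L + p.2)%:R / W, alpha * (L + p.2)%:R / L%:R).
exists (map F (fd_nodes L)); split.
- by rewrite size_map size_fd_nodes.
- move=> _ /mapP[p /fd_nodesP[p1 p2] ->] /=.
  (* The weight is at most L C(2L, L) / (L + i), hence at most the central binomial coefficient, one
     term in the expansion of (1 + 1)^(2L) = 4^L. *)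
  have WE : W^-1 = ('C(2 * L, L) * L)%:R.
    by rewrite -EL; apply: (mulfI W0); rewrite HW mulfV.
  rewrite !normrM p1 mul1r WE ger0_norm ?invr_ge0// ger0_norm//.
  rewrite mulrC ler_pdivrMr ?ltr0n ?addn_gt0 ?L0// -natrX -natrM ler_nat.
  apply: leq_mul; last exact: leq_addr.
  rewrite (_ : (4 ^ L = 2 ^ (2 * L))%N); last by rewrite expnM.
  rewrite -[X in (_ <= X ^ _)%N]/(1 + 1)%N expnDn (bigD1 (inord L)) //=.
  by rewrite !exp1n !muln1 inordK ?leq_addr// ltnS; lia.
- move=> _ /mapP[p /fd_nodesP[p1 p2] ->] /=.
  apply/andP; split.
    by rewrite ler_pdivlMr// ler_wpM2l ?(ltW a0)// ler_nat leq_addr.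
  rewrite ler_pdivrMr// (_ : 2 * alpha * L%:R = alpha * (2 * L)%:R); last by rewrite natrM; ring.
  by rewrite ler_wpM2l ?(ltW a0)// ler_nat mul2n -addnn leq_add2l.
- move=> k kL; rewrite big_map.
  have -> : \sum_(p <- fd_nodes L) (F p).1 * (F p).2 ^+ k =
     (alpha / L%:R) ^+ k / W * fd L (fun y => y^-1 * y ^+ k) L%:R.
    rewrite fd_nodesE mulr_sumr; apply: eq_bigr => p _ /=.
    rewrite natrD; set y := _ + p.2%:R.
    by rewrite [alpha * y / _]mulrAC [in LHS]exprMn; ring.
  case: k kL => [|k] kL.
    rewrite expr0 mul1r (@fd_ext _ _ (fun y => y^-1)) ?mulVf//.
    by move=> y _; rewrite mulr1.
  rewrite (@fd_ext _ _ (fun y => y ^+ k)) ?fd_X ?mulr0//.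
  by move=> y y0; rewrite exprS mulKf// gt_eqF.
Qed.

End FiniteDifference.

(** * Riesz products along the powers of 10 *)

Section Riesz.
Variable R : realType.
Notation C := R[i].
Implicit Types (x a : R) (m d : nat).

Lemma digits_inj (g h : nat -> nat) m : (forall j, g j < 10)%N -> (forall j, h j < 10)%N ->
  (\sum_(j < m) g j * 10 ^ j = \sum_(j < m) h j * 10 ^ j)%N -> forall j, (j < m)%N -> g j = h j.
Proof.
elim: m g h => // m IH g h gl hl.
have S (k : nat -> nat) : (\sum_(j < m.+1) k j * 10 ^ j = k 0%N + 10 * \sum_(j < m) k j.+1 * 10 ^ j)%N.
  rewrite big_ord_recl muln1 big_distrr; congr addn; apply: eq_bigr => j _ /=.
  by rewrite expnS mulnCA.
rewrite !S => E; have g0 := gl 0%N; have h0 := hl 0%N.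
have [E0 E1] : g 0%N = h 0%N /\ (\sum_(j < m) g j.+1 * 10 ^ j = \sum_(j < m) h j.+1 * 10 ^ j)%N by lia.
by case=> // j jm; apply: (IH (fun j => g j.+1) (fun j => h j.+1)).
Qed.

Definition freq m d (f : {ffun 'I_m -> 'I_(2 * d).+1}) : int :=
  \sum_(j < m) ((f j)%:Z - d%:Z) * (10 ^ j)%N%:Z.

(** Adding [d] to every signed digit gives an ordinary decimal expansion with digits at most 2d <
    10. Only d = 1 (for [riesz]) and d = 2 (for [riesz_maj]) occur. *)
Lemma freq_inj m d : (d < 5)%N -> injective (@freq m d).
Proof.
move=> d5 f g; rewrite /freq.
have H (k : {ffun 'I_m -> 'I_(2 * d).+1}) :
   \sum_(j < m) ((k j)%:Z - d%:Z) * (10 ^ j)%N%:Z =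
   (\sum_(j < m) k j * 10 ^ j)%N%:Z - \sum_(j < m) d%:Z * (10 ^ j)%N%:Z.
  rewrite (big_morph Posz PoszD (erefl _)) -sumrB.
  by apply: eq_bigr => j _; rewrite PoszM mulrBl.
rewrite !H => /addIr [E].
have G (k : {ffun 'I_m -> 'I_(2 * d).+1}) :
  (\sum_(j < m) k j * 10 ^ j = \sum_(j < m) (if insub (j : nat) is Some i then k i : nat else 0%N) * 10 ^ j)%N.
  by apply: eq_bigr => j _; rewrite valK.
have lt10 (k : {ffun 'I_m -> 'I_(2 * d).+1}) (j : nat) : ((if insub j is Some i then k i : nat else 0%N) < 10)%N.
  by case: insub => // i; have := ltn_ord (k i); lia.
rewrite !G in E; apply/ffunP => j; apply: val_inj.
by have := digits_inj (lt10 f) (lt10 g) E (ltn_ord j); rewrite valK.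
Qed.

Lemma freq_mid m d : freq [ffun _ : 'I_m => inord d : 'I_(2 * d).+1] = 0.
Proof.
by rewrite /freq big1// => j _; rewrite ffunE inordK ?subrr ?mul0r//; lia.
Qed.

Lemma e_prod (I : Type) (s : seq I) (n : I -> int) x :
  \prod_(i <- s) e (n i) x = e (\sum_(i <- s) n i) x.
Proof. by elim: s => [|i s IH]; rewrite ?big_nil ?e0// !big_cons eD IH. Qed.

Lemma rc_prod (I : Type) (s : seq I) (F : I -> R) :
  rc (\prod_(i <- s) F i) = \prod_(i <- s) rc (F i).
Proof. by elim: s => [|i s IH]; rewrite ?big_nil// !big_cons rcM IH. Qed.

Definition trig d (w : nat -> R) x : C := \sum_(r < (2 * d).+1) rc (w r) * e (r%:Z - d%:Z) x.

Lemma riesz_expand m d (w : nat -> R) x :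
  \prod_(j < m) trig d w (10 ^+ j * x) =
  \sum_(f : {ffun 'I_m -> 'I_(2 * d).+1}) rc (\prod_(j < m) w (f j)) * e (freq f) x.
Proof.
rewrite bigA_distr_bigA; apply: eq_bigr => f _.
rewrite big_split/= -rc_prod /freq -e_prod; congr (_ * _).
apply: eq_bigr => j _; rewrite -e_scale; congr (e _ (_ * _)).
by rewrite -pmulrn natrX.
Qed.

Lemma fc_esum (T : finType) (c : T -> C) (N : T -> int) n :
  fc (fun x => \sum_f c f * e (N f) x) n = \sum_f c f * (N f == n)%:R.
Proof.
rewrite /fc.
have -> : (fun x => (\sum_f c f * e (N f) x) * e (- n) x) = (fun x => \sum_f c f * (e (N f) x * e (- n) x)).
  by apply/funext => x; rewrite mulr_suml; apply: eq_bigr => f _; rewrite mulrA.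
rewrite cmean_sum; last by move=> f; apply: ccont_Z; apply: ccont_fc; exact: ccont_e.
apply: eq_bigr => f _; rewrite cmean_Z; last by apply: ccont_fc; exact: ccont_e.
by rewrite cmean_eM subr_eq0.
Qed.

(** Injectivity of [N] excludes collisions: each frequency carries at most one coefficient. *)
Lemma fc_esum_lq (T : finType) (c : T -> C) (N : T -> int) (q : R) : injective N -> 0 < q ->
  sumbd (fun n => nm (fc (fun x => \sum_f c f * e (N f) x) n) `^ q) (\sum_f nm (c f) `^ q).
Proof.
move=> Ni q0 s us.
apply: (@le_trans _ _ (\sum_(n <- s) \sum_f nm (c f) `^ q * (N f == n)%:R)).
  apply: ler_sum => n _; rewrite fc_esum.
  have P0 f : 0 <= nm (c f) `^ q * (N f == n)%:R by rewrite mulr_ge0// powR_ge0.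
  have [[g gn]|H] := pselect (exists g, N g = n); last first.
    rewrite big1; first by rewrite nm0 powR0 ?gt_eqF// sumr_ge0.
    by move=> f _; case: eqP => [E|]; [case: H; exists f|rewrite mulr0].
  rewrite (bigD1 g)//= gn eqxx mulr1 big1 ?addr0; last first.
    move=> f fg; case: eqP => [E|]; last by rewrite mulr0.
    by rewrite (Ni f g) ?eqxx// ?E ?gn in fg.
  by rewrite (bigD1 g)//= gn eqxx mulr1 lerDl sumr_ge0.
rewrite exchange_big/=; apply: ler_sum => f _.
rewrite -mulr_sumr ler_piMr ?powR_ge0//.
have [Nf|Nf] := boolP (N f \in s).
  rewrite (big_rem (N f))//= eqxx big1_seq ?addr0// => n /andP[_ ns].
  by case: eqP => // E; rewrite -E mem_rem_uniq// inE eqxx in ns.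
by rewrite big1_seq// => n /andP[_ ns]; case: eqP => // E; rewrite E ns in Nf.
Qed.

(** Only the choice of digit zero in every position has frequency 0, so the factors behave as if
    independent. *)
Lemma mean_riesz m d (w : nat -> R) (F : R -> R) : (d < 5)%N ->
  (forall x, rc (F x) = \prod_(j < m) trig d w (10 ^+ j * x)) -> mean F = w d ^+ m.
Proof.
move=> d5 HF; apply: rcI; rewrite -cmean_real.
have -> : (fun x => rc (F x)) = (fun x =>
   \sum_(f : {ffun 'I_m -> 'I_(2 * d).+1}) rc (\prod_(j < m) w (f j)) * e (freq f) x).
  by apply/funext => x; rewrite HF riesz_expand.
rewrite cmean_sum; last by move=> f; apply: ccont_Z; exact: ccont_e.
have dd : (d < (2 * d).+1)%N by lia.
rewrite (bigD1 [ffun _ => inord d]) //= [X in _ + X]big1 ?addr0; last first.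
  move=> f nf; rewrite cmean_Z; last exact: ccont_e.
  rewrite cmean_e -(freq_mid m d); case: eqP => [E|]; last by rewrite mulr0.
  by rewrite (freq_inj d5 E) eqxx in nf.
rewrite cmean_Z; last exact: ccont_e.
rewrite cmean_e freq_mid eqxx mulr1; congr rc.
rewrite (eq_bigr (fun=> w d)); last by move=> j _; rewrite ffunE inordK.
by rewrite prodr_const card_ord.
Qed.

Definition lac m x : R := \sum_(j < m) cos (10 ^+ j * x).
Definition riesz a m x : R := \prod_(j < m) (1 + a * cos (10 ^+ j * x)).
(* [1 + y - y^2/4] is a trigonometric polynomial in [y = a cos t] with
   [(1 + y)^2 <= (1 + y - y^2/4) e^y] for small y, so that the square of the Riesz
   product is controlled, by the exponential moment method, where [lac] is small. *)
Definition riesz_maj a m x : R :=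
  \prod_(j < m) (1 + a * cos (10 ^+ j * x) - (a * cos (10 ^+ j * x)) ^+ 2 / 4).

(* Fourier coefficients of the factors of [riesz] and [riesz_maj], index shifted by
   the degree. *)
Definition w1 a (r : nat) : R := if r == 1%N then 1 else a / 2.
Definition w2 a (r : nat) : R :=
  if r == 2%N then 1 - a ^+ 2 / 8 else if (r == 1%N) || (r == 3%N) then a / 2 else - (a ^+ 2 / 16).

Lemma trig_w1 a x : rc (1 + a * cos x) = trig 1 (w1 a) x.
Proof.
rewrite /trig !big_ord_recl big_ord0 /= /w1 /=.
by apply: complex_ext; rewrite !(ReD, ImD, ReM, ImM) /= ?(mulN1r, mul1r, mul0r, cosN, sinN, cos0, sin0); field.
Qed.

Lemma trig_w2 a x : rc (1 + a * cos x - (a * cos x) ^+ 2 / 4) = trig 2 (w2 a) x.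
Proof.
have h : cos (2 * x) = cos x ^+ 2 * 2 - 1 by rewrite mulr_natl cos_mulr2n -mulr_natr.
rewrite /trig !big_ord_recl big_ord0 /= /w2 /=.
by apply: complex_ext; rewrite !(ReD, ImD, ReM, ImM) /= ?(mulNr, mulN1r, mul1r, mul0r, cosN, sinN, cos0, sin0) ?h; field.
Qed.

Lemma mean_riesz_maj a m : mean (riesz_maj a m) = (1 - a ^+ 2 / 8) ^+ m.
Proof.
apply: (@mean_riesz m 2 (w2 a)) => // x.
by rewrite /riesz_maj rc_prod; apply: eq_bigr => j _; rewrite trig_w2.
Qed.

Lemma expR_maj (y : R) : -1/8 <= y <= 1/8 -> (1 + y) ^+ 2 <= (1 + y - y ^+ 2 / 4) * expR y.
Proof.
move=> /andP[y1 y2].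
have h0 : 0 <= 1 + y - y ^+ 2 / 4 by nra.
(* This makes the claim polynomial: the surplus starts with y^2 / 8, and the remaining terms are
   smaller for |y| <= 1/8. *)
have h1 : (1 + y / 4) ^+ 4 <= expR y.
  have -> : expR y = expR (y / 4) ^+ 4.
    by rewrite -expRM_natl; congr expR; field.
  by rewrite lerXn2r ?nnegrE ?expR_ge0 ?expR_ge1Dx//; lra.
apply: le_trans (ler_wpM2l h0 h1).
rewrite -subr_ge0.
have -> : (1 + y - y ^+ 2 / 4) * (1 + y / 4) ^+ 4 - (1 + y) ^+ 2 =
  y ^+ 2 * (1 / 8 + 3 / 16 * y + (1 / 256 + 1 / 16 - 3 / 32) * y ^+ 2 + (1 / 256 - 1 / 64) * y ^+ 3 - 1 / 1024 * y ^+ 4).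
  by field.
apply: mulr_ge0; first exact: sqr_ge0.
have k2 : y ^+ 2 <= 1 / 64 by nra.
have k20 : 0 <= y ^+ 2 by exact: sqr_ge0.
have k3 : - (1/8) <= y ^+ 3 <= 1 / 8 by rewrite exprS; nra.
have k4 : 0 <= y ^+ 4 <= 1 / 64 by rewrite (_ : y ^+ 4 = y ^+ 2 * y ^+ 2); [nra|ring].
move: k3 k4 => /andP[k3 k3'] /andP[k4 k4']; lra.
Qed.

Lemma cos_bound a x : 0 <= a <= 1/8 -> -1/8 <= a * cos x <= 1/8.
Proof.
by move=> /andP[a0 a1]; have := cos_le1 x; have := cos_geN1 x => h1 h2; apply/andP; split; nra.
Qed.

Lemma riesz_maj_ge0 a m x : 0 <= a <= 1/8 -> 0 <= riesz_maj a m x.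
Proof.
by move=> ha; apply: prodr_ge0 => j _; have := cos_bound (10 ^+ j * x) ha; set y := a * _; nra.
Qed.

Lemma riesz_le a m x : 0 <= a <= 1/8 ->
  riesz a m x ^+ 2 <= riesz_maj a m x * expR (a * lac m x).
Proof.
move=> ha; rewrite /riesz /riesz_maj /lac mulr_sumr expR_sum -big_split/= -prodrXl.
apply: ler_prod => j _; rewrite sqr_ge0/=; apply: expR_maj; exact: cos_bound.
Qed.

Lemma smoothR_lacj j : smoothR (fun x : R => cos (10 ^+ j * x)).
Proof. by apply: smoothR_scale; exact: smoothR_cos. Qed.

Lemma smoothR_lac m : smoothR (lac m).
Proof. by apply: smoothR_sum => j; exact: smoothR_lacj. Qed.

Lemma smoothR_riesz a m : smoothR (riesz a m).
Proof.
apply: smoothR_prod => j; apply: smoothR_D; first exact: (smoothR_cst 1).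
by apply: smoothR_Z; exact: smoothR_lacj.
Qed.

Lemma smoothR_riesz_maj a m : smoothR (riesz_maj a m).
Proof.
apply: smoothR_prod => j.
have s1 : smoothR (fun x : R => a * cos (10 ^+ j * x)) by apply: smoothR_Z; exact: smoothR_lacj.
apply: smoothR_B; first by apply: smoothR_D; [exact: (smoothR_cst 1)|exact: s1].
have /(smoothR_Z 4^-1) := smoothR_X 2 s1.
by congr smoothR; apply/funext => x; rewrite mulrC.
Qed.

Lemma per2pi_lacj j : per2pi (fun x : R => cos (10 ^+ j * x)).
Proof.
move=> x; have := @per2pi_scale R _ (@cos R) (10 ^ j)%N%:Z _ x.
rewrite -pmulrn natrX; apply => y.
by rewrite mulr_natl cosD2pi.
Qed.

Lemma per2pi_lac m : per2pi (lac m).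
Proof. by move=> x; apply: eq_bigr => j _; rewrite per2pi_lacj. Qed.

Lemma per2pi_riesz a m : per2pi (riesz a m).
Proof. by move=> x; apply: eq_bigr => j _; rewrite per2pi_lacj. Qed.

Lemma lac_le m x : `|lac m x| <= m%:R.
Proof.
apply: (le_trans (ler_norm_sum _ _ _)); apply: (@le_trans _ _ (\sum_(j < m) 1)).
  by apply: ler_sum => j _; exact: cos_max.
by rewrite sumr_const card_ord.
Qed.

(** The number of nonzero digits: digits are shifted by 1, so the value 1 stands for frequency 0. *)
Definition wt m (f : {ffun 'I_m -> 'I_3}) : nat := \sum_(j < m) (f j != 1 :> nat).

Lemma riesz_coef a m (f : {ffun 'I_m -> 'I_3}) : \prod_(j < m) w1 a (f j) = (a / 2) ^+ wt f.
Proof.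
rewrite /wt expr_sum; apply: eq_bigr => j _; rewrite /w1.
by case: eqP => _; rewrite ?expr0 ?expr1.
Qed.

Lemma wt0 m (f : {ffun 'I_m -> 'I_3}) : wt f = 0%N -> f = [ffun _ => inord 1].
Proof.
move=> /eqP; rewrite sum_nat_eq0 => /forallP H; apply/ffunP => j; rewrite ffunE.
apply: val_inj => /=; rewrite inordK//.
by have := H j; rewrite /= eqb0 negbK => /eqP.
Qed.

Lemma wt_gen (b : R) m : \sum_(f : {ffun 'I_m -> 'I_3}) b ^+ wt f = (1 + 2 * b) ^+ m.
Proof.
transitivity (\prod_(j < m) \sum_(r < 3) b ^+ (r != 1 :> nat)).
  by rewrite bigA_distr_bigA; apply: eq_bigr => f _; rewrite /wt expr_sum.
rewrite prodr_const card_ord; congr (_ ^+ _).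
by rewrite !big_ord_recl big_ord0 /= expr0 expr1; ring.
Qed.

Definition riesz_comb (l : seq (R * R)) m x : R := \sum_(p <- l) p.1 * riesz p.2 m x.

(** The weights have total 1, so the constant term of the combination cancels against the subtracted
    1; hence the zero at [wt f = 0]. *)
Lemma riesz_comb_expand (l : seq (R * R)) m x :
  (\sum_(p <- l) p.1 * p.2 ^+ 0 = 1) ->
  rc (riesz_comb l m x) - 1 = \sum_(f : {ffun 'I_m -> 'I_3})
    (if wt f == 0%N then 0 else rc ((1 / 2) ^+ wt f * \sum_(p <- l) p.1 * p.2 ^+ wt f)) * e (@freq m 1 f) x.
Proof.
move=> l0.
have -> : rc (riesz_comb l m x) = \sum_(f : {ffun 'I_m -> 'I_3})
    rc ((1 / 2) ^+ wt f * \sum_(p <- l) p.1 * p.2 ^+ wt f) * e (@freq m 1 f) x.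
  rewrite /riesz_comb rc_sum.
  under eq_bigr => p _.
    rewrite rcM /riesz rc_prod.
    under eq_bigr => j _ do rewrite trig_w1.
    rewrite riesz_expand mulr_sumr; over.
  rewrite exchange_big/=; apply: eq_bigr => f _.
  rewrite mulr_sumr rc_sum mulr_suml; apply: eq_bigr => p _.
  by rewrite riesz_coef mulrA -rcM; congr (rc _ * _); rewrite !exprMn expr1n mul1r; set u := p.2 ^+ _; set v := _ ^+ _; ring.
pose f1 : {ffun 'I_m -> 'I_3} := [ffun _ => inord 1].
have wf1 : wt f1 = 0%N.
  by rewrite /wt big1// => j _; rewrite ffunE inordK.
rewrite (bigD1 f1)//= [in RHS](bigD1 f1)//= wf1 eqxx mul0r add0r l0 [_ ^+ 0]expr0 mul1r freq_mid e0 mulr1 (_ : rc 1 = 1)//.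
rewrite addrAC subrr add0r; apply: eq_bigr => f nf.
by case: eqP => // /wt0 E; rewrite E eqxx in nf.
Qed.

(** Orders up to L cancel. Beyond, a coefficient is at most 2^L 4^L (2 alpha)^wt / 2^wt = 8^L
    alpha^wt. Rankin's trick replaces the restriction wt > L by the factor [R0 ^ (wt - L)], at least
    1 there, and the unrestricted sum is the generating function [wt_gen]. *)
Lemma riesz_comb_lq (l : seq (R * R)) (L m : nat) (alpha q R0 : R) : 0 < q -> 0 < alpha -> 1 <= R0 ->
  size l = (2 ^ L)%N -> (forall p, p \in l -> `|p.1| <= 4 ^+ L) ->
  (forall p, p \in l -> alpha <= p.2 <= 2 * alpha) ->
  (forall k, (k <= L)%N -> \sum_(p <- l) p.1 * p.2 ^+ k = (k == 0%N)%:R) ->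
  sumbd (fun n => nm (fc (fun x => rc (riesz_comb l m x) - 1) n) `^ q)
    ((8 ^+ L) `^ q / R0 ^+ L * (1 + 2 * (R0 * alpha `^ q)) ^+ m).
Proof.
move=> q0 a0 R01 sl l1 l2 l3 s us.
have R00 : 0 < R0 by exact: lt_le_trans R01.
have -> : (fun x => rc (riesz_comb l m x) - 1) = (fun x => \sum_(f : {ffun 'I_m -> 'I_3})
    (if wt f == 0%N then 0 else rc ((1 / 2) ^+ wt f * \sum_(p <- l) p.1 * p.2 ^+ wt f)) * e (@freq m 1 f) x).
  by apply/funext => x; apply: riesz_comb_expand; rewrite l3.
apply: le_trans (fc_esum_lq _ (@freq_inj m 1 isT) q0 us) _.
rewrite -wt_gen mulr_sumr; apply: ler_sum => f _.
have P0 : 0 <= (8 ^+ L) `^ q / R0 ^+ L * (R0 * alpha `^ q) ^+ wt f.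
  by rewrite mulr_ge0 ?divr_ge0 ?exprn_ge0 ?mulr_ge0 ?powR_ge0// ltW.
case: eqP => [_|/eqP w0]; first by rewrite nm0 powR0 ?gt_eqF.
rewrite nm_real; have [wL|wL] := leqP (wt f) L.
  by rewrite l3// (negbTE w0) mulr0 normr0 powR0 ?gt_eqF.
have H1 : `|\sum_(p <- l) p.1 * p.2 ^+ wt f| <= 8 ^+ L * (2 * alpha) ^+ wt f.
  apply: le_trans (ler_norm_sum _ _ _) _.
  apply: (@le_trans _ _ (\sum_(p <- l) 4 ^+ L * (2 * alpha) ^+ wt f)).
    rewrite big_seq [leRHS]big_seq; apply: ler_sum => p pl.
    have /andP[p1 p2] := l2 p pl; have p0 : 0 <= p.2 by apply: le_trans p1; exact: ltW.
    rewrite normrM normrX (ger0_norm p0); apply: ler_pM; [exact: normr_ge0|exact: exprn_ge0|exact: l1|].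
    by rewrite lerXn2r ?nnegrE// mulr_ge0// ltW.
  rewrite big_const_seq count_predT sl iter_addr_0 -[leLHS]mulr_natl natrX mulrA -exprMn.
  by rewrite -natrM.
have H2 : `|(1 / 2) ^+ wt f * \sum_(p <- l) p.1 * p.2 ^+ wt f| <= 8 ^+ L * alpha ^+ wt f.
  rewrite normrM ger0_norm ?exprn_ge0 ?divr_ge0//.
  apply: le_trans (ler_wpM2l _ H1) _; first by rewrite exprn_ge0// divr_ge0.
  rewrite mulrCA -exprMn (_ : 1 / 2 * (2 * alpha) = alpha)//; by field.
apply: (@le_trans _ _ ((8 ^+ L * alpha ^+ wt f) `^ q)).
  by apply: ge0_ler_powR; rewrite ?nnegrE ?(ltW q0) ?mulr_ge0 ?exprn_ge0// ltW.
rewrite powRM ?exprn_ge0 ?(ltW a0)// -[alpha ^+ _]powR_mulrn ?(ltW a0)// powRAC powR_mulrn ?powR_ge0//.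
rewrite exprMn; set A := (8 ^+ L) `^ q; set B := (alpha `^ q) ^+ _.
have -> : A / R0 ^+ L * (R0 ^+ wt f * B) = A * B * (R0 ^+ wt f / R0 ^+ L) by ring.
rewrite ler_peMr ?mulr_ge0 ?powR_ge0 ?exprn_ge0 ?powR_ge0//.
by rewrite ler_pdivlMr ?exprn_gt0// mul1r; apply: ler_weXn2l => //; exact: ltnW.
Qed.

End Riesz.

(** * The functions g_k: small sets of a lacunary average avoided at little l_q cost *)

Section SpreadFunction.
Variable R : realType.
Notation C := R[i].
Implicit Types (x : R).

Lemma expr_small (k eta : R) : 0 <= k < 1 -> 0 < eta -> exists2 n, (0 < n)%N & k ^+ n <= eta.
Proof.
move=> /andP[k0 k1] e0.
have /cvgrPdist_le /(_ _ e0) : (fun n => k ^+ n) @ \oo --> (0 : R) by apply: cvg_expr; rewrite ger0_norm.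
move=> [N _ H]; exists N.+1 => //; have := H N.+1 (leqnSn N).
by rewrite sub0r normrN ger0_norm// exprn_ge0.
Qed.

Lemma expR1_le4 : expR 1 <= 4 :> R.
Proof.
have h : 1 / 2 <= expR (- (1 / 2)) :> R by apply: le_trans (expR_ge1Dx _); lra.
have -> : expR 1 = expR (1 / 2) ^+ 2 :> R by rewrite -expRM_natl; congr expR; field.
have h2 : expR (1 / 2) <= 2 :> R.
  rewrite expRN in h; have p := expR_gt0 (1 / 2 : R).
  by rewrite -[leLHS]invrK -[leRHS]invrK lef_pV2 ?posrE ?invr_gt0//; lra.
by have := expR_gt0 (1 / 2 : R) => h3; nra.
Qed.

Lemma expRN_le (n : nat) : expR (- n%:R) <= (1 / 2) ^+ n :> R.
Proof.
have h : 2 <= expR 1 :> R by apply: le_trans (expR_ge1Dx _); lra.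
have -> : - n%:R = n%:R * (-1) :> R by ring.
rewrite expRM_natl lerXn2r ?nnegrE ?expR_ge0 ?divr_ge0//.
by rewrite expRN div1r lef_pV2 ?posrE ?expR_gt0.
Qed.

Lemma sqr_sum_le (T : Type) (l : seq T) (F : T -> R) :
  (\sum_(i <- l) F i) ^+ 2 <= (size l)%:R * \sum_(i <- l) F i ^+ 2.
Proof.
elim: l => [|i l IH]; first by rewrite !big_nil expr0n mulr0.
rewrite !big_cons /=; set S := \sum_(j <- l) F j in IH *; set S2 := \sum_(j <- l) _ in IH *.
have [l0|l0] := eqVneq (size l) 0%N.
  by rewrite l0 /S /S2 (size0nil l0) !big_nil !addr0 mul1r.
have n0 : 0 < (size l)%:R :> R by rewrite ltr0n lt0n.
rewrite -natr1; move: (_%:R : R) n0 IH => n n0 IH.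
have h : 2 * F i * S <= n * F i ^+ 2 + S ^+ 2 / n.
  have : 0 <= (n * F i - S) ^+ 2 / n by rewrite divr_ge0 ?sqr_ge0// ltW.
  rewrite (_ : (n * F i - S) ^+ 2 / n = n * F i ^+ 2 + S ^+ 2 / n - 2 * F i * S); first by lra.
  by field; rewrite gt_eqF.
have h2 : S ^+ 2 / n <= S2 by rewrite ler_pdivrMr// mulrC.
have : (F i + S) ^+ 2 = F i ^+ 2 + 2 * F i * S + S ^+ 2 by ring.
by move=> ->; lra.
Qed.

(** Since [B <= 1] every coefficient is at most 1, so its q-th power is at most its square. *)
Lemma bessel_lq (p : R -> C) (q B : R) : 2 < q -> ccont p ->
  mean (fun x => nm (p x) ^+ 2) <= B -> B <= 1 ->
  sumbd (fun n => nm (fc p n) `^ q) B.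
Proof.
move=> q2 cp hB B1 s us.
apply: (le_trans _ hB); apply: (le_trans _ (bessel cp us)).
apply: ler_sum => n _.
have b1 : nm (fc p n) ^+ 2 <= 1.
  have := bessel cp (isT : uniq [:: n]); rewrite big_seq1 => /le_trans; apply.
  exact: le_trans hB B1.
have [->|x0] := eqVneq (nm (fc p n)) 0.
  by rewrite powR0 ?expr0n// gt_eqF// (lt_trans _ q2).
have xp : 0 < nm (fc p n) by rewrite lt_def x0 nm_ge0.
rewrite -powR_mulrn ?nm_ge0//; apply: ger_powR (ltW q2).
by rewrite xp /= -(@expr_le1 _ 2)// ltW.
Qed.

(** The decisive use of q > 2. With alpha = 1/A and m = 128 A^2 L, this inequality says that m times
    2 (8 8^q) alpha^q is at most L. The bound 16 on A makes all Riesz parameters at most 1/8. *)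
Lemma exists_scale (q : R) : 2 < q -> exists2 A : nat, (16 <= A)%N &
  256 * (8 * 8 `^ q) * A%:R ^+ 2 * (A%:R^-1) `^ q <= 1.
Proof.
move=> q2; pose K : R := 256 * (8 * 8 `^ q).
have K0 : 0 < K by rewrite /K pmulr_rgt0 ?ltr0n// pmulr_rgt0 ?ltr0n// powR_gt0.
have q20 : 0 < q - 2 by rewrite subr_gt0.
pose A := maxn 16 (Num.truncn (K `^ (q - 2)^-1)).+1.
exists A; first exact: leq_maxl.
have A0 : 0 < A%:R :> R by rewrite ltr0n /A leq_max.
have h : K <= A%:R `^ (q - 2).
  have -> : K = (K `^ (q - 2)^-1) `^ (q - 2).
    by rewrite -powRrM mulVf ?gt_eqF// powRr1// ltW.
  apply: ge0_ler_powR; rewrite ?nnegrE ?powR_ge0 ?(ltW q20) ?(ltW A0)//.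
  apply: ltW; apply: lt_le_trans (truncnS_gt _) _.
  by rewrite ler_nat leq_maxr.
have -> : A%:R^-1 `^ q = (A%:R `^ q)^-1 :> R.
  by rewrite -powR_inv1 ?(ltW A0)// powRAC powR_inv1// powR_ge0.
rewrite ler_pdivrMr ?powR_gt0// mul1r -/K.
have -> : A%:R `^ q = A%:R `^ (q - 2) * A%:R ^+ 2 :> R.
  by rewrite -powR_mulrn ?(ltW A0)// -powRD ?subrK// (gt_eqF A0) implybT.
by rewrite ler_wpM2r// exprn_ge0// ltW.
Qed.

Lemma sumbd_powR_sub (q A B : R) (u v : int -> C) : 1 < q ->
  sumbd (fun n => nm (u n) `^ q) A -> sumbd (fun n => nm (v n) `^ q) B ->
  sumbd (fun n => nm (u n - v n) `^ q) ((1 + 1) `^ q * (A + B)).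
Proof.
move=> q1 hA hB s us; have q0 : 0 < q := lt_trans ltr01 q1.
apply: (@le_trans _ _ (\sum_(k <- s) (1 + 1) `^ q * (nm (u k) `^ q + nm (v k) `^ q))).
  apply: ler_sum => k _.
  apply: (@le_trans _ _ ((nm (u k) + nm (v k)) `^ q)).
    apply: ge0_ler_powR; rewrite ?nnegrE ?(ltW q0) ?addr_ge0 ?nm_ge0//.
    by apply: le_trans (nmD _ _) _; rewrite nmN.
  have := powR_split q1 ltr01 (nm_ge0 (u k)) (nm_ge0 (v k)).
  by rewrite invr1 mulrDr.
rewrite -mulr_sumr big_split/= ler_wpM2l ?powR_ge0//.
by apply: lerD; [exact: hA|exact: hB].
Qed.

(** [delta] is chosen before [ep]: the size alpha is fixed by [exists_scale], and the error is made
    small through L, m and the exponent n of the cut-off only. *)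
Lemma spread_function (q : R) : 2 < q -> exists2 delta : R, 0 < delta &
  forall ep : R, 0 < ep -> exists m : nat, exists g : R -> R,
  [/\ (0 < m)%N, smoothR g, per2pi g, (forall t, lac m t / m%:R <= delta -> g t = 0) &
      sumbd (fun n => nm (fc (fun x => rc (g x)) n - (n == 0)%:R) `^ q) ep].
Proof.
move=> q2; have q0 : 0 < q by exact: lt_trans q2.
have [A A16 HA] := exists_scale q2.
have A0 : 0 < A%:R :> R by rewrite ltr0n; lia.
pose alpha : R := A%:R^-1.
have al0 : 0 < alpha by rewrite invr_gt0.
have al1 : 2 * alpha <= 1 / 8.
  have : 16 <= A%:R :> R by rewrite ler_nat.
  by rewrite /alpha ler_pdivrMr//; lra.
(* The cut-off acts between [delta] and [2 * delta = alpha / 16], the level at which the exponential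
   moment loses half of the decay exp(-a^2 m / 8) of the mean of [riesz_maj]. *)
pose delta := alpha / 32; have d0 : 0 < delta by rewrite divr_gt0.
exists delta => // ep ep0.
pose K : R := (1 + 1) `^ q; have K0 : 0 < K by rewrite powR_gt0.
have [L L0 HL] : exists2 L, (0 < L)%N & (1 / 2) ^+ L <= Num.min (ep / 4 / K) (1 / 2) :> R.
  apply: expr_small; first by lra.
  by rewrite lt_min !divr_gt0.
move: HL; rewrite le_min => /andP[HL1 HL2].
have [l [sl l1 l2 l3]] := vanishing_moments L0 al0.
(* Chosen so that alpha^2 m / 16 = 8 L, a decay exp(-8L) that beats the factor 64^L coming from the
   weights and the number of products. *)
pose m := (128 * A ^ 2 * L)%N.
have m0 : (0 < m)%N by rewrite /m muln_gt0 L0 andbT muln_gt0 expn_gt0 (leq_trans _ A16).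
have mR : 0 < m%:R :> R by rewrite ltr0n.
have mE : m%:R = 128 * A%:R ^+ 2 * L%:R :> R by rewrite /m !natrM expr2.
have alm : alpha ^+ 2 * m%:R = 128 * L%:R.
  by rewrite mE /alpha; field; rewrite gt_eqF.
pose Q := riesz_comb l m; pose X t : R := lac m t / m%:R.
have sQ : smoothR Q.
  by apply: smoothR_sum => p; apply: smoothR_Z; exact: smoothR_riesz.
have pQ : per2pi Q by move=> x; apply: eq_bigr => p _; rewrite per2pi_riesz.
have sX : smoothR (fun t => X t - delta).
  apply: smoothR_B; last exact: smoothR_cst.
  have /(smoothR_Z m%:R^-1) := smoothR_lac R m.
  by congr smoothR; apply/funext => t; rewrite mulrC.
have pX : per2pi X by move=> x; rewrite /X per2pi_lac.
have [Qb Qb0 HQb] := periodic_bounded pQ (smoothR_continuous sQ).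
have bd := bump_gt0 d0; have bd1 := bump_le1 delta.
(* The alternative 1/2, here and for 2^-L, keeps the L^2 bound for [E] at most 1, as [bessel_lq]
   requires. *)
pose ep1 := Num.min (ep / 4 / K) (1 / 2).
have ep10 : 0 < ep1 by rewrite lt_min !divr_gt0.
have [n n0 Hn] : exists2 n, (0 < n)%N & (1 - bump delta) ^+ n <= Num.min 1 (ep1 / (Qb ^+ 2 + 1)).
  apply: expr_small; first by lra.
  by rewrite lt_min ltr01 divr_gt0// ltr_wpDl// sqr_ge0.
move: Hn; rewrite le_min => /andP[Hn1 Hn2].
pose U t := (1 - bump (X t - delta)) ^+ n.
have sB : smoothR (fun t => bump (X t - delta)) by exact: (smoothR_comp (smoothR_bump R) sX).
have sU : smoothR U by apply: smoothR_X; apply: smoothR_B => //; exact: (smoothR_cst 1).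
have pU : per2pi U by move=> x; rewrite /U pX.
pose g t := Q t * (1 - U t); pose E t := Q t * U t.
have sE : smoothR E by exact: smoothR_M.
have U01 t : 0 <= U t <= 1.
  rewrite /U exprn_ge0 ?subr_ge0 ?bump_le1//=.
  by rewrite exprn_ile1 ?subr_ge0 ?bump_le1// gerBl bump_ge0.
(* [U] is 1 where [X <= delta], and so small where [X > 2 delta] that [E = Q U] is
   negligible there; elsewhere [Q] is small in quadratic mean. *)
exists m, g; split => //.
- by apply: smoothR_M => //; apply: smoothR_B => //; exact: (smoothR_cst 1).
- by move=> x; rewrite /g pQ pU.
- move=> t ht; rewrite /g /U bump_le0 ?subr0 ?expr1n ?subrr ?mulr0//.
  by rewrite subr_le0.
have part1 : sumbd (fun n => nm (fc (fun x => rc (Q x) - 1) n) `^ q) (ep / 4 / K).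
  move=> s us; apply: (le_trans _ HL1).
  (* The Rankin parameter is R0 = 8 8^q: it absorbs (8^L)^q and leaves 8^-L, while the generating
     function costs at most exp(L) <= 4^L, for a total of 2^-L. *)
  have q81 : 1 <= 8 * 8 `^ q :> R.
    have := le1r_powR (ler1n R 8) (ltW (lt_trans (ltr1n R 2) q2)); clear; lra.
  apply: (le_trans (@riesz_comb_lq R l L m alpha q _ q0 al0 q81 sl l1 l2 l3 s us)) => {s us}.
  have h1 : (1 + 2 * (8 * 8 `^ q * alpha `^ q)) ^+ m <= 4 ^+ L.
    apply: (@le_trans _ _ (expR (2 * (8 * 8 `^ q * alpha `^ q)) ^+ m)).
      have ps : 0 <= 2 * (8 * 8 `^ q * alpha `^ q) by rewrite !mulr_ge0 ?powR_ge0.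
      by rewrite lerXn2r ?nnegrE ?expR_ge0 ?expR_ge1Dx ?addr_ge0.
    rewrite -expRM_natl; apply: (@le_trans _ _ (expR L%:R)).
      rewrite ler_expR mE -[leRHS]mul1r.
      have -> : 128 * A%:R ^+ 2 * L%:R * (2 * (8 * 8 `^ q * alpha `^ q)) =
         256 * (8 * 8 `^ q) * A%:R ^+ 2 * alpha `^ q * L%:R by ring.
      by rewrite ler_wpM2r.
    rewrite -[L%:R]mulr1 expRM_natl lerXn2r ?nnegrE ?expR_ge0//; exact: expR1_le4.
  have P8 : 0 < 8 `^ q :> R by exact: powR_gt0.
  have -> : (8 ^+ L) `^ q = (8 `^ q) ^+ L :> R.
    by rewrite -[8 ^+ L]powR_mulrn// powRAC powR_mulrn// ltW.
  apply: le_trans (ler_wpM2l _ h1) _; first by rewrite divr_ge0// exprn_ge0// ?mulr_ge0// ltW.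
  rewrite -expr_div_n -exprMn (_ : 8 `^ q / (8 * 8 `^ q) * 4 = 1 / 2)//.
  by field; rewrite gt_eqF.
have hp p : p \in l -> 0 <= p.2 <= 1/8.
  move=> pl; have := l2 p pl => /andP[h1 h2]; move: al0 al1 h1 h2; clear => *.
  by apply/andP; split; lra.
(* Here 32 = 2 * 16: the factor 2^L is Cauchy-Schwarz over the products, and 16^L bounds the squared
   weights. *)
pose Maj t := 32 ^+ L * \sum_(p <- l) riesz_maj p.2 m t * expR (p.2 ^+ 2 * m%:R / 16).
have HE t : E t ^+ 2 <= Maj t + ep1.
  have Maj0 : 0 <= Maj t.
    rewrite mulr_ge0 ?exprn_ge0// big_seq; apply: sumr_ge0 => p /hp h.
    by rewrite mulr_ge0 ?expR_ge0// riesz_maj_ge0.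
  have /andP[U0 U1] := U01 t.
  have [Xt|Xt] := leP (X t) (2 * delta).
    apply: (@le_trans _ _ (Q t ^+ 2)).
      by rewrite exprMn ler_piMr ?sqr_ge0// exprn_ile1.
    apply: (@le_trans _ _ (Maj t)); last by rewrite lerDl ltW.
    apply: le_trans (sqr_sum_le _ _) _.
    rewrite sl natrX /Maj (_ : 32 = 2 * 16); last by rewrite -natrM.
    rewrite exprMn -mulrA ler_wpM2l ?exprn_ge0// mulr_sumr big_seq [leRHS]big_seq.
    apply: ler_sum => p pl; rewrite exprMn.
    have /andP[a1 a2] := l2 p pl.
    apply: ler_pM; rewrite ?sqr_ge0//.
      rewrite -(real_normK (num_real p.1)) (_ : 16 = 4 ^+ 2); last by rewrite -natrX.
      by rewrite exprAC lerXn2r ?nnegrE ?exprn_ge0 ?l1.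
    apply: le_trans (riesz_le _ _ (hp p pl)) _.
    rewrite ler_wpM2l ?riesz_maj_ge0 ?hp// ler_expR.
    move: Xt; rewrite /X ler_pdivrMr// => Xt.
    have p20 : 0 <= p.2 := le_trans (ltW al0) a1.
    apply: le_trans (ler_wpM2l p20 Xt) _.
    have -> : p.2 * (2 * delta * m%:R) = p.2 * alpha * m%:R / 16 by rewrite /delta; field.
    rewrite ler_wpM2r ?invr_ge0// ler_wpM2r// expr2 ler_wpM2l//.
  apply: (@le_trans _ _ ep1); last by rewrite lerDr.
  have hU : U t <= (1 - bump delta) ^+ n.
    rewrite lerXn2r ?nnegrE ?subr_ge0 ?bump_le1// lerD2l lerN2 bump_nondecreasing//.
    by move: Xt; clear; lra.
  have hQ : Q t ^+ 2 <= Qb ^+ 2.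
    by rewrite -(real_normK (num_real (Q t))) lerXn2r ?nnegrE ?HQb.
  have hU2 : U t ^+ 2 <= ep1 / (Qb ^+ 2 + 1).
    apply: (@le_trans _ _ (U t)); first by rewrite expr2 ler_piMr.
    exact: le_trans hU Hn2.
  rewrite exprMn; apply: le_trans (ler_pM _ _ hQ hU2) _; rewrite ?sqr_ge0//.
  have Q1 : 0 < Qb ^+ 2 + 1 by rewrite ltr_wpDl// sqr_ge0.
  rewrite mulrA ler_pdivrMr// mulrC ler_wpM2l ?(ltW ep10)// lerDl//.
have cMaj : continuous Maj.
  apply: contZ; apply: cont_sum => p.
  apply: contM; last exact: cont_cst.
  by apply: smoothR_continuous; exact: smoothR_riesz_maj.
(* Each product has mean at most exp(-p.2^2 m / 16) <= exp(-8L) <= 256^-L, and 32^L 2^L 256^-L =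
   4^-L. *)
have mMaj : mean Maj <= (1 / 2) ^+ L.
  rewrite /Maj mean_Z; last first.
    apply: cont_sum => p; apply: contM; last exact: cont_cst.
    by apply: smoothR_continuous; exact: smoothR_riesz_maj.
  rewrite mean_sum; last first.
    move=> p; apply: contM; last exact: cont_cst.
    by apply: smoothR_continuous; exact: smoothR_riesz_maj.
  apply: (@le_trans _ _ (32 ^+ L * \sum_(p <- l) (1 / 256) ^+ L)).
    rewrite ler_wpM2l ?exprn_ge0// big_seq [leRHS]big_seq; apply: ler_sum => p pl.
    have -> : mean (fun x => riesz_maj p.2 m x * expR (p.2 ^+ 2 * m%:R / 16)) =
        expR (p.2 ^+ 2 * m%:R / 16) * mean (riesz_maj p.2 m).
      rewrite -mean_Z; last by apply: smoothR_continuous; exact: smoothR_riesz_maj.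
      by congr mean; apply/funext => x; rewrite mulrC.
    rewrite mean_riesz_maj.
    have /andP[a1 a2] := l2 p pl; have /andP[b1 b2] := hp p pl.
    apply: (@le_trans _ _ (expR (p.2 ^+ 2 * m%:R / 16) * expR (- (p.2 ^+ 2 / 8)) ^+ m)).
      rewrite ler_wpM2l ?expR_ge0// lerXn2r ?nnegrE ?expR_ge0 ?expR_ge1Dx//.
      by rewrite subr_ge0; move: b1 b2; clear; nra.
    rewrite -expRM_natl -expRD.
    have -> : p.2 ^+ 2 * m%:R / 16 + m%:R * - (p.2 ^+ 2 / 8) = - (p.2 ^+ 2 * m%:R / 16) by field.
    apply: (@le_trans _ _ (expR (- (8 * L)%:R))).
      rewrite ler_expR lerN2 natrM.
      have -> : 8 * L%:R = alpha ^+ 2 * m%:R / 16 by rewrite alm; field.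
      by rewrite ler_wpM2r ?invr_ge0// ler_wpM2r// lerXn2r ?nnegrE// ltW.
    apply: le_trans (expRN_le _) _; rewrite exprM expr_div_n expr1n.
    by rewrite (_ : 2 ^+ 8 = 256)// -natrX.
  rewrite big_const_seq count_predT sl iter_addr_0 -[X in _ * X]mulr_natl natrX mulrA -!exprMn.
  have h0 : (0 : R) <= 32 * 2 * (1 / 256) by lra.
  have h1 : (32 : R) * 2 * (1 / 256) <= 1 / 2 by lra.
  by rewrite lerXn2r ?nnegrE// divr_ge0.
have cE : continuous E by exact: smoothR_continuous.
have part2 : sumbd (fun n => nm (fc (fun x => rc (E x)) n) `^ q) ((1 / 2) ^+ L + ep1).
  apply: bessel_lq => //; first exact: ccont_real.
    have -> : (fun x => nm (rc (E x)) ^+ 2) = (fun x => E x ^+ 2).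
      by apply/funext => x; rewrite nm_real real_normK// num_real.
    apply: (@le_trans _ _ (mean (fun x => Maj x + ep1))).
      apply: mean_le => //; last by apply: contD => //; exact: cont_cst.
      by apply: smoothR_continuous; exact: smoothR_X.
    by rewrite mean_D ?mean_cst ?lerD2r//; exact: cont_cst.
  have : ep1 <= 1 / 2 by rewrite ge_min lexx orbT.
  by move: HL2; clear; lra.
move=> s us.
have cQ1 : ccont (fun x => rc (Q x) - 1).
  by apply: ccont_B; [apply: ccont_real; exact: smoothR_continuous|exact: ccont_cst].
have cEc : ccont (fun x => rc (E x)) by exact: ccont_real.
have c1 : ccont (fun=> 1 : C) by exact: ccont_cst.
have gE k : fc (fun x => rc (g x)) k - (k == 0)%:R =
    fc (fun x => rc (Q x) - 1) k - fc (fun x => rc (E x)) k.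
  have f1 : fc (fun=> 1 : C) k = (k == 0)%:R.
    rewrite /fc; have -> : (fun x => 1 * e (- k) x) = @e R (- k).
      by apply/funext => x; rewrite mul1r.
    by rewrite cmean_e oppr_eq0.
  rewrite -f1 -!fc_B//; last first.
    apply: ccont_real; apply: smoothR_continuous; apply: smoothR_M => //.
    by apply: smoothR_B => //; exact: (smoothR_cst 1).
  suff -> : (fun x => rc (g x) - 1) = (fun x => (rc (Q x) - 1) - rc (E x)) by [].
  by apply/funext => x; rewrite /g /E mulrBr mulr1 rcB addrAC.
have ep14 : ep1 <= ep / 4 / K by rewrite ge_min lexx.
have q1 : 1 < q := lt_trans (ltr1n R 2) q2.
under eq_bigr do rewrite gE.
apply: (le_trans (sumbd_powR_sub q1 part1 part2 us)).
rewrite -/K -ler_pdivlMl// [leRHS]mulrC.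
rewrite (_ : ep / K = ep / 4 / K + (ep / 4 / K + ep / 4 / K) + ep / 4 / K); last by rewrite -!mulrDl; congr (_ / _); field.
rewrite -[leLHS]addr0; apply: lerD; last by rewrite !divr_ge0// ltW.
by rewrite lerD2l lerD.
Qed.

End SpreadFunction.

(** * Distributions with coefficients in l_q *)

Section Distributions.
Variable R : realType.
Notation C := R[i].
Notation circle := (circle R).
Implicit Types (p r : R -> C) (x y : R) (z w : C) (phi psi f : circle -> C).

Definition lift phi x : C := phi (circle_pi x).
(** [repr] is an arbitrary section of the quotient map, so [desc] is a meaningful inverse of [lift]
    on periodic functions only. *)
Definition desc p (t : circle) : C := p (repr t).

Lemma circle_pi_repr (t : circle) : circle_pi (repr t) = t.
Proof. exact: (@reprK _ {eq_quot (@circle_equiv R)}). Qed.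

Lemma circle_pi_per x : circle_pi (x + 2 * pi) = circle_pi x.
Proof. by apply/circle_piP; exists 1; rewrite mul1r addrAC subrr add0r. Qed.

Lemma repr_circle_pi x : exists k : int, repr (circle_pi x) = x + k%:~R * (2 * pi).
Proof.
have /circle_piP[k hk] : circle_pi (repr (circle_pi x)) = circle_pi x by exact: circle_pi_repr.
by exists k; rewrite -hk addrC subrK.
Qed.

Lemma per2pi_lift phi : per2pi (lift phi).
Proof. by move=> x; rewrite /lift circle_pi_per. Qed.

Lemma descK p : per2pi p -> lift (desc p) = p.
Proof.
move=> pp; apply/funext => x; rewrite /lift /desc.
by have [k ->] := repr_circle_pi x; rewrite periodic_int.
Qed.

Lemma smoothP phi : smooth phi <-> csmooth (lift phi).
Proof.
split=> [H|[[H1] [H2]] k x]; last by split; [exact: H1|exact: H2].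
split; split=> k x; [exact: (H k x).1|exact: (H k x).2].
Qed.

Lemma smooth_desc p : csmooth p -> per2pi p -> smooth (desc p).
Proof. by move=> sp pp; apply/smoothP; rewrite descK. Qed.

Lemma characterE n : character n = desc (e (- n)).
Proof.
apply/funext => t; rewrite /character /desc /e mulrNz mulNr cosN sinN.
by [].
Qed.

Lemma lift_character n : lift (character n) = e (- n).
Proof. by rewrite characterE descK//; exact: e_periodic. Qed.

Lemma smooth_character n : smooth (@character R n).
Proof. by rewrite characterE; apply: smooth_desc; [exact: csmooth_e|exact: e_periodic]. Qed.

Lemma iter_deriveE k phi x : iter_derive k phi x = cDn k (lift phi) x.
Proof.
suff H : cDn k (lift phi) = (fun x => derive1n k (re_lift phi) x +i* derive1n k (im_lift phi) x) by rewrite H.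
elim: k => [|k IH]; first by apply/funext => y; rewrite /cDn /= -complex_eta.
by rewrite /cDn iterS -/(cDn k _) IH; apply/funext => y; rewrite /cD /=.
Qed.

Lemma deriv_normP k phi x : smooth phi -> nm (cDn k (lift phi) x) <= deriv_norm k phi.
Proof.
move=> /smoothP sp.
have /csmooth_ccont[c1 c2] := csmooth_cDn k sp.
have pp := periodic_cDn k (@per2pi_lift phi).
have [M1 M10 H1] := periodic_bounded (fun x => congr1 (fun z : C => complex.Re z) (pp x)) c1.
have [M2 M20 H2] := periodic_bounded (fun x => congr1 (fun z : C => complex.Im z) (pp x)) c2.
apply: ub_le_sup; last by exists x => //; rewrite iter_deriveE.
exists (M1 + M2) => _ [y _ <-]; rewrite iter_deriveE.
by apply: le_trans (nm_le _) _; apply: lerD.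
Qed.

Lemma deriv_norm_ge0 k phi : smooth phi -> 0 <= deriv_norm k phi.
Proof. by move=> /(deriv_normP k 0)/(le_trans _); apply; exact: nm_ge0. Qed.

Lemma deriv_norm_le k phi (B : R) : (forall x, nm (cDn k (lift phi) x) <= B) -> deriv_norm k phi <= B.
Proof.
move=> H; apply: ge_sup; first by exists (nm (iter_derive k phi 0)), 0.
by move=> _ [y _ <-]; rewrite iter_deriveE; exact: H.
Qed.

(* Unbundled [schwartz_distribution], for products and limits. *)
Record isdist (L : (circle -> C) -> C) : Prop := IsDist {
  isdist_linear : forall (a : C) phi psi, smooth phi -> smooth psi ->
    L (fun t => a * phi t + psi t) = a * L phi + L psi ;
  isdist_cont : exists (N : nat) (K : R), forall phi, smooth phi ->
    nm (L phi) <= K * \sum_(k < N.+1) deriv_norm k phi }.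

Definition coef (L : (circle -> C) -> C) (n : int) : C := L (character n).

Lemma schwartz_isdist (S : schwartz_distribution R) : isdist S.
Proof. by split; [exact: dist_linear|exact: dist_continuous]. Qed.

Lemma isdist_schwartz L : isdist L -> exists S : schwartz_distribution R, dist_fun S = L.
Proof. by case=> h1 h2; exists (SchwartzDistribution h1 h2). Qed.

Lemma smooth_D phi psi : smooth phi -> smooth psi -> smooth (fun t => phi t + psi t).
Proof. by move=> /smoothP h1 /smoothP h2; apply/smoothP; exact: csmooth_D. Qed.

Lemma smooth_M phi psi : smooth phi -> smooth psi -> smooth (fun t => phi t * psi t).
Proof. by move=> /smoothP h1 /smoothP h2; apply/smoothP; exact: csmooth_M. Qed.

Lemma smooth_Z z phi : smooth phi -> smooth (fun t => z * phi t).
Proof. by move=> /smoothP h1; apply/smoothP; exact: csmooth_Z. Qed.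

Lemma smooth_cst z : smooth (fun _ : circle => z).
Proof. by apply/smoothP; exact: csmooth_cst. Qed.

(** Numerical part of [isdist_mul]: [a], [b], [c] and [u], [v], [w] stand for the derivative norms
    of orders 0, 1, 2 of the factors, [D0] and [D2] for those of the product. *)
Lemma leibniz_arith (a b c u v w D0 D2 : R) : 0 <= a -> 0 <= b -> 0 <= c ->
  0 <= u -> 0 <= v -> 0 <= w -> D0 <= a * u -> D2 <= c * u + 2 * (b * v) + a * w ->
  2 * D0 + 8 * D2 <= (2 * a + 8 * (c + 2 * b + a)) * (u + v + w).
Proof.
move=> a0 b0 c0 u0 v0 w0 H0 H2.
have p k l : 0 <= k -> 0 <= l -> 0 <= k * l :> R by exact: mulr_ge0.
have := p _ _ a0 u0; have := p _ _ a0 v0; have := p _ _ a0 w0.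
have := p _ _ b0 u0; have := p _ _ b0 v0; have := p _ _ b0 w0.
have := p _ _ c0 u0; have := p _ _ c0 v0; have := p _ _ c0 w0.
lra.
Qed.

Section Functional.
Variable L : (circle -> C) -> C.
Hypothesis dL : isdist L.

Lemma dist0 : L (fun=> 0) = 0.
Proof.
have := isdist_linear dL 1 (smooth_cst 0) (smooth_cst 0).
under eq_fun do rewrite mulr0 addr0.
by rewrite mul1r => /eqP; rewrite -subr_eq0 opprD addNKr oppr_eq0 => /eqP.
Qed.

Lemma distZ z phi : smooth phi -> L (fun t => z * phi t) = z * L phi.
Proof.
move=> sp; have := isdist_linear dL z sp (smooth_cst 0).
by under eq_fun do rewrite addr0; rewrite dist0 addr0.
Qed.

Lemma distD phi psi : smooth phi -> smooth psi ->
  L (fun t => phi t + psi t) = L phi + L psi.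
Proof.
move=> s1 s2; have := isdist_linear dL 1 s1 s2.
by under eq_fun do rewrite mul1r; rewrite mul1r.
Qed.

Lemma smooth_B phi psi : smooth phi -> smooth psi -> smooth (fun t => phi t - psi t).
Proof. by move=> /smoothP h1 /smoothP h2; apply/smoothP; exact: csmooth_B. Qed.

Lemma distB phi psi : smooth phi -> smooth psi ->
  L (fun t => phi t - psi t) = L phi - L psi.
Proof.
move=> s1 s2; have -> : (fun t => phi t - psi t) = (fun t => (-1) * psi t + phi t).
  by apply/funext => t; rewrite mulN1r addrC.
by rewrite (isdist_linear dL)// mulN1r addrC.
Qed.

Lemma smooth_sum (T : Type) (s : seq T) (F : T -> circle -> C) : (forall i, smooth (F i)) ->
  smooth (fun t => \sum_(i <- s) F i t).
Proof. by move=> H; apply/smoothP; apply: csmooth_sum => i; apply/smoothP. Qed.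

Lemma dist_sum (T : Type) (s : seq T) (F : T -> circle -> C) : (forall i, smooth (F i)) ->
  L (fun t => \sum_(i <- s) F i t) = \sum_(i <- s) L (F i).
Proof. exact: (additive_fun_sum (smooth_cst 0) smooth_D dist0 distD). Qed.

Lemma smooth_desc_e n : smooth (desc (e n)).
Proof. by apply: smooth_desc; [exact: csmooth_e|exact: e_periodic]. Qed.

(** Since [character n] is [e (- n)], frequencies appear with opposite sign in [coef]. *)
Lemma dist_fejer N p : L (desc (fejer N p)) =
  rc N%:R^-1 * \sum_(a < N) \sum_(b < N) fc p (a%:Z - b%:Z) * coef L (b%:Z - a%:Z).
Proof.
have se n z : smooth (fun t : circle => z * desc (e n) t) by apply: smooth_Z; exact: smooth_desc_e.
rewrite /fejer.
rewrite -[desc _]/(fun t : circle => rc N%:R^-1 *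
  \sum_(a < N) \sum_(b < N) fc p (a%:Z - b%:Z) * desc (e (a%:Z - b%:Z)) t).
rewrite distZ; last by apply: smooth_sum => a; exact: smooth_sum.
congr (_ * _); rewrite dist_sum; last by move=> a; exact: smooth_sum.
apply: eq_bigr => a _; rewrite dist_sum//; apply: eq_bigr => b _.
by rewrite distZ; [rewrite /coef characterE opprB|exact: smooth_desc_e].
Qed.

Lemma dist_fejer_cvg phi : smooth phi -> forall ep : R, 0 < ep ->
  exists N, nm (L phi - L (desc (fejer N.+1 (lift phi)))) <= ep.
Proof.
move=> sp ep ep0; have csp := (smoothP phi).1 sp.
have [N [K HK]] := isdist_cont dL.
pose e1 := ep / ((`|K| + 1) * N.+1%:R).
have D0 : 0 < (`|K| + 1) * N.+1%:R by rewrite mulr_gt0 ?ltr0n// ltr_wpDl.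
have e10 : 0 < e1 by rewrite divr_gt0.
have H k : exists N0, forall M, (N0 <= M)%N -> forall x,
   nm (fejer M.+1 (cDn k (lift phi)) x - cDn k (lift phi) x) <= e1.
  apply: fejer_uniform e10; first exact: csmooth_cDn.
  by apply: periodic_cDn; exact: per2pi_lift.
have [N0 HN0] := choice H.
pose M := \max_(k < N.+1) N0 k; exists M.
have sf : smooth (desc (fejer M.+1 (lift phi))).
  by apply: smooth_desc; [exact: csmooth_fejer|exact: per2pi_fejer].
rewrite -distB//; apply: le_trans (HK _ (smooth_B sp sf)) _.
have Bk (k : 'I_N.+1) : deriv_norm k (fun t => phi t - desc (fejer M.+1 (lift phi)) t) <= e1.
  apply: deriv_norm_le => x.
  have -> : lift (fun t => phi t - desc (fejer M.+1 (lift phi)) t) =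
      (fun x => lift phi x - fejer M.+1 (lift phi) x).
    by rewrite -[in RHS](descK (@per2pi_fejer R M.+1 (lift phi))).
  rewrite cDn_B//; last exact: csmooth_fejer.
  rewrite cDn_fejer//; last exact: per2pi_lift.
  by rewrite nmB; apply: HN0; exact: leq_bigmax.
have S0 : 0 <= \sum_(k < N.+1) deriv_norm k (fun t => phi t - desc (fejer M.+1 (lift phi)) t).
  by apply: sumr_ge0 => k _; apply: deriv_norm_ge0; exact: smooth_B.
apply: (@le_trans _ _ ((`|K| + 1) * \sum_(k < N.+1) e1)).
  apply: (@le_trans _ _ ((`|K| + 1) * \sum_(k < N.+1) deriv_norm k (fun t => phi t - desc (fejer M.+1 (lift phi)) t))).
    by rewrite ler_wpM2r// (le_trans (ler_norm _))// lerDl.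
  by rewrite ler_wpM2l ?addr_ge0// ler_sum.
rewrite sumr_const card_ord -[e1 *+ _]mulr_natl mulrA /e1 mulrC divfK// gt_eqF//.
Qed.

Lemma uniq_shift_ord (N a : nat) (n : int) : uniq [seq a%:Z - b%:Z + n | b <- iota 0 N].
Proof. by rewrite map_inj_uniq ?iota_uniq// => b c /addIr/addrI/oppr_inj[]. Qed.

(* The Fejer means of the test function reduce a bound on the distribution to a
   bound on finite sums of Fourier coefficients. *)
Lemma dist_le phi (B : R) : smooth phi ->
  (forall s, uniq s -> \sum_(k <- s) nm (fc (lift phi) k) * nm (coef L (- k)) <= B) ->
  nm (L phi) <= B.
Proof.
move=> sp HB; apply/ler_addgt0Pl => ep ep0.
have [N HN] := dist_fejer_cvg sp ep0.
have -> : L phi = (L phi - L (desc (fejer N.+1 (lift phi)))) + L (desc (fejer N.+1 (lift phi))).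
  by rewrite subrK.
apply: le_trans (nmD _ _) _; apply: lerD => //.
rewrite dist_fejer nmM nm_real ger0_norm ?invr_ge0//.
rewrite mulrC ler_pdivrMr ?ltr0n//.
apply: le_trans (nm_sum _ _) _.
apply: (@le_trans _ _ (\sum_(a < N.+1) B)); last by rewrite sumr_const card_ord mulr_natr.
apply: ler_sum => a _; apply: le_trans (nm_sum _ _) _.
have := HB _ (uniq_shift_ord N.+1 a 0); rewrite big_map.
rewrite -{1}[N.+1]subn0 -/(index_iota 0 N.+1) big_mkord; apply: le_trans.
by apply: ler_sum => b _; rewrite nmM addr0 opprB.
Qed.

(** Bounded coefficients force order at most 2 with an explicit constant. This yields continuity of
    products and the rate of convergence of the multiplied distributions on each test function. *)
Lemma dist_le_sup phi (s : R) : smooth phi -> (forall n, nm (coef L n) <= s) ->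
  nm (L phi) <= s * (2 * deriv_norm 0 phi + 8 * deriv_norm 2 phi).
Proof.
move=> sp Hs; have s0 : 0 <= s := le_trans (nm_ge0 _) (Hs 0).
apply: dist_le => // t ut.
apply: (@le_trans _ _ (s * \sum_(k <- t) nm (fc (lift phi) k))).
  by rewrite mulr_sumr; apply: ler_sum => k _; rewrite mulrC ler_wpM2r ?nm_ge0.
rewrite ler_wpM2l//; apply: sum_fc_le => //.
- exact/smoothP.
- exact: per2pi_lift.
- by move=> x; exact: (deriv_normP 0).
- by move=> x; exact: deriv_normP.
Qed.

(** Multiplication by [character n] shifts the spectrum of [phi], so the coefficients of the product
    of [phi] and [L] are dominated by finite parts of a convolution. *)
Lemma dist_char_le phi n (B : R) : smooth phi ->
  (forall s, uniq s -> \sum_(k <- s) nm (fc (lift phi) k) * nm (coef L (n - k)) <= B) ->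
  nm (L (fun t => phi t * character n t)) <= B.
Proof.
move=> sp HB; apply: dist_le => [|s us]; first by apply: smooth_M => //; exact: smooth_character.
have := HB _ (shift_uniq (- n) us); rewrite big_map; apply: le_trans.
apply: ler_sum => k _.
rewrite (_ : n - (k - - n) = - k); last by ring.
rewrite (_ : fc (lift (fun t => phi t * character n t)) k = fc (lift phi) (k - - n))//.
rewrite /fc -[lift _]/(fun x => lift phi x * lift (character n) x) lift_character.
congr cmean; apply/funext => x; rewrite -mulrA -eD; congr (_ * e _ _); ring.
Qed.

Lemma dist_zero : (forall n, coef L n = 0) -> forall phi, smooth phi -> L phi = 0.
Proof.
move=> H phi sp; apply: nm_eq0; apply/eqP; rewrite eq_le nm_ge0 andbT.
by have := @dist_le_sup phi 0 sp; rewrite mul0r; apply => n; rewrite H nm0.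
Qed.

Lemma isdist_mul f (s : R) : smooth f -> (forall n, nm (coef L n) <= s) ->
  isdist (fun phi => L (fun t => f t * phi t)).
Proof.
move=> sf Hs; split.
  move=> a phi psi s1 s2; rewrite -(isdist_linear dL); [|exact: smooth_M|exact: smooth_M].
  by congr L; apply/funext => t; rewrite mulrDr mulrCA.
have s0 : 0 <= s := le_trans (nm_ge0 _) (Hs 0).
pose F k := deriv_norm k f.
have F0 k : 0 <= F k by exact: deriv_norm_ge0.
pose K := s * (2 * F 0%N + 8 * (F 2%N + 2 * F 1%N + F 0%N)).
exists 2%N, K => phi sp; rewrite !big_ord_recr big_ord0 /= [0 + _]add0r.
pose d k := deriv_norm k phi; have d0 k : 0 <= d k by exact: deriv_norm_ge0.
rewrite -/(d 0%N) -/(d 1%N) -/(d 2%N).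
have sfp := smooth_M sf sp.
have csf := (smoothP f).1 sf; have csp := (smoothP phi).1 sp.
have H0 : deriv_norm 0 (fun t => f t * phi t) <= F 0%N * d 0%N.
  apply: deriv_norm_le => x; rewrite [cDn 0 _ x]/(lift f x * lift phi x) nmM.
  by apply: ler_pM; rewrite ?nm_ge0 ?(deriv_normP 0).
have H2 : deriv_norm 2 (fun t => f t * phi t) <= F 2%N * d 0%N + 2 * (F 1%N * d 1%N) + F 0%N * d 2%N.
  apply: deriv_norm_le => x.
  have -> : cDn 2 (lift (fun t => f t * phi t)) x =
    cDn 2 (lift f) x * lift phi x + 2 * (cDn 1 (lift f) x * cDn 1 (lift phi) x) + lift f x * cDn 2 (lift phi) x.
    rewrite -[lift _]/(fun x => lift f x * lift phi x) -[cDn 2 (fun x => _)]/(cD (cD (fun x => lift f x * lift phi x))).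
    rewrite cD_M// cD_D; last 2 first.
    - by apply: csmooth_M => //; exact: csmooth_cD.
    - by apply: csmooth_M => //; exact: csmooth_cD.
    rewrite (cD_M (csmooth_cD csf) csp) (cD_M csf (csmooth_cD csp)).
    rewrite -[cDn 2 (lift f)]/(cD (cD (lift f))) -[cDn 2 (lift phi)]/(cD (cD (lift phi))).
    rewrite -[cDn 1 (lift f)]/(cD (lift f)) -[cDn 1 (lift phi)]/(cD (lift phi)).
    move: (cD (cD (lift f)) x) (cD (lift f) x) (lift f x) => a1 a2 a3.
    move: (cD (cD (lift phi)) x) (cD (lift phi) x) (lift phi x) => b1 b2 b3.
    by rewrite mulr_natl mulr2n !addrA.
  have n2 : nm (2 : C) = 2 by rewrite -rc_nat nm_real ger0_norm.
  apply: le_trans (nmD _ _) _; apply: lerD; first apply: le_trans (nmD _ _) _; first apply: lerD.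
  - by rewrite nmM; apply: ler_pM; rewrite ?nm_ge0 ?(deriv_normP 0) ?deriv_normP.
  - by rewrite !nmM n2 ler_wpM2l//; apply: ler_pM; rewrite ?nm_ge0 ?deriv_normP.
  - by rewrite nmM; apply: ler_pM; rewrite ?nm_ge0 ?(deriv_normP 0) ?deriv_normP.
apply: (le_trans (dist_le_sup sfp Hs)); rewrite /K -[leRHS]mulrA; apply: (ler_wpM2l s0).
exact: leibniz_arith (F0 0%N) (F0 1%N) (F0 2%N) (d0 0%N) (d0 1%N) (d0 2%N) H0 H2.
Qed.

End Functional.
End Distributions.

(** * One multiplication by a dilated function *)

Section Step.
Variable R : realType.
Notation C := R[i].
Notation circle := (circle R).
Implicit Types (p r : R -> C) (x y : R) (z w : C) (phi psi f : circle -> C).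

(** Passage to the limit on a fixed finite set: a uniform error [eta] is absorbed because [s] is
    finite. Used for suprema of partial convolutions and for the limiting distribution. *)
Lemma powR_sum_approx (q : R) (s : seq int) (u : int -> R) (B : R) : 1 < q -> 0 <= B ->
  (forall n, 0 <= u n) ->
  (forall eta : R, 0 < eta -> exists v : int -> R, [/\ (forall n, n \in s -> 0 <= v n),
     (forall n, n \in s -> u n <= v n + eta) & \sum_(n <- s) v n `^ q <= B]) ->
  \sum_(n <- s) u n `^ q <= B.
Proof.
move=> q1 B0 u0 H; have q0 : 0 < q := lt_trans ltr01 q1.
apply/ler_addgt0Pl => ep ep0.
have B1 : 0 < B + 1 by rewrite ltr_wpDl.
have [eta eta0 Heta] := powR_near1 q0 (divr_gt0 (divr_gt0 ep0 (ltr0n R 2)) B1).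
pose K := (1 + eta^-1) `^ q * ((size s)%:R + 1).
have K0 : 0 < K.
  by apply: mulr_gt0; [rewrite powR_gt0// addr_gt0// invr_gt0|rewrite ltr_wpDl].
pose tau := (ep / 2 / K) `^ q^-1.
have tau0 : 0 < tau by rewrite powR_gt0// !divr_gt0.
have tauq : tau `^ q = ep / 2 / K by rewrite -powRrM mulVf ?gt_eqF// powRr1// ltW// !divr_gt0.
have [v [v0 uv Sv]] := H tau tau0.
apply: (@le_trans _ _ (\sum_(n <- s) ((1 + eta) `^ q * v n `^ q + (1 + eta^-1) `^ q * tau `^ q))).
  rewrite big_seq [leRHS]big_seq; apply: ler_sum => n ns.
  apply: (le_trans _ (powR_split q1 eta0 (v0 n ns) (ltW tau0))).
  by apply: ge0_ler_powR; rewrite ?nnegrE ?(ltW q0) ?addr_ge0 ?v0 ?(ltW tau0)// uv.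
rewrite big_split/= -mulr_sumr big_const_seq count_predT iter_addr_0 -[_ *+ size s]mulr_natr tauq.
rewrite addrC [leRHS]addrC; rewrite [leRHS]addrC -[in leRHS](addrC B).
apply: (@le_trans _ _ (ep / 2 + (B + ep / 2))); last first.
  by rewrite addrCA -splitr.
apply: lerD.
  have -> : (1 + eta^-1) `^ q * (ep / 2 / K) * (size s)%:R =
     (ep / 2 / K) * ((1 + eta^-1) `^ q * (size s)%:R) by ring.
  rewrite -[leRHS](divfK (lt0r_neq0 K0)) ler_wpM2l ?divr_ge0 ?(ltW K0) ?(ltW ep0)//.
  by rewrite /K ler_wpM2l ?powR_ge0// lerDl.
apply: (le_trans (ler_wpM2l (powR_ge0 _ _) Sv)).
apply: (le_trans (ler_wpM2r B0 Heta)).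
by rewrite mulrDl mul1r lerD2l mulrAC ler_pdivrMr// ler_wpM2l ?divr_ge0 ?(ltW ep0)// lerDl.
Qed.

Definition cosum (m Lam : nat) (t : circle) : R := lac m (Lam%:Z%:~R * repr t) / m%:R.

Definition vanishes (L : (circle -> C) -> C) (U : set circle) :=
  forall phi, smooth phi -> fun_support phi `<=` U -> L phi = 0.

Lemma fc_bd (g : R -> C) : csmooth g -> per2pi g -> exists G : R, sumbd (fun n => nm (fc g n)) G.
Proof.
move=> sg pg.
have B k : exists M : R, forall x, nm (cDn k g x) <= M.
  have [M1 _ H1] := periodic_bounded (fun x => congr1 (fun z : C => complex.Re z) (periodic_cDn k pg x))
     (ccont_Re (csmooth_ccont (csmooth_cDn k sg))).
  have [M2 _ H2] := periodic_bounded (fun x => congr1 (fun z : C => complex.Im z) (periodic_cDn k pg x))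
     (ccont_Im (csmooth_ccont (csmooth_cDn k sg))).
  by exists (M1 + M2) => x; apply: le_trans (nm_le _) _; apply: lerD.
have [M0 H0] := B 0%N; have [M2 H2] := B 2%N.
exists (2 * M0 + 8 * M2) => s us; exact: sum_fc_le.
Qed.

Lemma sum_scale (G : int -> C) (Lam : nat) (v : int -> R) (n : int) (s : seq int) : (0 < Lam)%N -> uniq s ->
  exists2 t, uniq t & \sum_(j <- s) nm (if (Lam%:Z %| j)%Z then G (j %/ Lam%:Z)%Z else 0) * v (n - j) =
    \sum_(k <- t) nm (G k) * v (n - k * Lam%:Z).
Proof.
move=> L0 us; pose t := [seq (j %/ Lam%:Z)%Z | j <- s & (Lam%:Z %| j)%Z].
have mulK j : (Lam%:Z %| j)%Z -> ((j %/ Lam%:Z)%Z * Lam%:Z = j)%R by exact: divzK.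
exists t.
  rewrite map_inj_in_uniq ?filter_uniq// => j k; rewrite !mem_filter => /andP[/mulK hj _] /andP[/mulK hk _] E.
  by rewrite -hj -hk E.
rewrite /t big_map big_filter big_mkcond/= [RHS]big_mkcond/=; apply: eq_bigr => j _.
by case: ifP => [/mulK ->//|_]; rewrite nm0 mul0r.
Qed.

Variables (q delta : R).
Hypothesis q2 : 2 < q.
Hypothesis spread : forall ep : R, 0 < ep -> exists m : nat, exists g : R -> R,
  [/\ (0 < m)%N, smoothR g, per2pi g, (forall t, lac m t / m%:R <= delta -> g t = 0) &
      sumbd (fun n => nm (fc (fun x => rc (g x)) n - (n == 0)%:R) `^ q) ep].

Let q1 : 1 < q := lt_trans (ltr1n R 2) q2.
Let q0 : 0 < q := lt_trans ltr01 q1.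

Lemma lq_bounded (c : int -> C) V : sumbd (fun n => nm (c n) `^ q) V ->
  forall n, nm (c n) <= V `^ q^-1.
Proof.
move=> H n; apply: (powR_le_inj q1); rewrite ?nm_ge0 ?powR_ge0//.
rewrite -powRrM mulVf ?gt_eqF// powRr1; last exact: sumbd_ge0 H.
exact: (sumbd_le n H).
Qed.

(** Frequency 0 is separated: there the coefficient is within [eta] of 1, and elsewhere the q-th
    powers sum to at most [e1]. *)
Lemma spread_total (u : int -> R) (e1 eta eps : R) : (forall n, 0 <= u n) -> 0 < eta ->
  (1 + eta) `^ q <= 1 + e1 -> eps <= e1 -> eps <= eta `^ q ->
  forall c : int -> C, (forall n, u n = nm (c n)) ->
  sumbd (fun n => nm (c n - (n == 0)%:R) `^ q) eps -> sumbd (fun n => u n `^ q) (1 + e1 + e1).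
Proof.
move=> u0 eta0 Heta ee1 eeta c uc H.
have K (t : seq int) : uniq t -> 0 \notin t -> \sum_(n <- t) u n `^ q <= e1.
  move=> ut t0; apply: (le_trans _ ee1); apply: (le_trans _ (H _ ut)).
  rewrite big_seq [leRHS]big_seq; apply: ler_sum => n nt.
  by rewrite uc (_ : (n == 0) = false) ?subr0//; apply: contraNF t0 => /eqP <-.
have u00 : u 0 `^ q <= 1 + e1.
  apply: (le_trans _ Heta); apply: ge0_ler_powR; rewrite ?nnegrE ?(ltW q0) ?u0 ?addr_ge0 ?(ltW eta0)//.
  rewrite uc -[c 0](subrK 1); apply: le_trans (nmD _ _) _.
  rewrite nm1 addrC lerD2l; apply: (powR_le_inj q1); rewrite ?nm_ge0 ?(ltW eta0)//.
  by apply: (le_trans _ eeta); have := sumbd_le 0 H; rewrite eqxx.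
have e10 : 0 <= e1 by apply: le_trans (K [::] isT isT); rewrite big_nil.
move=> s us; have [s0|s0] := boolP (0 \in s).
  rewrite (big_rem 0)//= lerD//; apply: K; first exact: rem_uniq.
  by rewrite mem_rem_uniq// inE eqxx.
apply: (le_trans (K _ us s0)); rewrite lerDr.
by apply: (le_trans _ u00); exact: powR_ge0.
Qed.

(** [L'] is [L] multiplied by g(Lam t). The dilation Lam is taken beyond the thresholds of
    [conv_le], for the norm, and of [conv_sup], for the closeness of coefficients, and beyond [k0],
    so that the dilations tend to infinity. *)
Lemma dist_step (L : (circle -> C) -> C) (V : R) : isdist L ->
  sumbd (fun n => nm (coef L n) `^ q) V -> forall (ep : R) (k0 : nat), 0 < ep ->
  exists L' (m Lam : nat), [/\ isdist L', sumbd (fun n => nm (coef L' n) `^ q) (V + ep),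
    (forall n, nm (coef L' n - coef L n) <= ep), (0 < m)%N /\ (k0 <= Lam)%N &
    (forall U, vanishes L U -> vanishes L' U) /\
    (forall phi, smooth phi -> (forall t, delta < cosum m Lam t -> phi t = 0) -> L' phi = 0)].
Proof.
move=> dL hV ep k0 ep0; have V0 := sumbd_ge0 hV.
have VV : 0 < V + 1 by rewrite ltr_wpDl.
pose e1 := ep / 4 / (V + 1); have e10 : 0 < e1 by rewrite !divr_gt0.
have [eta eta0 Heta] := powR_near1 q0 e10.
pose W := V `^ q^-1; have W0 : 0 <= W by exact: powR_ge0.
have W1 : 0 < W + 1 by rewrite ltr_wpDl.
(* [W] is the l_q norm bound for the coefficients of [L]; with this [kap], the main term [kap * W]
   of [conv_sup] is at most [ep / 2]. *)
pose kap := ep / 2 / (W + 1); have kap0 : 0 < kap by rewrite !divr_gt0.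
pose eps := Num.min e1 (Num.min (eta `^ q) (kap `^ q)).
have eps0 : 0 < eps by rewrite !lt_min e10 !powR_gt0.
have ee1 : eps <= e1 by rewrite ge_min lexx.
have eeta : eps <= eta `^ q by rewrite !ge_min lexx orbT.
have ekap : eps <= kap `^ q by rewrite !ge_min lexx !orbT.
have [m [g [m0 sg pg gz hg]]] := spread eps0.
pose G x : C := rc (g x); pose G1 x : C := G x - 1.
have sG : csmooth G by exact: csmooth_real.
have pG : per2pi G by move=> x; rewrite /G pg.
have sG1 : csmooth G1 by apply: csmooth_B => //; exact: csmooth_cst.
have pG1 : per2pi G1 by move=> x; rewrite /G1 pG.
have fG1 k : fc G1 k = fc G k - (k == 0)%:R.
  rewrite fc_B; [|exact: csmooth_ccont|exact: ccont_cst]; congr (_ - _).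
  rewrite /fc; have -> : (fun x => 1 * e (- k) x) = @e R (- k).
    by apply/funext => x; rewrite mul1r.
  by rewrite cmean_e oppr_eq0.
have [B HB] := fc_bd sG pG; have [B1 HB1] := fc_bd sG1 pG1.
pose u k := nm (fc G k); pose u1 k := nm (fc G1 k); pose v n := nm (coef L n).
have v0 n : 0 <= v n by exact: nm_ge0.
have hu : sumbd (fun k => u k `^ q) (1 + e1 + e1).
  by apply: (@spread_total u e1 eta eps _ eta0 Heta ee1 eeta (fc G)) => // n; exact: nm_ge0.
have hu1 k : u1 k <= kap.
  apply: (powR_le_inj q1); rewrite ?nm_ge0 ?(ltW kap0)//; apply: (le_trans _ ekap).
  by rewrite /u1 fG1; exact: (sumbd_le k hg).
have ep2 : 0 < ep / 2 by rewrite divr_gt0.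
have [L1 HL1] := conv_le q1 (fun k => nm_ge0 (fc G k)) v0 HB hu hV ep2.
have [L2 HL2] := conv_sup q1 (fun k => nm_ge0 (fc G1 k)) v0 HB1 hu1 hV ep2.
pose Lam := (maxn L1 L2 + k0).+1.
have Lam0 : (0 < Lam)%N by [].
have Lam1 : (L1 <= Lam)%N := leqW (leq_trans (leq_maxl _ _) (leq_addr _ _)).
have Lam2 : (L2 <= Lam)%N := leqW (leq_trans (leq_maxr _ _) (leq_addr _ _)).
pose F x := G (Lam%:Z%:~R * x).
have sF : csmooth F by exact: csmooth_scale.
have pF : per2pi F by exact: per2pi_scale.
pose f := desc F; have lf : lift f = F by exact: descK.
have sf : smooth f by exact: smooth_desc.
pose L' phi := L (fun t => f t * phi t).
have dL' : isdist L' by apply: (isdist_mul dL sf); exact: lq_bounded hV.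
have fF k : fc F k = if (Lam%:Z %| k)%Z then fc G (k %/ Lam%:Z)%Z else 0 by exact: fc_scale.
exists L', m, Lam; split=> //.
- move=> s us.
  have UV : (1 + e1 + e1) * V + ep / 2 <= V + ep.
    rewrite -addrA mulrDl mul1r -addrA lerD2l [leRHS]splitr lerD2r.
    have : e1 * V <= ep / 4.
      by rewrite /e1 mulrAC ler_pdivrMr// ler_wpM2l ?divr_ge0 ?(ltW ep0)// lerDl.
    have <- : ep / 4 + ep / 4 = ep / 2 by field.
    by move=> h; rewrite mulrDl; exact: lerD.
  apply: (le_trans _ UV); apply: powR_sum_approx => //.
    apply: addr_ge0; last exact: ltW.
    by apply: mulr_ge0 => //; rewrite -addrA addr_ge0// addr_ge0// ltW.
    by move=> n; exact: nm_ge0.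
  move=> et et0.
  have H n : exists t, uniq t /\ nm (coef L' n) <= \sum_(k <- t) u k * v (n - k * Lam%:Z) + et.
    (* If every finite part of the convolution stayed below [nm (coef L' n) - et], then
       [dist_char_le] would bound [nm (coef L' n)] by that same number. *)
    apply: contrapT => /forallNP Hn.
    suff : nm (coef L' n) <= nm (coef L' n) - et by rewrite lerBrDr gerDl leNgt et0.
    apply: (dist_char_le dL sf) => s' us'; rewrite lf.
    under eq_bigr do rewrite fF.
    have [t ut ->] := sum_scale (fc G) v n Lam0 us'.
    by rewrite lerBrDr; apply: ltW; rewrite ltNge; apply/negP => h; apply: (Hn t).
  have [t Ht] := choice H.
  (* One index set serving all [n] in [s], because [conv_le] sums over [n] with a fixed inner set;
     enlarging the inner sets only increases nonnegative sums. *)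
  pose T := undup (flatten [seq t n | n <- s]).
  exists (fun n => \sum_(k <- T) u k * v (n - k * Lam%:Z)); split.
  + by move=> n _; apply: sumr_ge0 => k _; rewrite mulr_ge0// nm_ge0.
  + move=> n ns; have [ut h] := Ht n; apply: (le_trans h); rewrite lerD2r.
    apply: le_sum_subset => // [k kt|k]; last by rewrite mulr_ge0// nm_ge0.
    by rewrite mem_undup; apply/flatten_mapP; exists n.
  + by apply: HL1 => //; exact: undup_uniq.
- move=> n.
  have -> : coef L' n - coef L n = L (fun t => (f t - 1) * character n t).
    rewrite /coef /L' -distB//.
    + by congr L; apply/funext => t; rewrite mulrBl mul1r.
    + by apply: smooth_M => //; exact: smooth_character.
    + exact: smooth_character.
  apply: (dist_char_le dL); first by apply: smooth_B => //; exact: smooth_cst.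
  move=> s us.
  have lf1 : lift (fun t => f t - 1) = (fun x => G1 (Lam%:Z%:~R * x)).
    by rewrite -[lift _]/(fun x => lift f x - 1) lf.
  rewrite lf1; under eq_bigr do rewrite (fc_scale _ sG1 pG1 Lam0).
  have [t ut ->] := sum_scale (fc G1) v n Lam0 us.
  apply: (le_trans (HL2 _ Lam2 n t ut)).
  rewrite [leRHS]splitr lerD2r -/W /kap mulrAC ler_pdivrMr// ler_wpM2l ?(ltW ep2)//.
  by rewrite lerDl.
- by split=> //; exact: leqW (leq_addl _ _).
- split=> [U HU phi sp Hp|phi sp H].
    apply: HU; first exact: smooth_M.
    apply: (subset_trans _ Hp); apply: closure_subset => t /= ft0 pt0; apply: ft0.
    by rewrite pt0 mulr0.
  rewrite /L' -[RHS](dist0 dL); congr L; apply/funext => t.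
  have [ht|ht] := leP (cosum m Lam t) delta; last by rewrite H// mulr0.
  by rewrite /f /desc /F /G gz// mul0r.
Qed.

End Step.

(** * Iteration and the limiting distribution *)

Section Limit.
Variable R : realType.
Notation C := R[i].
Notation circle := (circle R).
Implicit Types (x y : R) (z w : C) (phi psi f : circle -> C).

Lemma half_small (K eta : R) : 0 < eta -> exists k0, forall k, (k0 <= k)%N -> K * (1 / 2) ^+ k <= eta.
Proof.
move=> e0; have K1 : 0 < `|K| + 1 by rewrite ltr_wpDl.
have h01 : 0 <= (1 / 2 : R) < 1 by rewrite divr_ge0//= ltr_pdivrMr// mul1r ltr1n.
have [k0 _ H] := expr_small h01 (divr_gt0 e0 K1).
exists k0 => k hk; apply: (@le_trans _ _ ((`|K| + 1) * (1 / 2) ^+ k0)).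
  apply: (@le_trans _ _ ((`|K| + 1) * (1 / 2) ^+ k)).
    by rewrite ler_wpM2r ?exprn_ge0 ?divr_ge0// (le_trans (ler_norm _))// lerDl.
  rewrite ler_wpM2l ?(ltW K1)//; apply: ler_wiXn2l => //; lra.
by rewrite mulrC -ler_pdivlMr.
Qed.

Lemma half_zero z (K : R) k0 : (forall k, (k0 <= k)%N -> nm z <= K * (1 / 2) ^+ k) -> z = 0.
Proof.
move=> H; apply: nm_le0P => ep ep0; have [k1 H1] := half_small K ep0.
by apply: (le_trans (H (maxn k0 k1) (leq_maxl _ _))); apply: H1; exact: leq_maxr.
Qed.

(** Nested intervals: [u k - r k] increases, [u k + r k] decreases, and the limit lies in all of
    them, which gives the explicit rate. *)
Lemma real_seq_limit (u : nat -> R) (K : R) : 0 <= K ->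
  (forall k, `|u k.+1 - u k| <= K * (1 / 2) ^+ k.+1) ->
  exists l, forall k, `|u k - l| <= K * (1 / 2) ^+ k.
Proof.
move=> K0 H; pose r k := K * (1 / 2) ^+ k.
have r0 k : 0 <= r k by rewrite mulr_ge0// exprn_ge0// divr_ge0.
have rS k : r k = r k.+1 + r k.+1 by rewrite /r exprS; field.
have lo k : u k - r k <= u k.+1 - r k.+1.
  by have := H k; rewrite -/(r k.+1) ler_norml (rS k) => /andP[]; lra.
have hi k : u k.+1 + r k.+1 <= u k + r k.
  by have := H k; rewrite -/(r k.+1) ler_norml (rS k) => /andP[]; lra.
have loM j k : u j - r j <= u (j + k)%N - r (j + k)%N.
  by elim: k => [|k IH]; rewrite ?addn0// addnS (le_trans IH).
have hiM j k : u (j + k)%N + r (j + k)%N <= u j + r j.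
  by elim: k => [|k IH]; rewrite ?addn0// addnS (le_trans _ IH).
have cross j k : u j - r j <= u k + r k.
  have [jk|/ltnW kj] := leqP j k.
    have := loM j (k - j)%N; rewrite subnKC// => /le_trans; apply.
    by have := r0 k; lra.
  have := hiM k (j - k)%N; rewrite subnKC// => h; apply: (le_trans _ h).
  by have := r0 j; lra.
pose A := range (fun k => u k - r k).
exists (sup A) => k; rewrite ler_norml -/(r k).
have h1 : u k - r k <= sup A.
  apply: ub_le_sup; last by exists k.
  by exists (u 0%N + r 0%N) => _ [j _ <-].
have h2 : sup A <= u k + r k.
  by apply: ge_sup => [|_ [j _ <-]]; [exists (u 0%N - r 0%N), 0%N|exact: cross].
by apply/andP; split; lra.
Qed.

Lemma complex_seq_limit (u : nat -> C) (K : R) : 0 <= K ->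
  (forall k, nm (u k.+1 - u k) <= K * (1 / 2) ^+ k.+1) ->
  exists l, forall k, nm (u k - l) <= 2 * K * (1 / 2) ^+ k.
Proof.
move=> K0 H.
have [a Ha] : exists l, forall k, `|complex.Re (u k) - l| <= K * (1 / 2) ^+ k.
  by apply: real_seq_limit => // k; rewrite -ReB; apply: le_trans (Re_le_nm _) (H k).
have [b Hb] : exists l, forall k, `|complex.Im (u k) - l| <= K * (1 / 2) ^+ k.
  by apply: real_seq_limit => // k; rewrite -ImB; apply: le_trans (Im_le_nm _) (H k).
exists (a +i* b) => k; apply: le_trans (nm_le _) _; rewrite ReB ImB /=.
by rewrite -mulrA mulr_natl mulr2n lerD.
Qed.

Lemma sum_ord_le (d : nat -> R) (n m : nat) : (forall k, 0 <= d k) ->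
  \sum_(k < n) d k <= \sum_(k < n + m) d k.
Proof.
move=> d0; elim: m => [|m IH]; first by rewrite addn0.
by rewrite addnS big_ord_recr/= (le_trans IH)// lerDl.
Qed.

(** The extra [M] lets functionals of different orders be bounded by a common sum of norms. *)
Lemma isdist_bound (L : (circle -> C) -> C) : isdist L -> exists N, exists2 K : R, 0 <= K &
  forall M phi, smooth phi -> nm (L phi) <= K * \sum_(k < N + M) deriv_norm k phi.
Proof.
case=> _ [N [K H]]; exists N.+1, `|K| => // M phi sp.
have d0 k : 0 <= deriv_norm k phi by exact: deriv_norm_ge0.
apply: (le_trans (H phi sp)).
apply: (@le_trans _ _ (`|K| * \sum_(k < N.+1) deriv_norm k phi)).
  by rewrite ler_wpM2r ?ler_norm// sumr_ge0.
rewrite ler_wpM2l//; exact: (@sum_ord_le (fun k => deriv_norm k phi) N.+1 M).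
Qed.

Lemma isdist_sub (L L' : (circle -> C) -> C) : isdist L -> isdist L' -> isdist (fun phi => L phi - L' phi).
Proof.
move=> dL dL'; split=> [a phi psi s1 s2|].
  by rewrite (isdist_linear dL)// (isdist_linear dL')//; ring.
have [N [K K0 H]] := isdist_bound dL; have [N' [K' K'0 H']] := isdist_bound dL'.
exists (N + N')%N, (K + K') => phi sp.
apply: le_trans (nmD _ _) _; rewrite nmN mulrDl; apply: lerD.
  by rewrite -addnS; exact: H.
by rewrite addnC -addnS; exact: H'.
Qed.

Variables (q delta : R).
Hypothesis q2 : 2 < q.
Hypothesis spread : forall ep : R, 0 < ep -> exists m : nat, exists g : R -> R,
  [/\ (0 < m)%N, smoothR g, per2pi g, (forall t, lac m t / m%:R <= delta -> g t = 0) &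
      sumbd (fun n => nm (fc (fun x => rc (g x)) n - (n == 0)%:R) `^ q) ep].

Let q1 : 1 < q := lt_trans (ltr1n R 2) q2.

Definition lq_dist (p : ((circle -> C) -> C) * R) :=
  isdist p.1 /\ sumbd (fun n => nm (coef p.1 n) `^ q) p.2.

Lemma dist_seq (L : (circle -> C) -> C) (V ep : R) : isdist L ->
  sumbd (fun n => nm (coef L n) `^ q) V -> 0 < ep ->
  exists (Ls : nat -> (circle -> C) -> C) (ms Lams : nat -> nat), Ls 0%N = L /\
  forall k, [/\ isdist (Ls k), sumbd (fun n => nm (coef (Ls k) n) `^ q) (V + ep),
    (forall n, nm (coef (Ls k.+1) n - coef (Ls k) n) <= ep * (1 / 2) ^+ k.+1),
    (0 < ms k)%N /\ (k <= Lams k)%N &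
    (forall U, vanishes (Ls k) U -> vanishes (Ls k.+1) U) /\
    (forall phi, smooth phi -> (forall t, delta < cosum (ms k) (Lams k) t -> phi t = 0) -> Ls k.+1 phi = 0)].
Proof.
move=> dL hV ep0; pose ek k : R := ep * (1 / 2) ^+ k.
have ek0 k : 0 < ek k by rewrite mulr_gt0// exprn_gt0// divr_gt0.
pose step (x : nat * {p | lq_dist p}) (y : {p | lq_dist p} * (nat * nat)) :=
  let: (k, d) := x in let: (d', (m, Lam)) := y in
  [/\ (sval d').2 = (sval d).2 + ek k.+1,
    (forall n, nm (coef (sval d').1 n - coef (sval d).1 n) <= ek k.+1),
    (0 < m)%N /\ (k <= Lam)%N &
    (forall U, vanishes (sval d).1 U -> vanishes (sval d').1 U) /\
    (forall phi, smooth phi -> (forall t, delta < cosum m Lam t -> phi t = 0) -> (sval d').1 phi = 0)].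
have [F HF] : {F & forall d, step d (F d)}.
  apply: choice => -[k [[M W] [/= dM hM]]].
  have [M' [m [Lam [h1 h2 h3 h4 h5]]]] := dist_step q2 spread dM hM k (ek0 k.+1).
  by exists (exist lq_dist (M', W + ek k.+1) (conj h1 h2), (m, Lam)).
pose St := fix St k : {p | lq_dist p} := if k is k'.+1 then (F (k', St k')).1 else exist lq_dist (L, V) (conj dL hV).
have HSt k := HF (k, St k).
pose ms k := (F (k, St k)).2.1; pose Lams k := (F (k, St k)).2.2.
exists (fun k => (sval (St k)).1), ms, Lams; split=> // k.
have E j : step (j, St j) (St j.+1, (ms j, Lams j)).
  by rewrite /ms /Lams /=; have := HSt j; case: (F _) => [? [? ?]].
(* The running bound plus the unspent budget is invariant, because [ek j] is twice [ek j.+1]. *)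
have VE j : (sval (St j)).2 + ek j = V + ep.
  elim: j => [|j <-]; first by rewrite /= /ek expr0 mulr1.
  have [-> _ _ _] := E j; rewrite -addrA; congr (_ + _).
  by rewrite /ek exprS; field.
have [_ e2 e3 e4] := E k; have [d1 d2] := svalP (St k).
split=> // s us; apply: (le_trans (d2 s us)).
by rewrite -(VE k) lerDl ltW.
Qed.

Lemma dist_limit (L : (circle -> C) -> C) (V : R) (n0 : int) : isdist L ->
  sumbd (fun n => nm (coef L n) `^ q) V -> coef L n0 <> 0 ->
  exists (L1 : (circle -> C) -> C) (ms Lams : nat -> nat), [/\ isdist L1,
    exists B, sumbd (fun n => nm (coef L1 n) `^ q) B, coef L1 n0 <> 0,
    forall k, (0 < ms k)%N /\ (k <= Lams k)%N &
    (forall U, vanishes L U -> vanishes L1 U) /\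
    (forall k, vanishes L1 [set t | cosum (ms k) (Lams k) t < delta])].
Proof.
move=> dL hV n0L.
have c0 : 0 < nm (coef L n0).
  by rewrite lt_def nm_ge0 andbT; apply/eqP => /nm_eq0.
(* All displacements of the coefficient at [n0] together amount to at most half of its size, so it
   survives in the limit. *)
pose ep := nm (coef L n0) / 2; have ep0 : 0 < ep by rewrite divr_gt0.
have [Ls [ms [Lams [Ls0 H]]]] := dist_seq dL hV ep0.
pose K phi := ep * (2 * deriv_norm 0 phi + 8 * deriv_norm 2 phi).
have K0 phi : smooth phi -> 0 <= K phi.
  by move=> sp; rewrite mulr_ge0 ?(ltW ep0)// addr_ge0// mulr_ge0// deriv_norm_ge0.
(* Consecutive functionals differ by one with coefficients at most [ep * (1 / 2) ^+ k.+1];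
   [dist_le_sup] turns this into geometric convergence on each smooth [phi]. *)
have HL phi : exists l, smooth phi -> forall k, nm (Ls k phi - l) <= 2 * K phi * (1 / 2) ^+ k.
  have [sp|] := pselect (smooth phi); last by exists 0.
  have [|l Hl] := @complex_seq_limit (fun k => Ls k phi) (K phi) (K0 phi sp); last by exists l.
  move=> k; have [d1 _ d2 _ _] := H k; have [d1' _ _ _ _] := H k.+1.
  have := dist_le_sup (isdist_sub d1' d1) sp d2.
  by rewrite /K mulrAC.
have [L1 HL1] := choice HL.
have van phi k : smooth phi -> (forall j, (k <= j)%N -> Ls j phi = 0) -> L1 phi = 0.
  move=> sp hz; apply: (@half_zero _ (2 * K phi) k) => j kj.
  by have := HL1 phi sp j; rewrite hz// sub0r nmN.
have dL1 : isdist L1.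
  split.
    move=> a phi psi s1 s2; apply/eqP; rewrite -subr_eq0; apply/eqP.
    have s3 : smooth (fun t => a * phi t + psi t) by apply: smooth_D => //; exact: smooth_Z.
    set chi := (fun t => a * phi t + psi t) in s3 *.
    apply: (@half_zero _ (2 * K chi + (nm a * (2 * K phi) + 2 * K psi)) 0) => k _.
    have -> : L1 chi - (a * L1 phi + L1 psi) =
      - (Ls k chi - L1 chi) + (a * (Ls k phi - L1 phi) + (Ls k psi - L1 psi)).
      by have [d1 _ _ _ _] := H k; rewrite /chi (isdist_linear d1)//; ring.
    apply: le_trans (nmD _ _) _; rewrite nmN mulrDl; apply: lerD; first exact: HL1.
    apply: le_trans (nmD _ _) _; rewrite mulrDl; apply: lerD; last exact: HL1.
    by rewrite nmM -mulrA ler_wpM2l ?nm_ge0// HL1.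
  have [N [K1 K10 HK]] := isdist_bound dL.
  (* [L1] is compared with [Ls 0 = L]. The difference is at most [2 * K phi], and 20 = 2 (2 + 8). *)
  exists (N + 2)%N, (K1 + 20 * ep) => phi sp.
  have d0 k : 0 <= deriv_norm k phi by exact: deriv_norm_ge0.
  have -> : L1 phi = L phi - (L phi - L1 phi) by rewrite subKr.
  apply: le_trans (nmD _ _) _; rewrite nmN mulrDl; apply: lerD.
    by rewrite -addnS; exact: HK.
  have := HL1 phi sp 0%N; rewrite Ls0 expr0 mulr1 => h; apply: (le_trans h).
  set S := \sum_(k < _) _.
  have S0 : deriv_norm 0 phi <= S.
    by have := @sum_ord_le (fun k => deriv_norm k phi) 1 (N + 2) d0; rewrite big_ord1 add1n.
  have S2 : deriv_norm 2 phi <= S.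
    have h3 := @sum_ord_le (fun k => deriv_norm k phi) 3 N d0.
    rewrite /S -addnS addnC; apply: (le_trans _ h3).
    by rewrite big_ord_recr/= lerDr sumr_ge0.
  rewrite /K mulrCA (_ : 20 * ep * S = ep * (20 * S)); last by ring.
  rewrite ler_wpM2l ?(ltW ep0)//.
  by lra.
exists L1, ms, Lams; split => //.
- exists (V + ep) => s us; apply: powR_sum_approx => //.
  + by have [_ /sumbd_ge0] := H 0%N.
  + by move=> n; exact: nm_ge0.
  move=> eta eta0; pose M := \sum_(n <- s) 2 * K (@character R n).
  have [k Hk] := half_small M eta0; have [_ h _ _ _] := H k.
  exists (fun n => nm (coef (Ls k) n)); split; [by move=> n _; exact: nm_ge0| |exact: h].
  move=> n ns; rewrite -[coef L1 n](subKr (coef (Ls k) n)).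
  apply: le_trans (nmD _ _) _; rewrite lerD2l nmN.
  apply: (le_trans (HL1 _ (smooth_character n) k)); apply: (le_trans _ (Hk k (leqnn k))).
  rewrite ler_wpM2r ?exprn_ge0 ?divr_ge0// /M (big_rem n)//= lerDl; apply: sumr_ge0 => j _.
  by rewrite mulr_ge0// K0//; exact: smooth_character.
- move=> E.
  have tel k : nm (coef (Ls k) n0 - coef L n0) <= ep * (1 - (1 / 2) ^+ k).
    elim: k => [|k IH]; first by rewrite Ls0 subrr nm0 expr0 subrr mulr0.
    have -> : coef (Ls k.+1) n0 - coef L n0 = (coef (Ls k.+1) n0 - coef (Ls k) n0) + (coef (Ls k) n0 - coef L n0) by ring.
    apply: le_trans (nmD _ _) _; have [_ _ /(_ n0) h _ _] := H k.
    by apply: le_trans (lerD h IH) _; rewrite -mulrDr exprS ler_wpM2l ?(ltW ep0)//; lra.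
  suff : nm (coef L n0) <= ep by rewrite /ep; lra.
  apply/ler_addgt0Pl => eta eta0.
  have [k Hk] := half_small (2 * K (@character R n0)) eta0.
  have -> : coef L n0 = (coef (Ls k) n0 - coef L1 n0) - (coef (Ls k) n0 - coef L n0).
    by rewrite E subr0 subKr.
  apply: le_trans (nmD _ _) _; rewrite nmN; apply: lerD.
    by apply: (le_trans (HL1 _ (smooth_character n0) k)); exact: Hk.
  apply: (le_trans (tel k)); rewrite ler_piMr ?(ltW ep0)// gerBl exprn_ge0// divr_ge0.
- by move=> k; have [_ _ _ h _] := H k.
split=> [U HU phi sp hp|k phi sp hp].
- apply: (van phi 0%N) => // j _; suff : vanishes (Ls j) U by apply.
  by elim: j => [|j IH]; [rewrite Ls0|have [_ _ _ _ [h _]] := H j; exact: h].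
- have [_ _ _ _ [_ h]] := H k.
  apply: (van phi k.+1) => // j kj; suff : vanishes (Ls j) [set t | cosum (ms k) (Lams k) t < delta] by apply.
  rewrite -(subnKC kj); elim: (j - k.+1)%N => [|i IH].
    (* Support in the set where the average is below [delta] makes [psi] zero wherever it exceeds
       [delta], which is the form given by the step; later multiplications preserve the
       vanishing. *)
    rewrite addn0 => psi sps hs; apply: h => // t ht; apply: contrapT => pt.
    have /hs /= : fun_support psi t by apply: subset_closure.
    by rewrite ltNge (ltW ht).
  by rewrite addnS; have [_ _ _ _ [h' _]] := H (k.+1 + i)%N; exact: h'.
Qed.

End Limit.

(** * Measures whose coefficients tend to zero *)

Section SignedIntegral.
Context d (T : measurableType d) (R : realType).
Variables mu1 mu2 : {finite_measure set T -> \bar R}.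
Implicit Types (f g : T -> R) (A : set T) (mu : {finite_measure set T -> \bar R}).

Record bm f : Prop := Bm {
  bm_meas : measurable_fun setT f ; bm_bd : exists M : R, forall t, `|f t| <= M }.

Lemma bm_cst (c : R) : bm (fun=> c).
Proof. by split; [exact: measurable_cst|exists `|c|]. Qed.

Lemma bm_D f g : bm f -> bm g -> bm (fun t => f t + g t).
Proof.
move=> [m1 [M1 b1]] [m2 [M2 b2]]; split; first exact: measurable_funD.
by exists (M1 + M2) => t; apply: le_trans (ler_normD _ _) _; apply: lerD.
Qed.

Lemma bm_M f g : bm f -> bm g -> bm (fun t => f t * g t).
Proof.
move=> [m1 [M1 b1]] [m2 [M2 b2]]; split; first exact: measurable_funM.
by exists (M1 * M2) => t; rewrite normrM ler_pM.
Qed.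

Lemma bm_Z (c : R) f : bm f -> bm (fun t => c * f t).
Proof. exact: (bm_M (bm_cst c)). Qed.

Lemma bm_B f g : bm f -> bm g -> bm (fun t => f t - g t).
Proof.
move=> bf bg; have := bm_D bf (bm_Z (-1) bg); congr bm.
by apply/funext => t; rewrite mulN1r.
Qed.

Lemma bm_norm f : bm f -> bm (fun t => `|f t|).
Proof.
move=> [m1 [M1 b1]]; split; last by exists M1 => t; rewrite normr_id.
exact: measurableT_comp.
Qed.

Lemma bm_indic A : measurable A -> bm (\1_A : T -> R).
Proof.
move=> mA; split; first exact: measurable_indic.
by exists 1 => t; rewrite indicE ger0_norm// lern1 leq_b1.
Qed.

Lemma bm_sum (I : Type) (s : seq I) (F : I -> T -> R) : (forall i, bm (F i)) ->
  bm (fun t => \sum_(i <- s) F i t).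
Proof. by move=> H; exact: (closed_fun_sum (bm_cst 0) bm_D). Qed.

Lemma bm_integrable mu f : bm f -> mu.-integrable setT (EFin \o f).
Proof.
move=> [mf [M HM]]; apply: measurable_bounded_integrable => //.
  by rewrite ltey_eq fin_num_measure.
by exists M; split; [exact: num_real|move=> x Mx t _; exact: le_trans (HM t) (ltW Mx)].
Qed.

Definition mass mu A : R := fine (mu A).

Lemma Rint_D mu f g : bm f -> bm g ->
  \int[mu]_t (f t + g t) = \int[mu]_t f t + \int[mu]_t g t.
Proof. by move=> bf bg; rewrite RintegralD//; exact: bm_integrable. Qed.

Lemma Rint_Z mu (c : R) f : bm f ->
  \int[mu]_t (c * f t) = c * \int[mu]_t f t.
Proof. by move=> bf; rewrite RintegralZl//; exact: bm_integrable. Qed.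

Lemma Rint_B mu f g : bm f -> bm g ->
  \int[mu]_t (f t - g t) = \int[mu]_t f t - \int[mu]_t g t.
Proof. by move=> bf bg; rewrite RintegralB//; exact: bm_integrable. Qed.

Lemma Rint_le mu f g : bm f -> bm g ->
  (forall t, f t <= g t) -> \int[mu]_t f t <= \int[mu]_t g t.
Proof. by move=> bf bg H; apply: le_Rintegral => //; exact: bm_integrable. Qed.

Lemma Rint_norm mu f : bm f ->
  `|\int[mu]_t f t| <= \int[mu]_t `|f t|.
Proof. by move=> bf; apply: le_normr_Rintegral => //; exact: bm_integrable. Qed.

Lemma Rint_cst mu (c : R) : \int[mu]_t c = c * mass mu setT.
Proof. by rewrite Rintegral_cst. Qed.

Lemma Rint_indic mu A : measurable A ->
  \int[mu]_t \1_A t = mass mu A.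
Proof. by move=> mA; rewrite /Rintegral integral_indic// setIT. Qed.

(** For the Jordan parts of a charge, [J] is the integral against it and [Nn] the L^1 norm for its
    total variation. *)
Definition J f : R := \int[mu1]_t f t - \int[mu2]_t f t.
Definition Nn f : R := \int[mu1]_t `|f t| + \int[mu2]_t `|f t|.

Lemma J_D f g : bm f -> bm g -> J (fun t => f t + g t) = J f + J g.
Proof. by move=> bf bg; rewrite /J !Rint_D//; ring. Qed.

Lemma J_Z c f : bm f -> J (fun t => c * f t) = c * J f.
Proof. by move=> bf; rewrite /J !Rint_Z//; ring. Qed.

Lemma J_sum (I : Type) (s : seq I) (F : I -> T -> R) : (forall i, bm (F i)) ->
  J (fun t => \sum_(i <- s) F i t) = \sum_(i <- s) J (F i).
Proof.
have J0 : J (fun=> 0) = 0 by rewrite /J !Rint_cst !mul0r subrr.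
exact: (additive_fun_sum (bm_cst 0) bm_D J0 J_D).
Qed.

Lemma J_le f : bm f -> `|J f| <= Nn f.
Proof.
move=> bf; rewrite /J; apply: (le_trans (ler_normB _ _)).
by apply: lerD; exact: Rint_norm.
Qed.

Lemma Nn_le f g : bm f -> bm g -> (forall t, `|f t| <= g t) ->
  Nn f <= \int[mu1]_t g t + \int[mu2]_t g t.
Proof. by move=> bf bg H; apply: lerD; apply: Rint_le => //; exact: bm_norm. Qed.

Variable X : nat -> T -> R.
Hypothesis bX : forall k, bm (X k).
Hypothesis X1 : forall k t, `|X k t| <= 1.

(** [X k] is to be the average Y_k. Goodness says that X k times the signed measure tends to zero
    when tested on [f]. *)
Definition good f := bm f /\ forall ep : R, 0 < ep -> exists k0, forall k, (k0 <= k)%N ->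
  `|J (fun t => X k t * f t)| <= ep.

Lemma good_D f g : good f -> good g -> good (fun t => f t + g t).
Proof.
move=> [bf Hf] [bg Hg]; split; first exact: bm_D.
move=> ep ep0; have ep2 : 0 < ep / 2 by rewrite divr_gt0.
have [k1 h1] := Hf _ ep2; have [k2 h2] := Hg _ ep2.
exists (maxn k1 k2) => k; rewrite geq_max => /andP[hk1 hk2].
have -> : (fun t => X k t * (f t + g t)) = (fun t => X k t * f t + X k t * g t).
  by apply/funext => t; rewrite mulrDr.
rewrite J_D; [|exact: bm_M|exact: bm_M].
by rewrite [ep]splitr (le_trans (ler_normD _ _))// lerD ?h1 ?h2.
Qed.

Lemma good_Z c f : good f -> good (fun t => c * f t).
Proof.
move=> [bf Hf]; split; first exact: bm_Z.
move=> ep ep0; have c1 : 0 < `|c| + 1 by rewrite ltr_wpDl.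
have [k0 h] := Hf _ (divr_gt0 ep0 c1); exists k0 => k /h hk.
have -> : (fun t => X k t * (c * f t)) = (fun t => c * (X k t * f t)).
  by apply/funext => t; rewrite mulrCA.
rewrite J_Z; last exact: bm_M.
rewrite normrM; apply: (@le_trans _ _ ((`|c| + 1) * `|J (fun t => X k t * f t)|)).
  by rewrite ler_wpM2r// lerDl.
by rewrite mulrC -ler_pdivlMr.
Qed.

Lemma good_B f g : good f -> good g -> good (fun t => f t - g t).
Proof.
move=> bf bg; have := good_D bf (good_Z (-1) bg); congr good.
by apply/funext => t; rewrite mulN1r.
Qed.

(** Goodness is closed in [Nn], uniformly in k because [X k] is bounded by 1. *)
Lemma good_approx f : bm f ->
  (forall ep : R, 0 < ep -> exists2 g, good g & Nn (fun t => f t - g t) <= ep) -> good f.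
Proof.
move=> bf H; split=> // ep ep0; have ep2 : 0 < ep / 2 by rewrite divr_gt0.
have [g [bg Hg] hfg] := H _ ep2; have [k0 h] := Hg _ ep2.
exists k0 => k /h hk.
have -> : (fun t => X k t * f t) = (fun t => X k t * g t + X k t * (f t - g t)).
  by apply/funext => t; ring.
have bfg : bm (fun t => f t - g t) by exact: bm_B.
rewrite J_D; [|exact: bm_M|exact: bm_M].
rewrite [ep]splitr (le_trans (ler_normD _ _))// lerD//.
apply: (le_trans _ hfg); apply: (le_trans (J_le (bm_M (bX k) bfg))).
apply: (Nn_le (bm_M (bX k) bfg) (bm_norm bfg)) => t.
by rewrite normrM ler_piMl.
Qed.

Lemma good_sum (I : Type) (s : seq I) (F : I -> T -> R) : good (fun=> 0) -> (forall i, good (F i)) ->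
  good (fun t => \sum_(i <- s) F i t).
Proof. by move=> g0 H; exact: (closed_fun_sum g0 good_D). Qed.

Lemma mass_ge0 mu A : 0 <= mass mu A.
Proof. by rewrite fine_ge0. Qed.

Lemma mass_cvg0 (D : nat -> set T) : (forall n, measurable (D n)) ->
  (forall n m, (n <= m)%N -> D m `<=` D n) -> \bigcap_n D n = set0 ->
  forall ep : R, 0 < ep -> exists n, mass mu1 (D n) + mass mu2 (D n) <= ep.
Proof.
move=> mD dD D0 ep ep0; have ep2 : 0 < ep / 2 by rewrite divr_gt0.
have K mu : exists n0, forall n, (n0 <= n)%N -> mass mu (D n) <= ep / 2.
  have := @nonincreasing_cvg_mu _ T R mu D; rewrite D0 measure0.
  have fin0 : (mu (D 0%N) < +oo)%E by rewrite ltey_eq fin_num_measure.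
  move=> /(_ fin0 mD measurable0) H.
  have /H cv : {homo D : n m / (n <= m)%N >-> (m <= n)%O} by move=> n m nm; apply/subsetPset; exact: dD.
  have /fine_cvgP[_ /cvgrPdist_le /(_ _ ep2) [n0 _ hn]] := cv.
  exists n0 => n n0n; have := hn n n0n; rewrite sub0r normrN => h.
  exact: le_trans (ler_norm _) h.
have [n1 h1] := K mu1; have [n2 h2] := K mu2.
exists (maxn n1 n2); rewrite [leRHS]splitr; apply: lerD; [apply: h1|apply: h2].
  exact: leq_maxl.
exact: leq_maxr.
Qed.

Lemma Nn_indic A : measurable A -> Nn (\1_A) = mass mu1 A + mass mu2 A.
Proof.
move=> mA; rewrite -!Rint_indic// /Nn; congr (_ + _); apply: eq_Rintegral => t _;
  by rewrite indicE ger0_norm.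
Qed.

(** Dynkin's theorem: [G] is stable under intersections, complements come from linearity, and
    disjoint countable unions from closure in [Nn]. *)
Lemma good_measurable (G : set (set T)) : @measurable _ T = <<s G >> -> setI_closed G ->
  good (fun=> 1) -> (forall A, G A -> good (\1_A)) -> forall A, measurable A -> good (\1_A).
Proof.
move=> GE GI g1 gG A mA.
have g0 : good (fun=> 0).
  by have := good_B g1 g1; congr good; apply/funext => t; rewrite subrr.
apply: (@dynkin_induction _ T G (fun A => good (\1_A)) GE GI) => //.
- by rewrite indicT.
- move=> S mS gS; have := good_B g1 gS; congr good; apply/funext => t.
  by rewrite !indicE in_setC; case: (_ \in _); rewrite ?subrr ?subr0.
- move=> F mF tF gF; have mU : measurable (\bigcup_k F k) by exact: bigcupT_measurable.
  apply: good_approx => [|ep ep0]; first exact: bm_indic.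
  pose D n := \bigcup_k F k `\` \big[setU/set0]_(k < n) F k.
  have mB n : measurable (\big[setU/set0]_(k < n) F k) by apply: bigsetU_measurable.
  have mD n : measurable (D n) by exact: measurableD.
  have dD n m : (n <= m)%N -> D m `<=` D n.
    move=> nm t [tU tn]; split=> // tB; apply: tn; move: tB.
    rewrite -!bigcup_mkord => -[k /= kn Fk]; exists k => //=; exact: leq_trans kn nm.
  have D0 : \bigcap_n D n = set0.
    rewrite -subset0 => t Ht; have [[k _ Fk] _] := Ht 0%N I.
    have [_] := Ht k.+1 I; apply; rewrite -bigcup_mkord; exists k => //=.
  have [n hn] := mass_cvg0 mD dD D0 ep0.
  exists (fun t => \sum_(k < n) \1_(F k) t).
    by apply: good_sum.
  apply: (le_trans _ hn); rewrite -Nn_indic//.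
  suff -> : (fun t => \1_(\bigcup_k F k) t - \sum_(k < n) \1_(F k) t) = \1_(D n) :> (T -> R) by [].
  apply/funext => t; rewrite !indicE /D in_setD.
  have -> : \sum_(k < n) (\1_(F k) t : R) = (t \in \big[setU/set0]_(k < n) F k)%:R.
    elim: (n) => [|j IH]; first by rewrite !big_ord0 in_set0.
    rewrite !big_ord_recr/= IH in_setU indicE.
    have [tj|_] := boolP (t \in F j); last by rewrite orbF addr0.
    rewrite orbT (_ : (t \in _) = false) ?add0r//; apply/negbTE/negP; rewrite inE -bigcup_mkord => -[i /= ij Fi].
    have := @trivIsetP _ _ setT F; move=> [/(_ tF i j I I) h _].
    have : (F i `&` F j) t by split=> //; move: tj; rewrite inE.
    by rewrite h// lt_eqF.
  have [tB|tB] := boolP (t \in \big[setU/set0]_(k < n) F k).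
    rewrite (_ : t \in \bigcup_k F k) ?subrr//; move: tB; rewrite !inE -bigcup_mkord => -[k _ Fk].
    by exists k.
  by rewrite subr0 andbT.
- by rewrite -GE.
Qed.

(** On the Hahn set [P] the signed measure is [mu1]. There [X k >= delta] almost everywhere, so the
    integral of [X k] over [P] is at least [delta] times the total mass of [mu1], yet it tends to
    0. *)
Lemma good_null (P : set T) (delta : R) : measurable P -> mu2 P = 0%E -> mu1 (~` P) = 0%E ->
  0 < delta -> (forall k, mu1 [set t | X k t < delta] = 0%E) -> good (\1_P) -> mass mu1 setT = 0.
Proof.
move=> mP P2 P1 d0 HX [bP gP].
have mC : measurable (~` P) by exact: measurableC.
have mXk k : measurable [set t | X k t < delta].
  have := bm_meas (bX k) measurableT (@measurable_itv R `]-oo, delta[).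
  by rewrite setTI set_itvE; congr measurable.
have H k : delta * mass mu1 setT <= `|J (fun t => X k t * \1_P t)|.
  have bXP := bm_M (bX k) bP.
  have E2 : \int[mu2]_t (X k t * \1_P t) = 0.
    apply/eqP; rewrite -normr_eq0 eq_le normr_ge0 andbT.
    apply: (le_trans (Rint_norm mu2 bXP)); have -> : 0 = \int[mu2]_t \1_P t :> R.
      by rewrite Rint_indic// /mass P2.
    apply: Rint_le => // [|t]; first exact: bm_norm.
    by rewrite normrM indicE [X in _ * X]ger0_norm// ler_piMl.
  rewrite /J E2 subr0; apply: (le_trans _ (ler_norm _)).
  pose S := [set t | X k t < delta].
  (* The integrand is a minorant of [X k t * \1_P t]: it equals [delta] off the two null sets and is
     at most -1 on them. *)
  have -> : delta * mass mu1 setT = \int[mu1]_t (delta - (1 + delta) * (\1_S t + \1_(~` P) t)).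
    have bS := bm_indic (mXk k); have bC := bm_indic mC.
    rewrite Rint_B; [|exact: bm_cst|by apply: bm_Z; exact: bm_D].
    rewrite Rint_Z; last exact: bm_D.
    rewrite Rint_D// (Rint_indic mu1 (mXk k)) (Rint_indic mu1 mC).
    rewrite /mass HX P1 /= addr0 mulr0 subr0.
    by rewrite -/(mass mu1 setT) -Rint_cst.
  apply: Rint_le => //.
    apply: bm_B; first exact: bm_cst.
    by apply: bm_Z; apply: bm_D; [exact: (bm_indic (mXk k))|exact: bm_indic].
  move=> t; rewrite !indicE in_setC; have := X1 k t; rewrite ler_norml => /andP[h1 h2].
  have [tS|tS] := boolP (t \in S); have [tP|tP] := boolP (t \in P) => /=; rewrite ?mulr1 ?mulr0 ?addr0 ?add0r; try lra.
  by move: tS; rewrite notin_setE /S /= => /negP; rewrite -leNgt; lra.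
apply/eqP; rewrite eq_le mass_ge0 andbT.
apply/ler_addgt0Pl => ep ep0; rewrite addr0.
have [k0 hk] := gP _ (mulr_gt0 d0 ep0).
by have := le_trans (H k0) (hk k0 (leqnn _)); rewrite ler_pM2l.
Qed.

End SignedIntegral.

(** * Lacunary averages tested against a signed measure on the circle *)

Section CircleMeasure.
Variable R : realType.
Notation C := R[i].
Notation circle := (circle R).
Notation bcircle := (borel_circle R).
Implicit Types (x y : R) (z : C).

Lemma open_circleE (U : set circle) : open U = open (@circle_pi R @^-1` U).
Proof. by []. Qed.

Lemma circle_pi_continuous : continuous (@circle_pi R : R -> circle).
Proof. by apply/continuousP => A oA. Qed.

(** [repr] need not be continuous, but the preimage in R of an open set under the composition is the
    one under [f], by periodicity, and this is openness in the quotient. *)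
Lemma continuous_repr (f : R -> R) : continuous f -> per2pi f ->
  continuous (fun t : circle => f (repr t)).
Proof.
move=> /continuousP cf pf; apply/continuousP => A oA; rewrite open_circleE.
rewrite (_ : _ @^-1` _ = f @^-1` A); first exact: cf.
apply/funext => x; rewrite /preimage/=; have [k ->] := repr_circle_pi x.
by rewrite periodic_int.
Qed.

Lemma circle_compact : compact [set: circle].
Proof.
have -> : [set: circle] = (@circle_pi R : R -> circle) @` `[0, 2 * pi]%classic.
  apply/seteqP; split=> // t _; have [k hk] := mod_2pi (repr t).
  exists (repr t + k%:~R * (2 * pi)); first by rewrite /= in_itv.
  by rewrite -[RHS]circle_pi_repr; apply/circle_piP; exists k; rewrite addrAC subrr add0r.
apply: continuous_compact; last exact: segment_compact.
apply: continuous_subspaceT; exact: circle_pi_continuous.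
Qed.

Lemma bm_repr (f : R -> R) : continuous f -> per2pi f -> bm (fun t : bcircle => f (repr t)).
Proof.
move=> cf pf; split; last by have [M _ HM] := periodic_bounded pf cf; exists M => t; exact: HM.
apply: (measurability _ (RGenOpens.measurableE R)) => _ [_ [a [b ->] <-]].
rewrite setTI; apply: sub_sigma_algebra.
by have /continuousP := continuous_repr cf pf; apply; exact: interval_open.
Qed.

Lemma measurable_open (U : set circle) : open U -> measurable (U : set bcircle).
Proof. by move=> oU; apply: sub_sigma_algebra. Qed.

Definition cosn (n : int) (t : circle) : R := cos (n%:~R * repr t).
Definition sinn (n : int) (t : circle) : R := sin (n%:~R * repr t).

Lemma per2pi_cos : per2pi (@cos R).
Proof. by move=> x; rewrite mulr_natl cosD2pi. Qed.
Lemma per2pi_sin : per2pi (@sin R).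
Proof. by move=> x; rewrite mulr_natl sinD2pi. Qed.

Lemma bm_cosn n : bm (cosn n : bcircle -> R).
Proof.
apply: (@bm_repr (fun x => cos (n%:~R * x))); last exact: per2pi_scale per2pi_cos.
by apply: smoothR_continuous; apply: smoothR_scale; exact: smoothR_cos.
Qed.

Lemma bm_sinn n : bm (sinn n : bcircle -> R).
Proof.
apply: (@bm_repr (fun x => sin (n%:~R * x))); last exact: per2pi_scale per2pi_sin.
by apply: smoothR_continuous; apply: smoothR_scale; exact: smoothR_sin.
Qed.

Lemma cosum_lift m Lam : smoothR (fun x : R => lac m (Lam%:Z%:~R * x) / m%:R) /\
  per2pi (fun x : R => lac m (Lam%:Z%:~R * x) / m%:R).
Proof.
split; last by move=> x; congr (_ / _); apply: (@per2pi_scale R R (@lac R m)); exact: per2pi_lac.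
have /(smoothR_scale (Lam%:Z%:~R : R))/(smoothR_Z m%:R^-1) := smoothR_lac R m.
by congr smoothR; apply/funext => x; rewrite mulrC.
Qed.

Lemma bm_cosum m Lam : bm (@cosum R m Lam : bcircle -> R).
Proof.
have [s p] := cosum_lift m Lam.
exact: (bm_repr (smoothR_continuous s) p).
Qed.

Lemma cosum_continuous m Lam : continuous (@cosum R m Lam).
Proof.
have [s p] := cosum_lift m Lam.
exact: (continuous_repr (smoothR_continuous s) p).
Qed.

Lemma cosum_le1 m Lam t : `|@cosum R m Lam t| <= 1.
Proof.
rewrite /cosum normrM normfV (ger0_norm (ler0n R m)).
have [->|m0] := posnP m; first by rewrite invr0 mulr0.
by rewrite ler_pdivrMr ?ltr0n// mul1r lac_le.
Qed.

Lemma cosumE m Lam t : cosum m Lam t = m%:R^-1 * \sum_(j < m) cosn (10 ^ j * Lam)%N%:Z t.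
Proof.
rewrite /cosum mulrC; congr (_ * _); apply: eq_bigr => j _; rewrite /cosn mulrA; congr (cos (_ * _)).
by rewrite -!pmulrn natrM natrX.
Qed.

Lemma lipschitz_continuous (f : R -> R) (L : R) : 0 <= L ->
  (forall x y, `|f y - f x| <= L * `|y - x|) -> continuous f.
Proof.
move=> L0 H x; apply/cvgrPdist_le => ep ep0; have L1 : 0 < L + 1 by rewrite ltr_wpDl.
near=> y; apply: (le_trans (H y x)).
apply: (@le_trans _ _ ((L + 1) * `|x - y|)); first by rewrite ler_wpM2r// lerDl.
rewrite mulrC -ler_pdivlMr//; near: y; apply: cvgr_dist_le; last exact: divr_gt0.
exact: cvg_id.
Unshelve. all: by end_near. Qed.

(** [b] is the distance to the complement of [V]; a point outside [V] keeps the infimum over a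
    nonempty set. *)
Lemma dist_complement (V : set R) (y0 : R) : open V -> (forall x, V (x + 2 * pi) <-> V x) ->
  ~ V y0 -> exists b : R -> R, [/\ forall x y, `|b y - b x| <= `|y - x|,
    forall x, 0 <= b x, forall x, V x <-> 0 < b x & per2pi b].
Proof.
move=> oV VP Vy0; pose D x := [set `|x - y| | y in ~` V].
have D0 x : D x !=set0 by exists `|x - y0|, y0.
have lD x : has_lbound (D x) by exists 0 => _ [y _ <-].
have bl x y : ~ V y -> inf (D x) <= `|x - y| by move=> Vy; apply: ge_inf => //; exists y.
have L x y : inf (D y) - inf (D x) <= `|y - x|.
  rewrite lerBlDl -lerBlDr; apply: lb_le_inf => // _ [z Vz <-].
  rewrite lerBlDl; apply: (le_trans (bl y z Vz)).
  by rewrite (le_trans _ (ler_normD _ _))// subrKA.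
exists (fun x => inf (D x)); split.
- by move=> x y; rewrite ler_norml lerNl opprB L (distrC y) L.
- by move=> x; apply: lb_le_inf => // _ [y _ <-].
- move=> x; split=> [Vx|h]; last by apply: contrapT => /(bl x); rewrite subrr normr0 leNgt h.
  have [ep /= ep0 hep] := (@nbhs_ballP _ _ x V).1 (open_nbhs_nbhs (conj oV Vx)).
  apply: (lt_le_trans ep0); apply: lb_le_inf => // _ [y Vy <-].
  by rewrite leNgt; apply/negP => h; apply: Vy; apply: hep.
- move=> x; congr inf; apply/seteqP; split=> _ [y Vy <-].
    exists (y - 2 * pi); last by rewrite opprB addrA.
    by move=> h; apply: Vy; rewrite -(subrK (2 * pi) y) VP.
  exists (y + 2 * pi); last by rewrite opprD addrACA subrr addr0.
  by move=> /VP.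
Qed.

Section OneCharge.
Variables mu1 mu2 : {finite_measure set bcircle -> \bar R}.
Variables (ms Lams : nat -> nat).
Hypothesis msP : forall k, (0 < ms k)%N /\ (k <= Lams k)%N.
Hypothesis Jcos : forall ep : R, 0 < ep -> exists N : nat, forall n : int, (N <= `|n|)%N ->
  `|J mu1 mu2 (cosn n)| <= ep.
Hypothesis Jsin : forall ep : R, 0 < ep -> exists N : nat, forall n : int, (N <= `|n|)%N ->
  `|J mu1 mu2 (sinn n)| <= ep.

Let X k : bcircle -> R := cosum (ms k) (Lams k).
Let bX k : bm (X k). Proof. exact: bm_cosum. Qed.
Let X1 k t : `|X k t| <= 1. Proof. exact: cosum_le1. Qed.
Let goodX := good mu1 mu2 X.

(** All frequencies [10 ^ j * Lams k] are at least k, so each term of the average is small on its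
    own and the mean is too. *)
Lemma good_tends (w : nat -> bcircle -> R) (f : bcircle -> R) : bm f -> (forall n, bm (w n)) ->
  (forall k t, X k t * f t = (ms k)%:R^-1 * \sum_(j < ms k) w (10 ^ j * Lams k)%N t) ->
  (forall ep : R, 0 < ep -> exists N : nat, forall n, (N <= n)%N -> `|J mu1 mu2 (w n)| <= ep) -> goodX f.
Proof.
move=> bf bw E H; split=> // ep ep0; have [N HN] := H ep ep0; exists N => k Nk.
have [m0 kL] := msP k.
have -> : (fun t => X k t * f t) = (fun t => (ms k)%:R^-1 * \sum_(j < ms k) w (10 ^ j * Lams k)%N t).
  by apply/funext => t.
rewrite J_Z; last exact: bm_sum.
rewrite J_sum// normrM ger0_norm ?invr_ge0// mulrC ler_pdivrMr ?ltr0n//.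
apply: (le_trans (ler_norm_sum _ _ _)); apply: (@le_trans _ _ (\sum_(j < ms k) ep)).
  apply: ler_sum => j _; apply: HN; apply: (leq_trans Nk); apply: (leq_trans kL).
  by rewrite leq_pmull// expn_gt0.
by rewrite sumr_const card_ord mulr_natr.
Qed.

Lemma J_pair_tends (F G : int -> bcircle -> R) (l : int) (a b : R) :
  (forall n, bm (F n)) -> (forall n, bm (G n)) ->
  (forall ep : R, 0 < ep -> exists N : nat, forall n : int, (N <= `|n|)%N -> `|J mu1 mu2 (F n)| <= ep) ->
  (forall ep : R, 0 < ep -> exists N : nat, forall n : int, (N <= `|n|)%N -> `|J mu1 mu2 (G n)| <= ep) ->
  forall ep : R, 0 < ep -> exists N : nat, forall n : nat, (N <= n)%N ->
  `|J mu1 mu2 (fun t => a * F (n%:Z + l) t + b * G (n%:Z - l) t)| <= ep.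
Proof.
move=> bF bG HF HG ep ep0.
have a1 : 0 < `|a| + 1 by rewrite ltr_wpDl.
have b1 : 0 < `|b| + 1 by rewrite ltr_wpDl.
have [N1 H1] := HF _ (divr_gt0 (divr_gt0 ep0 (ltr0n R 2)) a1).
have [N2 H2] := HG _ (divr_gt0 (divr_gt0 ep0 (ltr0n R 2)) b1).
exists (N1 + N2 + `|l|)%N => n hn.
rewrite J_D; [|exact: bm_Z|exact: bm_Z]; rewrite !J_Z//.
apply: (le_trans (ler_normD _ _)); rewrite [leRHS]splitr; apply: lerD; rewrite normrM.
  apply: (@le_trans _ _ ((`|a| + 1) * `|J mu1 mu2 (F (n%:Z + l))|)).
    by rewrite ler_wpM2r// lerDl.
  by rewrite mulrC -ler_pdivlMr//; apply: H1; lia.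
apply: (@le_trans _ _ ((`|b| + 1) * `|J mu1 mu2 (G (n%:Z - l))|)).
  by rewrite ler_wpM2r// lerDl.
by rewrite mulrC -ler_pdivlMr//; apply: H2; lia.
Qed.

(** The product formula turns cos (n t) cos (l t) into frequencies n + l and n - l, which tend to
    infinity with n. *)
Lemma good_cosn (l : int) : goodX (cosn l).
Proof.
apply: (@good_tends (fun n t => 1 / 2 * cosn (n%:Z + l) t + 1 / 2 * cosn (n%:Z - l) t)).
- exact: bm_cosn.
- by move=> n; apply: bm_D; apply: bm_Z; exact: bm_cosn.
- move=> k t; rewrite /X cosumE -mulrA; congr (_ * _); rewrite mulr_suml; apply: eq_bigr => j _.
  rewrite /cosn !intrD mulrNz !mulrDl mulNr cosD cosB; set a := cos _; set b := cos _; by field.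
- exact: (J_pair_tends l (1 / 2) (1 / 2) bm_cosn bm_cosn Jcos Jcos).
Qed.

Lemma good_sinn (l : int) : goodX (sinn l).
Proof.
apply: (@good_tends (fun n t => 1 / 2 * sinn (n%:Z + l) t + (- (1 / 2)) * sinn (n%:Z - l) t)).
- exact: bm_sinn.
- by move=> n; apply: bm_D; apply: bm_Z; exact: bm_sinn.
- move=> k t; rewrite /X cosumE -mulrA; congr (_ * _); rewrite mulr_suml; apply: eq_bigr => j _.
  rewrite /sinn /cosn !intrD mulrNz !mulrDl !mulNr !sinD sinN cosN; by field.
- exact: (J_pair_tends l (1 / 2) (- (1 / 2)) bm_sinn bm_sinn Jsin Jsin).
Qed.

Lemma good_one : goodX (fun=> 1).
Proof.
have := good_cosn 0; congr good; apply/funext => t.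
by rewrite /cosn mul0r cos0.
Qed.

Lemma good_zero : goodX (fun=> 0).
Proof.
have := good_B bX good_one good_one; congr good.
by apply/funext => t; rewrite subrr.
Qed.

Lemma good_Re_e z (n : int) : goodX (fun t => complex.Re (z * e n (repr t))).
Proof.
have := good_B bX (good_Z bX (complex.Re z) (good_cosn n)) (good_Z bX (complex.Im z) (good_sinn n)).
by congr good; apply/funext => t; rewrite ReM.
Qed.

Lemma Re_sum (I : Type) (s : seq I) (F : I -> C) :
  complex.Re (\sum_(i <- s) F i) = \sum_(i <- s) complex.Re (F i).
Proof. by elim: s => [|i s IH]; rewrite ?big_nil// !big_cons ReD IH. Qed.

(** Fejer means are finite combinations of sines and cosines, and uniform closeness is closeness in
    [Nn] because the total mass is finite. *)
Lemma good_lipschitz (f : R -> R) (L : R) : continuous f -> per2pi f -> 0 <= L ->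
  (forall x y, `|f y - f x| <= L * `|y - x|) -> goodX (fun t => f (repr t)).
Proof.
move=> cf pf L0 H; have bf := bm_repr cf pf.
apply: (good_approx bX X1 bf) => ep ep0.
pose Mt := mass mu1 setT + mass mu2 setT.
have Mt0 : 0 <= Mt by rewrite addr_ge0// mass_ge0.
have Mt1 : 0 < Mt + 1 by rewrite ltr_wpDl.
have [N HN] := fejer_lipschitz cf pf L0 H (divr_gt0 ep0 Mt1).
have {}HN := HN N (leqnn N).
pose g (t : bcircle) := complex.Re (fejer N.+1 (fun x => rc (f x)) (repr t)).
have gE t : g t = mean (fun y => f y * fejer_kernel N.+1 (repr t - y)).
  rewrite /g fejerE; last exact: ccont_real.
  by rewrite /cmean /=; congr mean; apply/funext => y; rewrite mulr0 subr0.
have gg : goodX g.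
  have : goodX (fun t => \sum_(a < N.+1) \sum_(b < N.+1)
     complex.Re (rc N.+1%:R^-1 * fc (fun x => rc (f x)) (a%:Z - b%:Z) * e (a%:Z - b%:Z) (repr t))).
    apply: (good_sum bX) => [|a]; first exact: good_zero.
    by apply: (good_sum bX) => [|b]; [exact: good_zero|exact: good_Re_e].
  congr good; apply/funext => t; rewrite /g /fejer mulr_sumr Re_sum; apply: eq_bigr => a _.
  by rewrite mulr_sumr Re_sum; apply: eq_bigr => b _; rewrite mulrA.
exists g => //; have [bg _] := gg.
apply: (le_trans (@Nn_le _ _ _ mu1 mu2 _ (fun=> ep / (Mt + 1)) (bm_B bf bg) (bm_cst _ _) _)).
  by move=> t; rewrite gE distrC.
rewrite !Rint_cst -mulrDr -/Mt mulrAC ler_pdivrMr// ler_wpM2l ?(ltW ep0)// lerDl//.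
Qed.

Lemma good_open (U : set circle) : open U -> goodX (\1_(U : set bcircle)).
Proof.
move=> oU; pose V := @circle_pi R @^-1` U; have oV : open V by [].
have bU := bm_indic R (measurable_open oU).
have VP x : V (x + 2 * pi) <-> V x.
  have [_ E] := circle_piP (x + 2 * pi) x; rewrite /V /preimage /= E//.
  by exists 1; rewrite mul1r addrAC subrr add0r.
have UV t : (t \in U) = (repr t \in V).
  by apply/idP/idP; rewrite !inE /V /preimage/= circle_pi_repr.
have [VT|[y0 Vy0]] : V = setT \/ exists y, ~ V y.
  have [h|h] := pselect (exists y, ~ V y); first by right.
  by left; rewrite -subTset => y _; apply: contrapT => Vy; apply: h; exists y.
  have := good_one; congr good; apply/funext => t.
  by rewrite indicE UV VT in_setT.
have [b [bL b0 bV bP]] := dist_complement oV VP Vy0.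
(* Lipschitz functions increasing to the indicator of [V]; the error is at most 1 and lives on
   [D n], which decreases to the empty set. *)
pose f n x := Num.min 1 (n.+1%:R * b x).
have fL n x y : `|f n y - f n x| <= n.+1%:R * `|y - x|.
  apply: (@le_trans _ _ `|n.+1%:R * b y - n.+1%:R * b x|).
    rewrite /f; set u := _ * b y; set v := _ * b x.
    have [h1|h1] := leP 1 u; have [h2|h2] := leP 1 v; rewrite !ler_norml; have := ler_norm (u - v); have := ler_norm (v - u); rewrite distrC => *; apply/andP; split; lra.
  by rewrite -mulrBr normrM ger0_norm// ler_pM2l.
have fc n : continuous (f n) by apply: (@lipschitz_continuous _ n.+1%:R) (fL n).
have fp n : per2pi (f n) by move=> x; rewrite /f bP.
have gf n : goodX (fun t => f n (repr t)) by apply: good_lipschitz (fL n).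
pose D n : set bcircle := (fun t => n.+1%:R * b (repr t)) @^-1` `]-oo, 1[%classic `&` U.
have mD n : measurable (D n).
  apply: measurableI; last exact: measurable_open.
  have bn : bm (fun t : bcircle => n.+1%:R * b (repr t)).
    apply: (@bm_repr (fun x => n.+1%:R * b x)); last by move=> x; rewrite bP.
    apply: (@lipschitz_continuous _ n.+1%:R) => // x y.
    by rewrite -mulrBr normrM ger0_norm// ler_pM2l.
  by have := bm_meas bn measurableT (@measurable_itv R `]-oo, 1[); rewrite setTI.
have dD n m : (n <= m)%N -> D m `<=` D n.
  move=> nm t [/=]; rewrite !in_itv/= => h Ut; split=> //=; rewrite in_itv/=.
  by apply: le_lt_trans h; rewrite ler_wpM2r// ler_nat.
have D0 : \bigcap_n D n = set0.
  rewrite -subset0 => t Ht; have [_ Ut] := Ht 0%N I.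
  have /bV bt : V (repr t) by rewrite -in_setE -UV in_setE.
  pose n := Num.Def.truncn (b (repr t))^-1; have [+ _] := Ht n I.
  rewrite /= in_itv/= => h; have := truncnS_gt (b (repr t))^-1; rewrite -/n => h2.
  by move: h2; rewrite -[_^-1]mul1r ltr_pdivrMr// => /(lt_trans h); rewrite ltxx.
apply: (good_approx bX X1 bU) => ep ep0.
have [n hn] := mass_cvg0 mu1 mu2 mD dD D0 ep0.
exists (fun t => f n (repr t)); first exact: gf.
apply: (le_trans _ hn); rewrite -!Rint_indic//; apply: Nn_le => [||t]; [|exact: bm_indic|].
  by have [bfn _] := gf n; exact: bm_B.
rewrite !indicE in_setI UV /f.
have [Vt|Vt] := boolP (repr t \in V); last first.
  have -> : b (repr t) = 0.
    by apply/eqP; rewrite eq_le b0 andbT leNgt; apply/negP => /bV; rewrite -in_setE (negbTE Vt).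
  by rewrite mulr0 andbF min_r// subrr normr0.
rewrite andbT; have [h|h] := leP 1 (n.+1%:R * b (repr t)); first by rewrite subrr normr0 ler0n.
rewrite mem_set/= ?in_itv//=.
have h0 : 0 <= n.+1%:R * b (repr t) by rewrite mulr_ge0.
by rewrite ger0_norm; lra.
Qed.

Lemma good_borel (A : set bcircle) : measurable A -> goodX (\1_A).
Proof. by apply: (good_measurable bX X1 _ (@openI circle) good_one) => // U; exact: good_open. Qed.

End OneCharge.
End CircleMeasure.

(** * Charges with vanishing high frequencies *)

Section ChargeNull.
Variable R : realType.
Notation C := R[i].
Notation circle := (circle R).
Notation bcircle := (borel_circle R).

Definition tends0 (u : int -> R) := forall ep : R, 0 < ep ->
  exists N : nat, forall n : int, (N <= `|n|)%N -> `|u n| <= ep.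

(** The Hahn set chosen inside [charge_integral] is exposed together with the Jordan parts.
    Vanishing of [nu] on all measurable subsets of [A], not only on [A], is what annihilates both
    parts. *)
Lemma charge_integralE (nu : {charge set bcircle -> \bar R}) :
  exists (mu1 mu2 : {finite_measure set bcircle -> \bar R}) (P : set bcircle),
    [/\ measurable P, mu2 P = 0%E, mu1 (~` P) = 0%E,
        forall f, charge_integral nu f = J mu1 mu2 f
      & forall A, measurable A -> (nu A = mu1 A - mu2 A)%E /\
         ((forall B, measurable B -> B `<=` A -> nu B = 0%E) -> mu1 A = 0%E /\ mu2 A = 0%E)].
Proof.
pose HP := cid (Hahn_decomposition nu); pose P := projT1 HP.
pose N := projT1 (cid (projT2 HP)); pose nuPN : hahn_decomposition nu P N := projT2 (cid (projT2 HP)).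
exists (jordan_pos nuPN), (jordan_neg nuPN), P.
have [[mP _] [mN _] PN PN0] := nuPN.
have posE A : measurable A -> jordan_pos nuPN A = nu (A `&` P).
  by move=> mA; rewrite jordan_posE cjordan_posE /crestr0 mem_set.
have negE A : measurable A -> jordan_neg nuPN A = (- nu (A `&` N))%E.
  by move=> mA; rewrite jordan_negE cjordan_negE /crestr0 mem_set.
split=> //.
- by apply: etrans (negE _ mP) _; rewrite PN0 charge0 oppe0.
- by apply: etrans (posE _ (measurableC mP)) _; rewrite setICl charge0.
- move=> A mA; split.
    by rewrite [LHS](jordan_decomp nuPN mA) /cadd /= cscaleN1.
  move=> H; split.
    by apply: etrans (posE _ mA) _; rewrite H//; exact: measurableI.
  by apply: etrans (negE _ mA) _; rewrite H ?oppe0//; exact: measurableI.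
Qed.

Lemma J_swap (mu1 mu2 : {finite_measure set bcircle -> \bar R}) f : J mu2 mu1 f = - J mu1 mu2 f.
Proof. by rewrite /J opprB. Qed.

(** [good_null] is applied twice: to the positive part with [P], and to the negative part with the
    complement of [P] and the two measures exchanged. *)
Lemma charge_null (nu : {charge set bcircle -> \bar R}) (ms Lams : nat -> nat) (delta : R) :
  (forall k, (0 < ms k)%N /\ (k <= Lams k)%N) -> 0 < delta ->
  tends0 (fun n => charge_integral nu (@cosn R n)) -> tends0 (fun n => charge_integral nu (@sinn R n)) ->
  (forall k (B : set bcircle), measurable B -> B `<=` [set t | cosum (ms k) (Lams k) t < delta] -> nu B = 0%E) ->
  forall A : set bcircle, measurable A -> nu A = 0%E.
Proof.
move=> msP d0; have [mu1 [mu2 [P [mP P2 P1 JE HA]]]] := charge_integralE nu.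
move=> tc ts Hnull.
have {}tc : tends0 (fun n => J mu1 mu2 (@cosn R n)).
  by move=> ep /tc[N HN]; exists N => n /HN; rewrite JE.
have {}ts : tends0 (fun n => J mu1 mu2 (@sinn R n)).
  by move=> ep /ts[N HN]; exists N => n /HN; rewrite JE.
have tc' : tends0 (fun n => J mu2 mu1 (@cosn R n)).
  by move=> ep /tc[N HN]; exists N => n /HN; rewrite J_swap normrN.
have ts' : tends0 (fun n => J mu2 mu1 (@sinn R n)).
  by move=> ep /ts[N HN]; exists N => n /HN; rewrite J_swap normrN.
have bX k : bm (cosum (ms k) (Lams k) : bcircle -> R) by exact: bm_cosum.
have mX k : measurable ([set t | cosum (ms k) (Lams k) t < delta] : set bcircle).
  have := bm_meas (bX k) measurableT (@measurable_itv R `]-oo, delta[).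
  by rewrite setTI set_itvE; congr measurable.
have X1 k t : `|cosum (ms k) (Lams k) t| <= 1 :> R by exact: cosum_le1.
have N1 k : mu1 [set t | cosum (ms k) (Lams k) t < delta] = 0%E.
  by have [_ /(_ (Hnull k))[]] := HA _ (mX k).
have N2 k : mu2 [set t | cosum (ms k) (Lams k) t < delta] = 0%E.
  by have [_ /(_ (Hnull k))[]] := HA _ (mX k).
have M1 : mass mu1 setT = 0.
  apply: (good_null bX X1 mP P2 P1 d0 N1).
  exact: (good_borel msP tc ts mP).
have M2 : mass mu2 setT = 0.
  have mC : measurable (~` P) by exact: measurableC.
  have P2' : mu2 (~` ~` P) = 0%E by rewrite setCK.
  apply: (good_null bX X1 mC P1 P2' d0 N2).
  exact: (good_borel msP tc' ts' mC).
have Z (mu : {finite_measure set bcircle -> \bar R}) A : measurable A -> mass mu setT = 0 -> mu A = 0%E.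
  move=> mA m0; have mT : mu setT = 0%E by rewrite -(fineK (fin_num_measure mu setT measurableT)) -/(mass mu setT) m0.
  by apply/eqP; rewrite eq_le measure_ge0 andbT -mT le_measure// inE.
by move=> A mA; have [-> _] := HA A mA; rewrite !Z// sube0.
Qed.
End ChargeNull.

(** * Fourier coefficients and supports of complex measures *)

Section MeasureSide.
Variable R : realType.
Notation C := R[i].
Notation circle := (circle R).
Notation bcircle := (borel_circle R).

Lemma ellP (q : R) (c : int -> C) : ell q c <-> exists B, sumbd (fun n => nm (c n) `^ q) B.
Proof.
have a0 n : (0 <= ((nm (c n)) `^ q)%:E)%E by rewrite lee_fin powR_ge0.
rewrite /ell /summable; under eq_esum do rewrite gee0_abs ?a0//; split.
  move=> h; have fin : \esum_(n in [set: int]) (nm (c n) `^ q)%:E \is a fin_num.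
    by rewrite fin_numElt h andbT; apply: lt_le_trans (esum_ge0 _) => //; exact: ltNyr.
  exists (fine (\esum_(n in [set: int]) (nm (c n) `^ q)%:E)%E) => s us.
  rewrite -lee_fin fineK// -sumEFin; apply: esum_ge.
  exists [set` s]; first by split=> //; exact: finite_seq.
  by rewrite fsbig_seq.
move=> [B hB]; apply: le_lt_trans (ltry B); apply: ge_ereal_sup => _ [A [fA _] <-].
by rewrite fsbig_finite// sumEFin lee_fin; apply: hB; exact: finmap.fset_uniq.
Qed.

Lemma sumbd_tends (q : R) (c : int -> C) B : 0 < q -> sumbd (fun n => nm (c n) `^ q) B ->
  tends0 (fun n => nm (c n)).
Proof.
move=> q0 hB ep ep0; have epq : 0 < ep `^ q by rewrite powR_gt0.
have [N HN] := sumbd_tail (fun n => powR_ge0 (nm (c n)) q) hB epq.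
exists N.+1 => n Nn; rewrite ger0_norm ?nm_ge0//.
rewrite leNgt; apply/negP => h; move: (gt0_ltr_powR q0 (ltW ep0) (nm_ge0 (c n)) h); rewrite ltNge => /negP; apply.
have := HN [:: n]; rewrite big_seq1; apply => // m; by rewrite inE => /eqP ->.
Qed.

Lemma tends0_combine (F1 F2 u v : int -> R) :
  (forall n, `|u n| <= F1 n) -> (forall n, `|v n| <= F2 n) -> tends0 F1 -> tends0 F2 ->
  forall a b, `|a| <= 1 -> `|b| <= 1 -> tends0 (fun n => a * u n + b * v n).
Proof.
move=> hu hv H1 H2 a b a1 b1 ep ep0; have ep2 : 0 < ep / 2 by rewrite divr_gt0.
have [N1 h1] := H1 _ ep2; have [N2 h2] := H2 _ ep2.
exists (N1 + N2)%N => n hn; rewrite [leRHS]splitr; apply: (le_trans (ler_normD _ _)).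
apply: lerD; rewrite normrM; apply: (le_trans (ler_piMl (normr_ge0 _) _)) => //.
  by apply: le_trans (hu n) _; apply: le_trans (ler_norm _) _; apply: h1; lia.
by apply: le_trans (hv n) _; apply: le_trans (ler_norm _) _; apply: h2; lia.
Qed.

Lemma charge_integral_Z (nu : {charge set bcircle -> \bar R}) c f : bm f ->
  charge_integral nu (fun t => c * f t) = c * charge_integral nu f.
Proof.
move=> bf; have [mu1 [mu2 [P [_ _ _ JE _]]]] := charge_integralE nu.
by rewrite !JE J_Z.
Qed.

Lemma meas_fourierE (mu : complex_measure R) n : meas_fourier mu n =
  (charge_integral (re_measure mu) (@cosn R n) + charge_integral (im_measure mu) (@sinn R n)) +i*
  (charge_integral (im_measure mu) (@cosn R n) - charge_integral (re_measure mu) (@sinn R n)).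
Proof.
have E nu : charge_integral nu (fun t => - @sinn R n t) = - charge_integral nu (@sinn R n).
  rewrite -[RHS]mulN1r -charge_integral_Z; last exact: bm_sinn.
  by congr charge_integral; apply/funext => t; rewrite mulN1r.
rewrite /meas_fourier /complex_integral /character /=.
by rewrite !E opprK [X in _ +i* X]addrC.
Qed.

(** Half sums and half differences of the coefficients at n and -n separate cosine from sine
    integrals, and real and imaginary parts of a coefficient then separate the two charges. *)
Lemma meas_fourier_tends (mu : complex_measure R) : tends0 (fun n => nm (meas_fourier mu n)) ->
  [/\ tends0 (fun n => charge_integral (re_measure mu) (@cosn R n)),
      tends0 (fun n => charge_integral (re_measure mu) (@sinn R n)),
      tends0 (fun n => charge_integral (im_measure mu) (@cosn R n)) &
      tends0 (fun n => charge_integral (im_measure mu) (@sinn R n))].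
Proof.
move=> H; have H' : tends0 (fun n => nm (meas_fourier mu (- n))).
  by move=> ep /H[N HN]; exists N => n hn; apply: HN; rewrite abszN.
have cN nu n : charge_integral nu (@cosn R (- n)) = charge_integral nu (@cosn R n).
  by congr charge_integral; apply/funext => t; rewrite /cosn mulrNz mulNr cosN.
have sN nu n : charge_integral nu (@sinn R (- n)) = - charge_integral nu (@sinn R n).
  rewrite -[RHS]mulN1r -charge_integral_Z; last exact: bm_sinn.
  by congr charge_integral; apply/funext => t; rewrite /sinn mulrNz mulNr sinN mulN1r.
have R1 n : `|complex.Re (meas_fourier mu n)| <= nm (meas_fourier mu n) by exact: Re_le_nm.
have R2 n : `|complex.Re (meas_fourier mu (- n))| <= nm (meas_fourier mu (- n)) by exact: Re_le_nm.
have I1 n : `|complex.Im (meas_fourier mu n)| <= nm (meas_fourier mu n) by exact: Im_le_nm.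
have I2 n : `|complex.Im (meas_fourier mu (- n))| <= nm (meas_fourier mu (- n)) by exact: Im_le_nm.
have h : `|1 / 2 : R| <= 1 by rewrite ger0_norm; lra.
have h' : `|- (1 / 2) : R| <= 1 by rewrite normrN.
have := tends0_combine R1 R2 H H' h h; have := tends0_combine R1 R2 H H' h h'.
have := tends0_combine I1 I2 H H' h h; have := tends0_combine I1 I2 H H' h' h.
move=> t1 t2 t3 t4.
split; [move: t4|move: t1|move: t2|move: t3]; congr tends0; apply/funext => n;
  rewrite !meas_fourierE /= !cN !sN; lra.
Qed.

(** The support is defined through an uncountable union of null open sets; on a compact set a finite
    subcover reduces the claim to additivity. *)
Lemma charge_cover (nu : {charge set bcircle -> \bar R}) (F : set circle) : compact F ->
  (forall t, F t -> exists U : set circle, [/\ open U, U t &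
    forall B : set bcircle, measurable B -> B `<=` U -> nu B = 0%E]) ->
  forall B : set bcircle, measurable B -> B `<=` F -> nu B = 0%E.
Proof.
move=> cF HF.
pose U t := if pselect (F t) is left Ft then projT1 (cid (HF t Ft)) else setT.
have UP t : F t -> [/\ open (U t), U t t & forall B : set bcircle, measurable B -> B `<=` U t -> nu B = 0%E].
  by move=> Ft; rewrite /U; case: pselect => // Ft'; case: (cid _).
have [D DF FD] : finite_subset_cover F U F.
  have cF' := cF; rewrite compact_cover in cF'; apply: cF'; first by move=> t /UP[].
  by move=> t Ft; exists t => //; have [] := UP t Ft.
have K (s : seq circle) : (forall t, t \in s -> F t) ->
    forall B : set bcircle, measurable B -> B `<=` \bigcup_(t in [set` s]) U t -> nu B = 0%E.
  elim: s => [_ B mB|t s IH Hs B mB BU].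
    by rewrite set_nil bigcup_set0 subset0 => ->; exact: charge0.
  have [oU Ut nU] := UP t (Hs t (mem_head _ _)).
  have mU : measurable (U t : set bcircle) by exact: measurable_open.
  rewrite (chargeDI nu mB mU) [X in (_ + X)%E]nU ?adde0; [|exact: measurableI|exact: subIsetr].
  apply: IH; [|exact: measurableD|].
    by move=> r rs; apply: Hs; rewrite inE rs orbT.
  move=> r [Br nUr]; have [r' /= +] := BU r Br; rewrite inE => /orP[/eqP ->//|r's] ?.
  by exists r'.
move=> B mB BF; apply: (K (finmap.enum_fset D)) => // [t tD|t Bt].
  by have := DF t; rewrite inE; apply.
by have [t' t'D Ut'] := FD t (BF t Bt); exists t'.
Qed.

End MeasureSide.

(** * The set K_1, its distribution and its measures *)

Theorem theorem4p1 (R : realType) (q : R) (K : set (circle R)) :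
  2 < q ->
  compact K ->
  (exists S : schwartz_distribution R,
     [/\ dist_nonzero S, dist_support S `<=` K & ell q (dist_fourier S)]) ->
  exists K1 : set (circle R),
    [/\ compact K1,
        K1 `<=` K,
        exists S1 : schwartz_distribution R,
          [/\ dist_nonzero S1, dist_support S1 `<=` K1 & ell q (dist_fourier S1)]
      & ~ exists mu : complex_measure R,
          [/\ meas_nonzero mu, meas_support mu `<=` K1 & ell q (meas_fourier mu)]].
Proof.
move=> q2 cK [S [[phi sphi Sphi] supS /ellP[V hV]]].
have dS := schwartz_isdist S.
have [n0 cn0] : exists n0, coef S n0 <> 0.
  apply: contrapT => H; apply: Sphi; apply: (dist_zero dS) => // n.
  by apply: contrapT => h; apply: H; exists n.
have [delta d0 sp] := spread_function q2.
have [L1 [ms [Lams [dL1 hB n1 mL [vL vX]]]]] := dist_limit q2 sp dS hV cn0.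
have [S1 ES1] := isdist_schwartz dL1; subst L1.
have cX k (I : set R) : closed I -> closed [set t | I (cosum (ms k) (Lams k) t)].
  by move=> cI; apply: (continuous_closedP _).1 => //; exact: cosum_continuous.
pose K1 := K `&` \bigcap_k [set t | delta <= cosum (ms k) (Lams k) t].
exists K1; split.
- apply: compact_closedI => //; apply: closed_bigI => k _.
  exact: (cX k _ (@closed_ge _ delta)).
- by move=> t [].
- exists S1; split; last exact/ellP.
    by exists (character n0) => //; exact: smooth_character.
  move=> t tS; split=> [|k _] /=.
    apply: contrapT => nK; apply: tS.
    have : ~ dist_support S t by move/supS.
    move=> /contrapT[U [oU vU] Ut]; exists U => //; split=> //; exact: vL.
  rewrite leNgt; apply/negP => h; apply: tS.
  exists [set t | cosum (ms k) (Lams k) t < delta] => //; split; last exact: vX.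
  have /continuousP/(_ _ (@open_lt _ delta)) := @cosum_continuous R (ms k) (Lams k).
  exact.
- move=> [mu [[A mA nA] supmu /ellP[B hBmu]]].
  (* The set where the average is at most [delta / 2] is compact and misses [K1], so [charge_cover]
     applies to it; the open set where it is below [delta] need not be compact. *)
  have d2 : 0 < delta / 2 by rewrite divr_gt0.
  have q0 : 0 < q by lra.
  have [t1 t2 t3 t4] := meas_fourier_tends (sumbd_tends q0 hBmu).
  have cF k : compact [set t | cosum (ms k) (Lams k) t <= delta / 2].
    have := compact_closedI (@circle_compact R) (cX k _ (@closed_le _ (delta / 2))).
    by rewrite setTI.
  have HF k t : cosum (ms k) (Lams k) t <= delta / 2 -> exists U : set (circle R), [/\ open U, U t &
      forall B : set (borel_circle R), measurable B -> B `<=` U ->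
        re_measure mu B = 0%E /\ im_measure mu B = 0%E].
    move=> ht; have : ~ meas_support mu t.
      by move=> /supmu[_ /(_ k I)] /=; lra.
    move=> /contrapT[U [oU vU] Ut]; exists U; split=> // D mD DU.
    have [/= r0 i0] := vU D mD DU.
    by rewrite -(fineK (fin_num_measure (re_measure mu) D mD)) -(fineK (fin_num_measure (im_measure mu) D mD)) r0 i0.
  have Nre k (D : set (borel_circle R)) : measurable D ->
      D `<=` [set t | cosum (ms k) (Lams k) t < delta / 2] -> re_measure mu D = 0%E.
    move=> mD Dk; apply: (charge_cover (cF k)) => // [t /HF[U [oU Ut h]]|t /Dk /ltW//].
    by exists U; split=> // D' mD' /h[].
  have Nim k (D : set (borel_circle R)) : measurable D ->
      D `<=` [set t | cosum (ms k) (Lams k) t < delta / 2] -> im_measure mu D = 0%E.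
    move=> mD Dk; apply: (charge_cover (cF k)) => // [t /HF[U [oU Ut h]]|t /Dk /ltW//].
    by exists U; split=> // D' mD' /h[].
  apply: nA; rewrite /cmeas.
  by rewrite (charge_null mL d2 t1 t2 Nre mA) (charge_null mL d2 t3 t4 Nim mA).
Qed.
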